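(* Let $d\ge 2$, $\kappa\in\mathbb R$, and $k\in\{0,\ldots,d-1\}$. Let $\xi\sim \mathrm N(0,1)$ be a standard normal random variable, let $\ell\in(0,\infty)$, and put $C:=C_\kappa(\ell)$, where $C_\kappa(\ell)=\cosh(\sqrt{-\kappa}\,\ell)$ if $\kappa<0$, $C_\kappa(\ell)=1$ if $\kappa=0$, and $C_\kappa(\ell)=\cos(\sqrt\kappa\,\ell)$ if $\kappa>0$. 1. Suppose that the regular simplex $\Delta_\ell^d(\kappa)$ of geodesic edge length $\ell$ exists, and let $F$ be a $k$-dimensional face of it. Then $$\gamma_\kappa\bigl(F,\Delta_\ell^d(\kappa)\bigr)=\mathbb E\left[\Phi\left(\sqrt{\frac{C}{1+kC}}\,\xi\right)^{d-k}\right],\qquad \beta_\kappa\bigl(F,\Delta_\ell^d(\kappa)\bigr)=\mathbb E\left[\Phi\left(\sqrt{-\frac{C}{1+dC}}\,\xi\right)^{d-k}\right].$$ 2. Suppose that the regular cube $\Box_\ell^d(\kappa)$ of geodesic edge length $\ell$ exists, and let $F$ be a $k$-dimensional face of it. Then $$\gamma_\kappa\bigl(F,\Box_\ell^d(\kappa)\bigr)=\mathbb E\left[\Phi\left(\sqrt{\frac{C-1}{2+k(C-1)}}\,\xi\right)^{d-k}\right],\qquad \beta_\kappa\bigl(F,\Box_\ell^d(\kappa)\bigr)=\mathbb E\left[\Phi\left(\sqrt{-\frac{C-1}{2+d(C-1)}}\,\xi\right)^{d-k}\right].$$ Moreover, if $\kappa<0$, the angle formulas for the ideal regular simplex $\Delta^d_\infty(\kappa)$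 and the ideal regular cube $\Box_\infty^d(\kappa)$ are obtained by letting $C\to\infty$: for $k\in\{1,\ldots,d-1\}$, the external angle at each $k$-dimensional face of either polytope equals $\mathbb E\bigl[\Phi(\xi/\sqrt k)^{d-k}\bigr]$, and the internal angle equals $\mathbb E\bigl[\Phi(\mathrm i\,\xi/\sqrt d)^{d-k}\bigr]$.
   Context: Klein model. $\mathbb B^d(\kappa):=\mathbb R^d$ if $\kappa\ge0$ and $\mathbb B^d(\kappa):=\{x\in\mathbb R^d:\|x\|<1/\sqrt{-\kappa}\}$ if $\kappa<0$; $\bar{\mathbb B}^d(\kappa)$ is its Euclidean closure. The tangent space at $x\in\mathbb B^d(\kappa)$ is identified with $\mathbb R^d$ and carries the inner product $$g_x(u,v)=\frac{\langle u,v\rangle}{1+\kappa\|x\|^2}-\frac{\kappa\langle x,u\rangle\langle x,v\rangle}{(1+\kappa\|x\|^2)^2}.$$ The geodesic distance is $\rho_\kappa(x,y)=\|x-y\|$ for $\kappa=0$, and, with $q=\frac{1+\kappa\langle x,y\rangle}{\sqrt{(1+\kappa\|x\|^2)(1+\kappa\|y\|^2)}}$, it is $\frac1{\sqrt\kappa}\arccos q$ for $\kappa>0$ and $\frac1{\sqrt{-\kappa}}\operatorname{arcosh} q$ for $\kappa<0$. Polytopes and angles. A polytope is the Euclidean convex hull of finitely many points of $\bar{\mathbb B}^d(\kappa)$; (nonempty) faces, relative interiors and dimensions are Euclidean. Let $P=\{y:\langle a_r,y\rangle\le b_r,\ r=1,\ldots,m\}$ be a full-dimensional polytope with irredundant inequalities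 ($a_r\neq 0$), $F\ne P$ a face, and $I(F)=\{r:\langle a_r,y\rangle=b_r\ \forall y\in F\}$. For $x\in\operatorname{relint}(F)\cap\mathbb B^d(\kappa)$ put $T_x(F,P)=\{u\in\mathbb R^d:\langle a_r,u\rangle\le0\ \forall r\in I(F)\}$ and $N_x(F,P)=\{v\in\mathbb R^d: g_x(v,u)\le0\ \forall u\in T_x(F,P)\}$. For a polyhedral cone $K$ in $(\mathbb R^d,g_x)$ with linear hull $L$, its solid angle $\alpha_x(K)$ is the ratio of the $(\dim L)$-dimensional volume of $K\cap B$ to that of $L\cap B$, where $B$ is the unit ball and volume is taken with respect to $g_x$ ($\alpha_x(\{0\})=1$). The internal angle is $\beta_\kappa(F,P):=\alpha_x(T_x(F,P))$ and the external angle is $\gamma_\kappa(F,P):=\alpha_x(N_x(F,P))$; they do not depend on the choice of $x$. Regular polytopes. $\Delta_\ell^d(\kappa)\subseteq \mathbb B^d(\kappa)$ is a $d$-dimensional simplex whose vertices have pairwise geodesic distance $\ell$. $\Box_\ell^d(\kappa)=[-\tau,\tau]^d\subseteq\mathbb B^d(\kappa)$ is the cube (centred at the origin, $\tau>0$) whose adjacent vertices have geodesic distance $\ell$. For $\kappa<0$, $\Delta_\infty^d(\kappa)$ is a Euclidean regular $d$-simplex centred at the origin with all vertices on $\partial\mathbb B^d(\kappa)$, and $\Box_\infty^d(\kappa)=[-\frac1{\sqrt{-\kappa d}},\frac1{\sqrt{-\kappa d}}]^d$. $\Phi$ is the entire function $\Phi(z)=\frac12+\frac1{\sqrt{2\pi}}\int_0^z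 e^{-t^2/2}\,dt$, $z\in\mathbb C$. Convention: $\mathrm i=\sqrt{-1}$ and $\sqrt{-a}:=\mathrm i\sqrt a$ for $a>0$. *)

(* Defs.v *)
From HB Require Import structures.
From mathcomp Require Import all_boot all_order all_algebra.
From mathcomp Require Import all_classical all_reals all_analysis.
From mathcomp Require Import complex.

Set Implicit Arguments.
Unset Strict Implicit.
Unset Printing Implicit Defensive.

Import Order.TTheory GRing.Theory Num.Theory.
Import numFieldNormedType.Exports.

Local Open Scope classical_set_scope.
Local Open Scope ring_scope.
Local Open Scope complex_scope.

Section euclidean.
Context {R : realType} {d : nat}.
Implicit Types (u v x y : 'rV[R]_d) (A F P : set 'rV[R]_d).

Definition dotv u v : R := \sum_i u 0 i * v 0 i.

(* The library norm on ['rV[R]_d] is the sup norm. *)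
Definition enorm u : R := Num.sqrt (dotv u u).

Definition convex_hull n (v : 'I_n -> 'rV[R]_d) : set 'rV[R]_d :=
  [set y | exists w : 'I_n -> R,
    [/\ forall i, 0 <= w i, \sum_i w i = 1 & y = \sum_i w i *: v i]].

Definition affinely_independent n (v : 'I_n -> 'rV[R]_d) :=
  forall w : 'I_n -> R,
    \sum_i w i = 0 -> \sum_i w i *: v i = 0 -> forall i, w i = 0.

Definition is_linear_hull A (V : {vspace 'rV[R]_d}) :=
  (forall u, A u -> u \in V) /\
  (forall W : {vspace 'rV[R]_d}, (forall u, A u -> u \in W) -> (V <= W)%VS).

Definition linear_hull A : {vspace 'rV[R]_d} := xget 0%VS [set V | is_linear_hull A V].

(* [is_linear_hull A] is always inhabited, so the default value is never used. *)
Lemma linear_hullP A : is_linear_hull A (linear_hull A).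
Proof.
rewrite /linear_hull; case: xgetP => [V _ //|noV]; exfalso.
pose Q n := `[< exists V : {vspace 'rV[R]_d},
                 (forall u, A u -> u \in V) /\ \dim V = n >].
have exQ : exists n, Q n.
  by exists (\dim {:'rV[R]_d}); apply/asboolP; exists fullv;
    split=> // u _; rewrite memvf.
have [n /asboolP[V [AV dV]] nmin] := ex_minnP exQ.
apply: (noV V); split=> // W AW.
have : Q (\dim (V :&: W)%VS).
  apply/asboolP; exists (V :&: W)%VS; split=> // u Au.
  by rewrite memv_cap AV // AW.
move=> /nmin; rewrite -dV => VW; apply/capv_idPl/eqP.
by rewrite eqEdim capvSl.
Qed.

(* The direction space of the affine hull of [A]. *)
Definition direction A : {vspace 'rV[R]_d} :=
  linear_hull [set u | exists y z, [/\ A y, A z & u = y - z]].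

Definition affine_dim A : nat := \dim (direction A).

Definition relint A : set 'rV[R]_d :=
  [set x | A x /\ exists2 e : R, 0 < e &
    forall y, y - x \in direction A -> enorm (y - x) < e -> A y].

Definition is_face F P :=
  F !=set0 /\ exists (c : 'rV[R]_d) (t : R),
    (forall y, P y -> dotv c y <= t) /\ F = P `&` [set y | dotv c y = t].

Definition polyhedron m (a : 'I_m -> 'rV[R]_d) (b : 'I_m -> R) : set 'rV[R]_d :=
  [set y | forall r, dotv (a r) y <= b r].

Definition irredundant_Hrep P m (a : 'I_m -> 'rV[R]_d) (b : 'I_m -> R) :=
  [/\ P = polyhedron a b,
      forall r, a r != 0 &
      forall r, exists2 y, ~ P y & forall s, s != r -> dotv (a s) y <= b s].

Definition tangent_cone m (a : 'I_m -> 'rV[R]_d) (b : 'I_m -> R) F :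
    set 'rV[R]_d :=
  [set u | forall r, (forall y, F y -> dotv (a r) y = b r) -> dotv (a r) u <= 0].

End euclidean.

(* Lebesgue measure of a Borel subset of R^n as an iterated integral: the step
   is the formula of the library's product measure [lebesgue_measure \x _]. *)
Fixpoint volume {R : realType} (n : nat) : set (n.-tuple R) -> \bar R :=
  match n with
  | 0 => fun A => (\1_A [tuple])%:E
  | n'.+1 => fun A =>
      (\int[lebesgue_measure]_(t in [set: R])
         volume [set y : n'.-tuple R | A (cons_tuple (t : R) y)])%E
  end.

Section klein.
Context {R : realType} {d : nat} (kappa : R).
Implicit Types (u v x y : 'rV[R]_d) (K S F : set 'rV[R]_d).

Definition klein_ball : set 'rV[R]_d :=
  [set x | 0 <= kappa \/ enorm x < (Num.sqrt (- kappa))^-1].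

Definition klein_metric x u v : R :=
  dotv u v / (1 + kappa * enorm x ^+ 2)
  - kappa * dotv x u * dotv x v / (1 + kappa * enorm x ^+ 2) ^+ 2.

Definition arcosh (q : R) : R := ln (q + Num.sqrt (q ^+ 2 - 1)).

Definition geodesic_dist x y : R :=
  let q := (1 + kappa * dotv x y) /
    Num.sqrt ((1 + kappa * enorm x ^+ 2) * (1 + kappa * enorm y ^+ 2)) in
  if kappa == 0 then enorm (x - y)
  else if 0 < kappa then acos q / Num.sqrt kappa
  else arcosh q / Num.sqrt (- kappa).

(* Volume on the subspace [L] for the restriction of the inner product
   [klein_metric x]: in linear coordinates, Lebesgue measure times the square root of
   the Gram determinant of the basis. *)
Definition metric_volume x (L : {vspace 'rV[R]_d}) S : \bar R :=
  let e := vbasis L in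
  let coords := [set t : (\dim L).-tuple R | S (\sum_i tnth t i *: tnth e i)] in
  let gram := \matrix_(i, j) klein_metric x (tnth e i) (tnth e j) in
  ((Num.sqrt (\det gram))%:E * volume coords)%E.

Definition solid_angle x K : R :=
  let L := linear_hull K in
  let B := [set u | klein_metric x u u <= 1] in
  fine (metric_volume x L (K `&` B)) /
  fine (metric_volume x L ([set u | u \in L] `&` B)).

Definition normal_cone x m (a : 'I_m -> 'rV[R]_d) (b : 'I_m -> R) F :
    set 'rV[R]_d :=
  [set v | forall u, tangent_cone a b F u -> klein_metric x v u <= 0].

Definition internal_angle x m (a : 'I_m -> 'rV[R]_d) (b : 'I_m -> R) F : R :=
  solid_angle x (tangent_cone a b F).

Definition external_angle x m (a : 'I_m -> 'rV[R]_d) (b : 'I_m -> R) F : R :=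
  solid_angle x (normal_cone x a b F).

Definition regular_simplex (l : R) (v : 'I_d.+1 -> 'rV[R]_d) :=
  [/\ affinely_independent v, convex_hull v `<=` klein_ball &
      forall i j, i != j -> geodesic_dist (v i) (v j) = l].

Definition ideal_regular_simplex (v : 'I_d.+1 -> 'rV[R]_d) :=
  [/\ affinely_independent v,
      exists s, forall i j, i != j -> enorm (v i - v j) = s,
      \sum_i v i = 0 &
      forall i, enorm (v i) = (Num.sqrt (- kappa))^-1].

Definition cube (tau : R) : set 'rV[R]_d :=
  [set y | forall i, - tau <= y 0 i <= tau].

Definition cube_vertex (tau : R) : set 'rV[R]_d :=
  [set v | forall i, v 0 i = tau \/ v 0 i = - tau].

Definition adjacent u v :=
  exists i, u 0 i <> v 0 i /\ forall j, j != i -> u 0 j = v 0 j.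

Definition regular_cube (l tau : R) :=
  [/\ 0 < tau, cube tau `<=` klein_ball &
      forall u v, cube_vertex tau u -> cube_vertex tau v -> adjacent u v ->
        geodesic_dist u v = l].

Definition ideal_cube : set 'rV[R]_d :=
  cube (Num.sqrt (- kappa * d%:R))^-1.

End klein.

Section gaussian.
Context {R : realType}.

Definition expC (z : R[i]) : R[i] :=
  (expR (complex.Re z))%:C * (cos (complex.Im z) +i* sin (complex.Im z)).

(* The path integral from 0 to [z] is taken along the segment [s |-> s z]. *)
Definition Phi (z : R[i]) : R[i] :=
  let f (s : R) := expC (- (s%:C * z) ^+ 2 / 2) * z in
  2^-1 + ((Num.sqrt (2 * pi))^-1)%:C *
    ((\int[lebesgue_measure]_(s in `[0, 1]) complex.Re (f s)) +i*
     (\int[lebesgue_measure]_(s in `[0, 1]) complex.Im (f s))).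

Definition sqrt_real (a : R) : R[i] :=
  if 0 <= a then (Num.sqrt a)%:C else 0 +i* Num.sqrt (- a).

Definition curvature_cos (kappa l : R) : R :=
  if kappa < 0 then
    (expR (Num.sqrt (- kappa) * l) + expR (- (Num.sqrt (- kappa) * l))) / 2
  else if kappa == 0 then 1
  else cos (Num.sqrt kappa * l).

Context d (T : measurableType d) (Pr : probability T R).

(* Laws are only compared on measurable sets: the values of the library's
   measures elsewhere are irrelevant. *)
Definition standard_normal (xi : {RV Pr >-> R}) :=
  forall A, measurable A -> distribution Pr xi A = normal_prob 0 1 A.

Definition has_mean (Z : T -> R[i]) (c : R[i]) :=
  [/\ Pr.-integrable setT (fun w => (complex.Re (Z w))%:E),
      Pr.-integrable setT (fun w => (complex.Im (Z w))%:E),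
      'E_Pr[fun w => complex.Re (Z w)]%E = (complex.Re c)%:E &
      'E_Pr[fun w => complex.Im (Z w)]%E = (complex.Im c)%:E].

End gaussian.

(* Main.v *)
(** At a relative interior point of a face, the tangent cone is spanned by vectors
    [E i] with [<E i, E j> = delta_ij + mu * s_i * s_j], [s_i] being 0 or 1, where the
    coefficient of [E i] is free if [s_i = 0] and nonnegative if [s_i = 1];
    the normal cone has the same shape.  Comparing the unit ball with a Gaussian
    weight, the solid angle of such a cone is the ratio of the integrals of
    [exp (- mu * (t_1 + ... + t_k) ^ 2 / 2)] against a standard Gaussian vector over
    the orthant and over the whole space.  Writing this exponential as
    [E exp (sqrt (- mu) * xi * (t_1 + ... + t_k))] makes the inner integral a product,
    and each factor is a multiple of [Phi (sqrt (- mu) * xi)], with an imaginary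
    argument for [mu > 0]; absorbing the remaining weight [exp (c * xi ^ 2)] rescales
    [xi].  After rescaling, the facet normals have constant pairwise products:
    for the simplex, because the Gram matrix of the barycentric functionals is
    the inverse, up to the factor [kappa], of [1 + kappa * <v i, v j>]. *)

From HB Require Import structures.
Require Import Defs.
From mathcomp Require Import all_boot all_order all_algebra.
From mathcomp Require Import all_classical all_reals all_analysis.
From mathcomp Require Import measurable_realfun.
From mathcomp Require Import complex.
From mathcomp Require Import ring lra.

Set Implicit Arguments.
Unset Strict Implicit.
Unset Printing Implicit Defensive.

Import Order.TTheory GRing.Theory Num.Theory.
Import numFieldNormedType.Exports.

Local Open Scope classical_set_scope.
Local Open Scope ring_scope.

(** Nothing in a solid angle has to be computed absolutely: numerator and denominator of
    [solid_angle] share the Gram factor of the chosen basis, the Jacobian of the change to [E] and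
    the radial constant of the Gaussian comparison, so these factors only have to be finite and
    nonzero. The representation [a], [b] of the polytope is arbitrary; the tangent cone is therefore
    identified with the directions feasible at [x], which depend on the polytope alone, and explicit
    facet normals then replace [a]. Both angles come from one computation: if the rescaled normals
    at a face have Gram matrix [1 + lam J] ([J] all ones, size [n]), their dual basis has [1 + mu J]
    with [mu = - lam / (1 + n lam)], and [lam |-> mu] is an involution. The condition
    [1 + n lam > 0] is inherited from positive definiteness of the metric at [x]. The sign of [mu]
    decides the analysis: for [mu <= 0] all integrands are nonnegative and Tonelli suffices; for
    [mu > 0] the argument of [Phi] is imaginary, [Phi] is unbounded there, and only its product with
    a Gaussian factor is bounded. *)

Section density.
Local Open Scope ereal_scope.
Context d (T : measurableType d) (R : realType).
Variables mu nu : {measure set T -> \bar R}.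
Variable p : T -> R.
Hypothesis mp : measurable_fun setT p.
Hypothesis p0 : forall x, (0 <= p x)%R.
Hypothesis nuE : forall A, measurable A -> nu A = \int[mu]_(x in A) (p x)%:E.

Import HBNNSimple.

Let integral_density_indic A : measurable A ->
  \int[nu]_x (\1_A x)%:E = \int[mu]_x ((\1_A x)%:E * (p x)%:E).
Proof.
move=> mA; rewrite integral_indic// setIT nuE// integral_mkcond.
apply: eq_integral => x _; rewrite patchE indicE.
by case: ifPn => _; rewrite ?mul1e ?mul0e.
Qed.

Let integral_density_nnsfun (f : {nnsfun T >-> R}) :
  \int[nu]_x (f x)%:E = \int[mu]_x ((f x)%:E * (p x)%:E).
Proof.
under [LHS]eq_integral do rewrite fimfunE -fsumEFin//.
rewrite [LHS]ge0_integral_fsum//; last 2 first.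
- by move=> r; apply/measurable_EFinP/measurableT_comp.
- by move=> n x _; rewrite EFinM nnfun_muleindic_ge0.
transitivity (\sum_(r \in range f)
    \int[mu]_x ((r * \1_(f @^-1` [set r]) x)%:E * (p x)%:E)); last first.
  rewrite -ge0_integral_fsum//; last 2 first.
  - move=> r; apply: emeasurable_funM => //; apply/measurable_EFinP => //.
    by apply: measurableT_comp.
  - move=> n x _; apply: mule_ge0; last by rewrite lee_fin.
    by rewrite EFinM nnfun_muleindic_ge0.
  apply: eq_integral => x _.
  rewrite [in RHS]fimfunE -fsumEFin// ge0_mule_fsuml// => r.
  by rewrite EFinM nnfun_muleindic_ge0.
apply: eq_fsbigr => r _.
have [r0|r0] := leP 0%R r; last first.
  rewrite !integral0_eq// => x _.
  - by rewrite preimage_nnfun0// indicE in_set0 mulr0 mul0e.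
  - by rewrite preimage_nnfun0// indicE in_set0 mulr0.
under eq_integral do rewrite EFinM.
rewrite ge0_integralZl//; last by exact/measurable_EFinP.
under [in RHS]eq_integral do rewrite EFinM -muleA.
rewrite ge0_integralZl//; last 2 first.
- by apply: emeasurable_funM => //; apply/measurable_EFinP.
- by move=> x _; rewrite mule_ge0// lee_fin.
by rewrite integral_density_indic.
Qed.

(** Monotone convergence on both sides along the same simple approximation; multiplication by the
    finite number [p x] preserves monotonicity and limits. *)
Lemma ge0_integral_density (f : T -> \bar R) : measurable_fun setT f ->
  (forall x, 0 <= f x) -> \int[nu]_x f x = \int[mu]_x (f x * (p x)%:E).
Proof.
move=> mf f0; pose f_ := nnsfun_approx measurableT mf.
transitivity (limn (fun n => \int[nu]_x (f_ n x)%:E)).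
  rewrite -monotone_convergence//=.
  - by apply: eq_integral => x _; apply/esym/cvg_lim => //; exact: cvg_nnsfun_approx.
  - by move=> n; exact/measurable_EFinP.
  - by move=> n x _; rewrite lee_fin.
  - by move=> x _ a b ab; rewrite lee_fin; have /lefP := nd_nnsfun_approx measurableT mf ab; apply.
transitivity (limn (fun n => \int[mu]_x ((f_ n x)%:E * (p x)%:E))).
  by congr (limn _); apply/funext => n; exact: integral_density_nnsfun.
rewrite -monotone_convergence//=.
- apply: eq_integral => x _; apply/cvg_lim => //; apply: cvgeZr => //.
  exact: cvg_nnsfun_approx.
- by move=> n; apply: emeasurable_funM => //; apply/measurable_EFinP.
- by move=> n x _; rewrite mule_ge0// lee_fin.
- move=> x _ a b ab; rewrite lee_wpmul2r ?lee_fin//.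
  by have /lefP := nd_nnsfun_approx measurableT mf ab; apply.
Qed.

Let density_funepos (f : T -> \bar R) x :
  ((fun x => f x * (p x)%:E)^\+ x = f^\+ x * (p x)%:E)%E.
Proof. by rewrite !funeposE maxe_pMl ?lee_fin// mul0e. Qed.

Let density_funeneg (f : T -> \bar R) x :
  ((fun x => f x * (p x)%:E)^\- x = f^\- x * (p x)%:E)%E.
Proof. by rewrite !funenegE maxe_pMl ?lee_fin// mul0e mulNe. Qed.

Lemma integrable_density (f : T -> \bar R) : measurable_fun setT f ->
  nu.-integrable setT f <-> mu.-integrable setT (fun x => f x * (p x)%:E).
Proof.
move=> mf; have mfp : measurable_fun setT (fun x => f x * (p x)%:E).
  by apply: emeasurable_funM => //; exact/measurable_EFinP.
suff E : \int[nu]_x `|f x| = \int[mu]_x `|f x * (p x)%:E|.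
  by split => /integrableP[_ h]; apply/integrableP; split; rewrite // ?E// -E.
rewrite ge0_integral_density//; last exact: measurableT_comp.
by apply: eq_integral => x _; rewrite abseM [X in _ = _ * X]gee0_abs ?lee_fin.
Qed.

Lemma integral_density (f : T -> \bar R) : measurable_fun setT f ->
  \int[nu]_x f x = \int[mu]_x (f x * (p x)%:E).
Proof.
move=> mf; rewrite integralE [RHS]integralE.
rewrite !ge0_integral_density//; [|exact: measurable_funeneg|exact: measurable_funepos].
by congr (_ - _); apply: eq_integral => x _; rewrite ?density_funepos ?density_funeneg.
Qed.

End density.

(** * Lebesgue measure on tuples *)

Section power_measure.
Local Open Scope ereal_scope.
Context d (T : measurableType d) (R : realType).

Lemma measurable_cons_tuple n :
  measurable_fun [set: T * n.-tuple T] (fun ty => cons_tuple ty.1 ty.2).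
Proof. exact: (measurable_cons measurable_fst measurable_snd). Qed.

Lemma measurable_cons_tupler n (t : T) :
  measurable_fun [set: n.-tuple T] (fun y => cons_tuple t y).
Proof. exact: (measurableT_comp (@measurable_cons_tuple n) (pair1_measurable t)). Qed.

Lemma measurable_cons_tuplel n (y : n.-tuple T) :
  measurable_fun [set: T] (fun t => cons_tuple t y).
Proof. exact: (measurableT_comp (@measurable_cons_tuple n) (pair2_measurable y)). Qed.

Section step.
Variables (n : nat) (m1 : {sigma_finite_measure set T -> \bar R})
  (m2 : {sigma_finite_measure set (n.-tuple T) -> \bar R}).

(** The product measure is carried to tuples so that the construction can be iterated; the first
    factor becomes the outermost variable, as in [volume]. *)
Definition cons_measure : set (n.+1.-tuple T) -> \bar R :=
  pushforward (m1 \x m2) (fun ty => cons_tuple ty.1 ty.2).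

HB.instance Definition _ := Measure.copy cons_measure
  (measure_function_pushforward__canonical__measure_function_Measure
    (m1 \x m2) (@measurable_cons_tuple n)).

Let cons_measure_sigma_finite : sigma_finite [set: n.+1.-tuple T] cons_measure.
Proof.
have /sigma_finiteP[F [TF ndF Foo]] := sigma_finiteT m1.
have /sigma_finiteP[G [TG ndG Goo]] := sigma_finiteT m2.
(* [unc] inverts the cons map, so the sets [F k] times [G k], pulled back along it, exhaust the
   tuples and keep their finite product measure. *)
pose unc (y : n.+1.-tuple T) : T * n.-tuple T := (thead y, [tuple of behead y]).
have munc : measurable_fun setT unc.
  apply/measurable_fun_pairP; split.
    exact: (measurable_tnth ord0).
  exact: measurable_behead.
exists (fun k => unc @^-1` (F k `*` G k)).
  rewrite -preimage_bigcup -(preimage_setT unc); congr (unc @^-1` _).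
  rewrite -setXTT TF TG predeqE => -[x y]; split.
    move=> [/= [i _ Fix] [k _ Gky]]; exists (maxn i k) => //; split.
    - by move: x Fix; exact/subsetPset/ndF/leq_maxl.
    - by move: y Gky; exact/subsetPset/ndG/leq_maxr.
  by move=> [i _ []/= ? ?]; split; exists i.
move=> k; have [mFk Fky] := Foo k; have [mGk Gky] := Goo k; split.
  by rewrite -[X in measurable X]setTI; apply: munc => //; exact: measurableX.
rewrite /cons_measure /pushforward -comp_preimage.
rewrite (_ : unc \o _ = id) ?preimage_id; last first.
  by apply/funext => -[t y] /=; rewrite /unc /thead tnth0; congr pair; exact: val_inj.
by rewrite product_measure1E// lte_mul_pinfty// ge0_fin_numE.
Qed.

HB.instance Definition _ := Measure_isSigmaFinite.Build _ _ _ cons_measure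
  cons_measure_sigma_finite.

Lemma ge0_integral_cons_measure1 (f : n.+1.-tuple T -> \bar R) :
  measurable_fun setT f -> (forall y, 0 <= f y) ->
  \int[cons_measure]_y f y = \int[m1]_t \int[m2]_y f (cons_tuple t y).
Proof.
move=> mf f0; rewrite ge0_integral_pushforward//=; last first.
  exact: measurable_cons_tuple.
rewrite preimage_setT fubini_tonelli1//.
by apply: measurableT_comp => //; exact: measurable_cons_tuple.
Qed.

Lemma ge0_integral_cons_measure2 (f : n.+1.-tuple T -> \bar R) :
  measurable_fun setT f -> (forall y, 0 <= f y) ->
  \int[cons_measure]_y f y = \int[m2]_y \int[m1]_t f (cons_tuple t y).
Proof.
move=> mf f0; rewrite ge0_integral_pushforward//=; last first.
  exact: measurable_cons_tuple.
rewrite preimage_setT fubini_tonelli2//.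
by apply: measurableT_comp => //; exact: measurable_cons_tuple.
Qed.

Lemma measurable_integral_cons (f : n.+1.-tuple T -> \bar R) :
  measurable_fun setT f -> (forall y, 0 <= f y) ->
  measurable_fun setT (fun t => \int[m2]_y f (cons_tuple t y)).
Proof.
move=> mf f0; apply: (@measurable_fun_fubini_tonelli_F _ _ T (n.-tuple T) R m2
  (fun ty => f (cons_tuple ty.1 ty.2))) => //.
by apply: measurableT_comp => //; exact: measurable_cons_tuple.
Qed.

Lemma integral_cons_measure1 (f : n.+1.-tuple T -> \bar R) :
  cons_measure.-integrable setT f ->
  \int[cons_measure]_y f y = \int[m1]_t \int[m2]_y f (cons_tuple t y).
Proof.
move=> intf.
have mf : measurable_fun setT f by exact: measurable_int intf.
have mfc : measurable_fun setT (f \o fun ty : T * n.-tuple T => cons_tuple ty.1 ty.2).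
  by apply: measurableT_comp => //; exact: measurable_cons_tuple.
have intfc : (m1 \x m2).-integrable setT
    (f \o fun ty : T * n.-tuple T => cons_tuple ty.1 ty.2).
  apply/integrableP; split => //.
  move/integrableP : intf => [_]; rewrite ge0_integral_pushforward//=.
  - exact: measurable_cons_tuple.
  - by apply: measurableT_comp.
rewrite integral_pushforward//=; last exact: measurable_cons_tuple.
by rewrite preimage_setT -integral12_prod_meas1.
Qed.

End step.

Section dirac_step.

Definition nil_measure := [the {sigma_finite_measure set (0.-tuple T) -> \bar R} of
  dirac [tuple] : {measure set (0.-tuple T) -> \bar R}].

End dirac_step.

(** Generic in [m], because it is used both for Lebesgue measure ([tuple_volume]) and for the normal
    law ([tuple_gauss]). *)
Fixpoint power_measure (m : {sigma_finite_measure set T -> \bar R}) n :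
    {sigma_finite_measure set (n.-tuple T) -> \bar R} :=
  match n with
  | 0 => nil_measure
  | n'.+1 => cons_measure m (power_measure m n')
  end.

End power_measure.

Section lebesgue_tuple.
Context {R : realType}.
Local Notation mu := (@lebesgue_measure R).
Local Open Scope ereal_scope.

Section affine.
Variables (a b : R).

Let affine (x : measurableTypeR R) : measurableTypeR R := (a * x + b)%R.

Let measurable_affine : measurable_fun setT affine.
Proof.
apply: (@measurable_funD _ _ R setT (fun x : R => a * x)%R (cst b)) => //.
exact: measurable_funM.
Qed.

Let affine_measure : {measure set (measurableTypeR R) -> \bar R} :=
  mscale (NngNum (normr_ge0 a))
    (measure_function_pushforward__canonical__measure_function_Measure
      mu measurable_affine).

Hypothesis a0 : (a != 0)%R.

Let preimage_phi_itv (x y : R) : (x < y)%R ->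
  mu (affine @^-1` `]x, y]) = (`|a|^-1 * (y - x))%:E.
Proof.
move=> xy; have [a_gt0|a_lt0|aE] := ltgtP 0%R a.
- rewrite (_ : affine @^-1` _ = `]((x - b) / a)%R, ((y - b) / a)%R]%classic).
    rewrite lebesgue_measure_itv/= lte_fin ltr_pM2r ?invr_gt0// ltrD2r xy.
    by rewrite -EFinD gtr0_norm//; congr EFin; field.
  apply/seteqP; split => t /=; rewrite !in_itv/= /affine;
    by rewrite ltr_pdivrMr// ler_pdivlMr// ltrBlDr lerBrDr (mulrC t).
- rewrite (_ : affine @^-1` _ = `[((y - b) / a)%R, ((x - b) / a)%R[%classic).
    rewrite lebesgue_measure_itv/= lte_fin ltr_nM2r ?invr_lt0// ltrD2r xy.
    by rewrite -EFinD ltr0_norm//; congr EFin; field.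
  apply/seteqP; split => t /=; rewrite !in_itv/= /affine;
    by rewrite ltr_ndivlMr// ler_ndivrMr// ltrBlDr lerBrDr (mulrC t) andbC.
- by move: a0; rewrite -aE eqxx.
Qed.

(** Lebesgue measure is determined by its values on half-open intervals; a negative [a] swaps the
    closed and the open end of the preimage, which leaves its length unchanged. *)
Let nuE A : measurable A -> mu A = affine_measure A.
Proof.
apply: lebesgue_measure_unique => X /ocitvP[->|[[x y]/= xy ->]].
  by rewrite !measure0.
rewrite /affine_measure /= /mscale/= /pushforward preimage_phi_itv//.
rewrite lebesgue_measure_itv/= lte_fin xy -EFinM mulrA divff ?normr_eq0// mul1r.
by rewrite -EFinD.
Qed.

Lemma ge0_integral_lebesgue_affine (f : R -> \bar R) :
  measurable_fun setT f -> (forall x, 0 <= f x) ->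
  \int[mu]_x f (a * x + b)%R = (`|a|^-1)%:E * \int[mu]_x f x.
Proof.
move=> mf f0.
rewrite [in RHS](eq_measure_integral affine_measure); last by move=> A mA _; exact: nuE.
rewrite ge0_integral_mscale//= muleA -EFinM mulVf ?normr_eq0// mul1e.
by rewrite ge0_integral_pushforward// preimage_setT.
Qed.

End affine.

Definition tuple_volume n :
    {sigma_finite_measure set (n.-tuple (measurableTypeR R)) -> \bar R} :=
  power_measure (mu : {sigma_finite_measure set (measurableTypeR R) -> \bar R}) n.

Lemma ge0_integral_tuple_volumeS1 n (f : n.+1.-tuple R -> \bar R) :
  measurable_fun setT f -> (forall y, 0 <= f y) ->
  \int[tuple_volume n.+1]_y f y =
  \int[mu]_t \int[tuple_volume n]_y f (cons_tuple t y).
Proof.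
exact: (@ge0_integral_cons_measure1 _ (measurableTypeR R) R n mu (tuple_volume n) f).
Qed.

Lemma ge0_integral_tuple_volumeS2 n (f : n.+1.-tuple R -> \bar R) :
  measurable_fun setT f -> (forall y, 0 <= f y) ->
  \int[tuple_volume n.+1]_y f y =
  \int[tuple_volume n]_y \int[mu]_t f (cons_tuple t y).
Proof.
exact: (@ge0_integral_cons_measure2 _ (measurableTypeR R) R n mu (tuple_volume n) f).
Qed.

Lemma integral_tuple_volume0 (f : 0.-tuple R -> \bar R) :
  measurable_fun setT f -> \int[tuple_volume 0]_y f y = f [tuple].
Proof. by move=> mf; rewrite [LHS]integral_dirac// diracT mul1e. Qed.

Lemma measurable_integral_tuple_volume n (f : n.+1.-tuple R -> \bar R) :
  measurable_fun setT f -> (forall y, 0 <= f y) ->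
  measurable_fun [set: R] (fun t => \int[tuple_volume n]_y f (cons_tuple t y)).
Proof.
exact: (@measurable_integral_cons _ (measurableTypeR R) R n (tuple_volume n) f).
Qed.

(** Measurability lets Tonelli identify the iterated integral with a genuine measure, so that
    changes of variables apply to [volume]. *)
Lemma volumeE n (A : set (n.-tuple R)) : measurable A ->
  volume A = tuple_volume n A.
Proof.
elim: n A => [|n IH] A mA /=.
  by rewrite diracE indicE.
rewrite -[A in RHS]setIT -integral_indic//= ge0_integral_cons_measure1//=; last first.
  exact/measurable_EFinP/measurable_indic.
apply: eq_integral => t _.
have mAt : measurable ((fun y : n.-tuple R => cons_tuple t y) @^-1` A).
  by rewrite -[X in measurable X]setTI; exact: measurable_cons_tupler.
by rewrite IH//= -[X in tuple_volume n X]setIT -integral_indic.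
Qed.

Opaque tuple_volume.

(** Tuples carry the sigma-algebra and rows the matrix product; [row_of] and [tuple_of] pass between
    the two. *)
Definition row_of n (t : n.-tuple R) : 'rV[R]_n := (\row_i tnth t i)%R.
Definition tuple_of n (r : 'rV[R]_n) : n.-tuple R := [tuple r 0%R i | i < n].

Lemma row_ofK n : cancel (@row_of n) (@tuple_of n).
Proof. by move=> t; apply: eq_from_tnth => i; rewrite tnth_mktuple mxE. Qed.

Lemma tuple_ofK n : cancel (@tuple_of n) (@row_of n).
Proof. by move=> r; apply/rowP => i; rewrite mxE tnth_mktuple. Qed.

Lemma row_of_cons n t (y : n.-tuple R) :
  @row_of (1 + n) (cons_tuple t y) = row_mx t%:M%R (row_of y).
Proof.
apply/rowP => i; rewrite mxE; case: (split_ordP i) => j ->.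
  rewrite row_mxEl ord1 mxE eqxx mulr1n.
  by rewrite (_ : lshift n 0%R = ord0) ?tnth0//; exact: val_inj.
rewrite row_mxEr mxE (_ : rshift 1 j = lift ord0 j) ?tnthS//.
exact: val_inj.
Qed.

Lemma tuple_of_cons n t (y : 'rV[R]_n) :
  @tuple_of (1 + n) (row_mx t%:M%R y) = cons_tuple t (tuple_of y).
Proof. by rewrite -(row_ofK (cons_tuple _ _)) row_of_cons tuple_ofK. Qed.

Lemma tuple_of_cons_add n t (y : n.-tuple R) (v : 'rV[R]_(1 + n)) :
  @tuple_of (1 + n) (@row_of (1 + n) (cons_tuple t y) + v)%R =
  cons_tuple (t + v 0 0)%R (tuple_of (row_of y + rsubmx v)%R).
Proof.
rewrite row_of_cons -[v in LHS]hsubmxK add_row_mx [lsubmx v]mx11_scalar.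
rewrite -raddfD/= tuple_of_cons mxE.
by congr (cons_tuple (_ + v _ _)%R _); exact: val_inj.
Qed.

Lemma tuple_of_cons_scale n t (y : n.-tuple R) r :
  @tuple_of (1 + n) (r *: @row_of (1 + n) (cons_tuple t y))%R =
  cons_tuple (r * t)%R (tuple_of (r *: row_of y)%R).
Proof.
by rewrite row_of_cons scale_row_mx scale_scalar_mx tuple_of_cons.
Qed.

Lemma measurable_tuple_of d (T : measurableType d) n (g : T -> 'rV[R]_n) :
  (forall i, measurable_fun setT (fun x => g x 0%R i)) ->
  measurable_fun setT (fun x => tuple_of (g x)).
Proof.
move=> mg; apply/measurable_fun_tnthP => i.
rewrite (_ : _ \o _ = fun x => g x 0%R i); first exact: mg.
by apply/funext => x /=; rewrite tnth_mktuple.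
Qed.

Lemma measurable_row_of n (i : 'I_n) :
  measurable_fun [set: n.-tuple R] (fun t => row_of t 0%R i).
Proof.
rewrite (_ : (fun t => _) = (@tnth n R)^~ i); first exact: measurable_tnth.
by apply/funext => t; rewrite mxE.
Qed.

Lemma measurable_row_of_mul n p (M : 'M[R]_(n, p)) i :
  measurable_fun [set: n.-tuple R] (fun t => (row_of t *m M)%R 0%R i).
Proof.
rewrite (_ : (fun t => _) = fun t => (\sum_j row_of t 0 j * M j i)%R).
  apply: measurable_sum => j; apply: measurable_funM => //.
  exact: measurable_row_of.
by apply/funext => t; rewrite mxE.
Qed.

Lemma ge0_integral_translate n (v : 'rV[R]_n) (f : n.-tuple R -> \bar R) :
  measurable_fun setT f -> (forall t, 0 <= f t) ->
  \int[tuple_volume n]_t f (tuple_of (row_of t + v)%R) = \int[tuple_volume n]_t f t.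
Proof.
elim: n v f => [|n IH] v f mf f0.
  by apply: eq_integral => t _; congr f; apply: eq_from_tnth => -[].
have mtr : measurable_fun setT (fun t : n.+1.-tuple R => tuple_of (row_of t + v)%R).
  apply: measurable_tuple_of => i; under eq_fun do rewrite mxE.
  by apply: measurable_funD => //; exact: measurable_row_of.
rewrite ge0_integral_tuple_volumeS1; [|exact: measurableT_comp|by []].
rewrite ge0_integral_tuple_volumeS1; [|by []|by []].
pose F (t : R) := \int[tuple_volume n]_y f (cons_tuple t y).
transitivity (\int[mu]_t F (1 * t + v 0 ord0)%R); last first.
  rewrite ge0_integral_lebesgue_affine ?oner_neq0//.
  - by rewrite normr1 invr1 mul1e.
  - exact: measurable_integral_tuple_volume.
  - by move=> t; exact: integral_ge0.
apply: eq_integral => t _.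
rewrite /F -[RHS](IH (rsubmx (v : 'rV[R]_(1 + n)))).
- apply: eq_integral => y _; congr f.
  by apply: etrans (tuple_of_cons_add t y v) _; rewrite mul1r.
- by apply: measurableT_comp => //; exact: measurable_cons_tupler.
- by [].
Qed.

Lemma ge0_integral_scale n  (r : R) (f : n.-tuple R -> \bar R) : (0 < r)%R ->
  measurable_fun setT f -> (forall t, 0 <= f t) ->
  \int[tuple_volume n]_t f (tuple_of (r *: row_of t)%R) =
  (r ^- n)%:E * \int[tuple_volume n]_t f t.
Proof.
move=> r0; elim: n f => [|n IH] f mf f0.
  rewrite expr0 invr1 mul1e.
  by apply: eq_integral => t _; congr f; apply: eq_from_tnth => -[].
have mtr : measurable_fun setT (fun t : n.+1.-tuple R => tuple_of (r *: row_of t)%R).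
  apply: measurable_tuple_of => i; under eq_fun do rewrite mxE.
  by apply: measurable_funM => //; exact: measurable_row_of.
rewrite ge0_integral_tuple_volumeS1; [|exact: measurableT_comp|by []].
rewrite ge0_integral_tuple_volumeS1; [|by []|by []].
pose F (t : R) := \int[tuple_volume n]_y f (cons_tuple t y).
have mF : measurable_fun setT F.
  exact: measurable_integral_tuple_volume.
have F0 t : 0 <= F t by exact: integral_ge0.
transitivity (\int[mu]_t ((r ^- n)%:E * F (r * t + 0)%R)); last first.
  rewrite ge0_integralZl//.
  - rewrite ge0_integral_lebesgue_affine ?gt_eqF// gtr0_norm// muleA -EFinM.
    by rewrite exprSr invfM.
  - apply: measurableT_comp => //; exact: measurable_funD.
  - by rewrite lee_fin invr_ge0 exprn_ge0// ltW.
apply: eq_integral => t _.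
rewrite /F -[RHS]IH.
- apply: eq_integral => y _; congr f.
  by apply: etrans (tuple_of_cons_scale t y r) _; rewrite addr0.
- by apply: measurableT_comp => //; exact: measurable_cons_tupler.
- by [].
Qed.

Definition tuple_mulmx n (M : 'M[R]_n) (t : n.-tuple R) : n.-tuple R :=
  tuple_of (row_of t *m M)%R.

Lemma measurable_tuple_mulmx n (M : 'M[R]_n) :
  measurable_fun setT (tuple_mulmx M).
Proof.
apply: measurable_tuple_of => i; exact: measurable_row_of_mul.
Qed.

(** The constant is the inverse of [|det M|], but it cancels in every solid angle, so only its
    existence and positivity are kept. *)
Definition scales_volume n (M : 'M[R]_n) := exists2 c : R, (0 < c)%R &
  forall f : n.-tuple R -> \bar R, measurable_fun setT f -> (forall t, 0 <= f t) ->
  \int[tuple_volume n]_t f (tuple_mulmx M t) = c%:E * \int[tuple_volume n]_t f t.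

Lemma scales_volumeM n (M N : 'M[R]_n) :
  scales_volume M -> scales_volume N -> scales_volume (M *m N)%R.
Proof.
move=> [c c0 Mc] [e e0 Ne]; exists (c * e)%R; first exact: mulr_gt0.
move=> f mf f0; rewrite EFinM -muleA -Ne// -Mc//.
  by apply: eq_integral => t _; rewrite /tuple_mulmx tuple_ofK mulmxA.
by apply: measurableT_comp => //; exact: measurable_tuple_mulmx.
Qed.

Lemma tuple_mulmx_block n a b c D t (y : n.-tuple R) :
  tuple_mulmx (block_mx a%:M%R b c D : 'M[R]_(1 + n)) (cons_tuple t y) =
  cons_tuple (a * t + (row_of y *m c) 0 0)%R (tuple_of (t *: b + row_of y *m D)%R).
Proof.
rewrite /tuple_mulmx row_of_cons mul_row_block -tuple_of_cons.
congr (tuple_of (row_mx _ _)).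
  rewrite -scalar_mxM [X in (_ + X)%R]mx11_scalar -raddfD/=.
  by rewrite (mulrC a).
by rewrite mul_scalar_mx.
Qed.

(** This shear moves the first coordinate by an amount depending only on the others; integrating it
    innermost leaves one-dimensional translation invariance. The upper shear is treated with the
    opposite order of integration. *)
Lemma scales_volume_lower n c :
  scales_volume (block_mx 1%:M 0 c 1%:M : 'M[R]_(1 + n))%R.
Proof.
exists 1%R => // f mf f0; rewrite mul1e.
rewrite ge0_integral_tuple_volumeS2; [| |by []]; last first.
  by apply: measurableT_comp => //; exact: measurable_tuple_mulmx.
rewrite ge0_integral_tuple_volumeS2; [|by []|by []].
apply: eq_integral => y _.
under eq_integral do rewrite tuple_mulmx_block scaler0 add0r mulmx1 row_ofK.
rewrite (ge0_integral_lebesgue_affine _ _ (f := fun t => f (cons_tuple t y))) ?oner_neq0//.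
  by rewrite normr1 invr1 mul1e.
by apply: measurableT_comp => //; exact: measurable_cons_tuplel.
Qed.

Lemma scales_volume_upper n b :
  scales_volume (block_mx 1%:M b 0 1%:M : 'M[R]_(1 + n))%R.
Proof.
exists 1%R => // f mf f0; rewrite mul1e.
rewrite ge0_integral_tuple_volumeS1; [| |by []]; last first.
  by apply: measurableT_comp => //; exact: measurable_tuple_mulmx.
rewrite ge0_integral_tuple_volumeS1; [|by []|by []].
apply: eq_integral => t _.
under eq_integral do rewrite tuple_mulmx_block mulmx0 mxE addr0 mul1r mulmx1 addrC.
rewrite (ge0_integral_translate _ (f := fun y => f (cons_tuple t y)))//.
by apply: measurableT_comp => //; exact: measurable_cons_tupler.
Qed.

Lemma scales_volume_diag n a (D : 'M[R]_n) : a != 0%R -> scales_volume D ->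
  scales_volume (block_mx a%:M 0 0 D : 'M[R]_(1 + n))%R.
Proof.
move=> a0 [c c0 Dc]; exists (`|a|^-1 * c)%R.
  by rewrite mulr_gt0// invr_gt0 normr_gt0.
move=> f mf f0.
rewrite ge0_integral_tuple_volumeS1; [| |by []]; last first.
  by apply: measurableT_comp => //; exact: measurable_tuple_mulmx.
rewrite ge0_integral_tuple_volumeS1; [|by []|by []].
pose F (t : R) := \int[tuple_volume n]_y f (cons_tuple t y).
have mF : measurable_fun setT F.
  exact: measurable_integral_tuple_volume.
have F0 t : 0 <= F t by exact: integral_ge0.
transitivity (\int[mu]_t (c%:E * F (a * t + 0)%R)); last first.
  rewrite ge0_integralZl//.
  - by rewrite ge0_integral_lebesgue_affine// muleA -EFinM mulrC.
  - apply: measurableT_comp => //; exact: measurable_funD.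
  - by rewrite lee_fin ltW.
apply: eq_integral => t _; rewrite -Dc//.
  apply: eq_integral => y _; rewrite tuple_mulmx_block mulmx0 mxE.
  by rewrite scaler0 add0r.
by apply: measurableT_comp => //; exact: measurable_cons_tupler.
Qed.

(** Gaussian elimination: a nonzero pivot splits the matrix into a lower shear, a block diagonal
    matrix and an upper shear, and the induction hypothesis applies to the remaining block. A zero
    pivot is first repaired by one more shear. *)
Lemma scales_volume_unitmx n (M : 'M[R]_n) : M \in unitmx -> scales_volume M.
Proof.
elim: n M => [|n IH] M uM.
  exists 1%R => // f mf f0; rewrite mul1e; apply: eq_integral => t _; congr f.
  by apply: eq_from_tnth => -[].
have pivot (N : 'M[R]_(1 + n)) : N \in unitmx -> (ulsubmx N 0 0 != 0)%R ->
    scales_volume N.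
  move=> uN a0; set a := (ulsubmx N 0 0)%R in a0.
  pose b := ursubmx N; pose c := dlsubmx N; pose D := drsubmx N.
  (* The Schur complement of the pivot; it is invertible because [N] is. *)
  pose D' := (D - c *m (a^-1 *: b))%R.
  have NE : N = (block_mx 1%:M 0 (a^-1 *: c) 1%:M *m block_mx a%:M 0 0 D' *m
      block_mx 1%:M (a^-1 *: b) 0 1%:M)%R.
    rewrite !mulmx_block !(mulmx0, mul0mx, mulmx1, mul1mx, addr0, add0r).
    rewrite -[LHS]submxK mul_mx_scalar scalerA divff// scale1r.
    rewrite mul_scalar_mx scalerA divff// scale1r.
    rewrite /D' addrC subrK [ulsubmx _]mx11_scalar.
    by rewrite -/a -/b -/c -/D.
  have uD' : D' \in unitmx.
    move: uN; rewrite NE !unitmx_mul => /andP[/andP[_ +] _].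
    by rewrite !unitmxE det_ublock unitrM => /andP[].
  rewrite NE; apply: scales_volumeM; last exact: scales_volume_upper.
  apply: scales_volumeM; first exact: scales_volume_lower.
  by apply: scales_volume_diag => //; exact: IH.
suff main (N : 'M[R]_(1 + n)) : N \in unitmx -> scales_volume N by exact: main.
move=> uN; have [a0|a0] := eqVneq (ulsubmx N 0 0)%R 0%R; last exact: pivot.
have [i ci0] : exists i, dlsubmx N i 0%R != 0%R.
  apply/existsP; apply: contraT => /existsPn c0; exfalso.
  have N0 : (N *m (col_mx 1%:M 0 : 'cV[R]_(1 + n)) = 0)%R.
    rewrite -[N]submxK mul_block_col !mulmx1 !mulmx0 !addr0.
    rewrite (_ : ulsubmx _ = 0)%R; last first.
      by apply/matrixP => j k; rewrite !ord1 a0 mxE.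
    rewrite (_ : dlsubmx _ = 0)%R ?col_mx0//.
    apply/matrixP => j k; rewrite ord1 [RHS]mxE; apply/eqP.
    by have := c0 j; rewrite negbK.
  have := mulKmx uN (col_mx 1%:M 0 : 'cV[R]_(1 + n))%R.
  rewrite N0 mulmx0 => /matrixP/(_ (lshift _ 0) 0)%R.
  by rewrite col_mxEu !mxE eqxx => /eqP; rewrite eq_sym oner_eq0.
(* [S] adds row [i] of the lower block to the first row, whose leading entry becomes
   [dlsubmx N i 0]; [S'] undoes this. *)
pose S := (block_mx 1%:M (delta_mx 0 i) 0 1%:M : 'M[R]_(1 + n))%R.
pose S' := (block_mx 1%:M (- delta_mx 0 i) 0 1%:M : 'M[R]_(1 + n))%R.
have SS : (S' *m S = 1%:M)%R.
  rewrite mulmx_block !(mulmx0, mul0mx, mulmx1, mul1mx, addr0, add0r) subrr.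
  by rewrite -scalar_mx_block.
rewrite -[N]mul1mx -SS -mulmxA; apply: scales_volumeM.
  exact: scales_volume_upper.
apply: pivot.
  by rewrite unitmx_mul uN andbT; have /mulmx1_unit[] := SS.
rewrite -[N]submxK mulmx_block block_mxKul mul1mx mxE a0 add0r.
by rewrite -rowE mxE.
Qed.

End lebesgue_tuple.

(** * Gaussian measure on tuples and volumes of cones *)

Lemma measurable_indic_comp d1 d2 (T1 : measurableType d1)
    (T2 : measurableType d2) (R : realType) (A : set T2) (phi : T1 -> T2) :
  measurable A -> measurable_fun setT phi ->
  measurable_fun setT (fun x => \1_A (phi x) : R).
Proof.
move=> mA mphi; rewrite (_ : (fun x => _) = \1_(phi @^-1` A)).
  by apply: measurable_indic; rewrite -[X in measurable X]setTI; exact: mphi.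
by apply/funext => x; rewrite !indicE.
Qed.

Section gaussian_cone.
Context {R : realType}.
Local Notation mu := (@lebesgue_measure R).
Local Open Scope ereal_scope.

Lemma normal_pdf1E (m x : R) :
  (normal_pdf m 1 x = (Num.sqrt (2 * pi))^-1 * expR (- (x - m) ^+ 2 / 2))%R.
Proof.
rewrite normal_pdfE ?oner_neq0// /normal_peak /normal_fun expr1n mul1r.
by rewrite mulr_natl.
Qed.

Lemma std_normal_pdfE (x : R) :
  (normal_pdf 0 1 x = (Num.sqrt (2 * pi))^-1 * expR (- x ^+ 2 / 2))%R.
Proof. by rewrite normal_pdf1E subr0. Qed.

Lemma sqrt2pi_gt0 : (0 < Num.sqrt (2 * pi) :> R)%R.
Proof. by rewrite sqrtr_gt0 mulr_gt0 ?pi_gt0. Qed.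

Definition std_normal : probability (measurableTypeR R) R := normal_prob 0 1.

Lemma ge0_integral_std_normal (f : R -> \bar R) :
  measurable_fun setT f -> (forall x, 0 <= f x) ->
  \int[std_normal]_x f x = \int[mu]_x (f x * (normal_pdf 0 1 x)%:E).
Proof.
move=> mf f0; apply: (ge0_integral_density (mu := mu)) => //.
- exact: measurable_normal_pdf.
- by move=> x; exact: normal_pdf_ge0.
Qed.

Lemma ge0_integral_lebesgue_gauss (f : R -> \bar R) :
  measurable_fun setT f -> (forall x, 0 <= f x) ->
  \int[mu]_x ((expR (- x ^+ 2 / 2))%:E * f x) =
  (Num.sqrt (2 * pi))%:E * \int[std_normal]_x f x.
Proof.
move=> mf f0; rewrite ge0_integral_std_normal//.
rewrite -ge0_integralZl//=.
- apply: eq_integral => x _; rewrite std_normal_pdfE [X in _ = X]muleCA -EFinM.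
  by rewrite mulVKf ?gt_eqF ?sqrt2pi_gt0// muleC.
- by apply: emeasurable_funM => //; apply/measurable_EFinP; exact: measurable_normal_pdf.
- by move=> x _; rewrite mule_ge0// lee_fin normal_pdf_ge0.
Qed.

Definition tuple_gauss n :
    {sigma_finite_measure set (n.-tuple (measurableTypeR R)) -> \bar R} :=
  power_measure std_normal n.

Definition sqsum n (t : n.-tuple R) : R := (\sum_i tnth t i ^+ 2)%R.

Lemma sqsum_cons n x (t : n.-tuple R) :
  sqsum (cons_tuple x t) = (x ^+ 2 + sqsum t)%R.
Proof.
rewrite /sqsum big_ord_recl tnth0; congr (_ + _)%R.
by apply: eq_bigr => i _; rewrite tnthS.
Qed.

Lemma measurable_sqsum n : measurable_fun [set: n.-tuple R] (@sqsum n).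
Proof.
apply: measurable_sum => i; apply: measurable_funX.
exact: measurable_tnth.
Qed.

Lemma ge0_integral_tuple_gaussS n (f : n.+1.-tuple R -> \bar R) :
  measurable_fun setT f -> (forall y, 0 <= f y) ->
  \int[tuple_gauss n.+1]_y f y =
  \int[std_normal]_t \int[tuple_gauss n]_y f (cons_tuple t y).
Proof.
exact: (@ge0_integral_cons_measure1 _ (measurableTypeR R) R n std_normal (tuple_gauss n) f).
Qed.

Lemma measurable_integral_tuple_gauss n (f : n.+1.-tuple R -> \bar R) :
  measurable_fun setT f -> (forall y, 0 <= f y) ->
  measurable_fun [set: R] (fun t => \int[tuple_gauss n]_y f (cons_tuple t y)).
Proof.
exact: (@measurable_integral_cons _ (measurableTypeR R) R n (tuple_gauss n) f).
Qed.

Lemma tuple_gaussT n : tuple_gauss n setT = 1.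
Proof.
elim: n => [|n IH]; first by rewrite /tuple_gauss/= diracT.
rewrite -[LHS]mul1e -integral_cst// ge0_integral_tuple_gaussS//.
rewrite (eq_integral (cst 1)) => [|t _]; last by rewrite [LHS]integral_cst// mul1e.
by rewrite integral_cst// mul1e; exact: probability_setT.
Qed.

Lemma integrable_tuple_gauss_bounded n (f : n.-tuple R -> R) (M : R) :
  measurable_fun setT f -> (forall t, `|f t| <= M)%R ->
  (tuple_gauss n).-integrable setT (EFin \o f).
Proof.
move=> mf fM; apply/integrableP; split; first exact/measurable_EFinP.
apply: (@le_lt_trans _ _ (\int[tuple_gauss n]_t M%:E)).
  apply: ge0_le_integral => //=.
  - by do 2 apply: measurableT_comp => //.
  - by move=> t _; rewrite lee_fin.
rewrite integral_cst//; apply: lte_mul_pinfty => //.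
  by rewrite lee_fin (le_trans _ (fM [tuple of nseq n 0%R])).
by rewrite [ltLHS](tuple_gaussT n) ltry.
Qed.

Lemma integral_tuple_gaussS n (f : n.+1.-tuple R -> \bar R) :
  (tuple_gauss n.+1).-integrable setT f ->
  \int[tuple_gauss n.+1]_y f y =
  \int[std_normal]_t \int[tuple_gauss n]_y f (cons_tuple t y).
Proof.
exact: (@integral_cons_measure1 _ (measurableTypeR R) R n std_normal (tuple_gauss n) f).
Qed.

Lemma integral_tuple_gauss0 (f : 0.-tuple R -> \bar R) :
  measurable_fun setT f -> \int[tuple_gauss 0]_y f y = f [tuple].
Proof. by move=> mf; rewrite [LHS]integral_dirac// diracT mul1e. Qed.

Lemma Rintegral_tuple_gauss0 (f : 0.-tuple R -> R) :
  measurable_fun setT f -> (\int[tuple_gauss 0]_y f y)%R = f [tuple].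
Proof.
move=> mf; rewrite /Rintegral integral_tuple_gauss0//; exact/measurable_EFinP.
Qed.

Opaque tuple_gauss.

Lemma ge0_integral_tuple_volume_gauss n (f : n.-tuple R -> \bar R) :
  measurable_fun setT f -> (forall t, 0 <= f t) ->
  \int[tuple_volume n]_t ((expR (- sqsum t / 2))%:E * f t) =
  (Num.sqrt (2 * pi) ^+ n)%:E * \int[tuple_gauss n]_t f t.
Proof.
have mexp k : measurable_fun [set: k.-tuple R] (fun t => (expR (- sqsum t / 2))%:E).
  apply/measurable_EFinP; apply: measurableT_comp => //.
  apply: measurable_funM => //; apply: measurableT_comp => //.
  exact: measurable_sqsum.
have mexp1 : measurable_fun [set: R] (fun x => (expR (- x ^+ 2 / 2))%:E).
  apply/measurable_EFinP; apply: measurableT_comp => //.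
  apply: measurable_funM => //; apply: measurableT_comp => //.
elim: n f => [|n IH] f mf f0.
  rewrite expr0 mul1e [RHS]integral_dirac// diracT mul1e.
  rewrite integral_tuple_volume0; last by apply: emeasurable_funM; [exact: mexp|].
  by rewrite /sqsum big_ord0 oppr0 mul0r expR0 mul1e.
rewrite ge0_integral_tuple_volumeS1; last 2 first.
  by apply: emeasurable_funM; [exact: mexp|].
  by move=> t; rewrite mule_ge0// lee_fin expR_ge0.
rewrite ge0_integral_tuple_gaussS//.
pose F (x : R) := \int[tuple_gauss n]_y f (cons_tuple x y).
have mF : measurable_fun setT F by exact: measurable_integral_tuple_gauss.
have F0 x : 0 <= F x by exact: integral_ge0.
transitivity (\int[mu]_x ((Num.sqrt (2 * pi) ^+ n)%:E *
    ((expR (- x ^+ 2 / 2))%:E * F x))).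
  apply: eq_integral => x _; rewrite muleCA /F -IH//; last first.
    by apply: measurableT_comp => //; exact: measurable_cons_tupler.
  rewrite -ge0_integralZl//.
  - apply: eq_integral => y _; rewrite muleA -EFinM -expRD sqsum_cons.
    by rewrite opprD mulrDl.
  - apply: emeasurable_funM; first exact: mexp.
    by apply: measurableT_comp => //; exact: measurable_cons_tupler.
  - by move=> y _; rewrite mule_ge0// lee_fin expR_ge0.
rewrite ge0_integralZl//.
- by rewrite ge0_integral_lebesgue_gauss// muleA -EFinM exprSr.
- exact: emeasurable_funM.
- by move=> x _; rewrite mule_ge0// lee_fin expR_ge0.
Qed.

Let rayleigh (r : R) : R := (r * expR (- r ^+ 2 / 2))%R.

Lemma is_derive_gauss (x : R) :
  is_derive x 1%R (fun x : R => expR (- x ^+ 2 / 2))%R (- (x * expR (- x ^+ 2 / 2)))%R.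
Proof.
apply: is_derive_eq.
rewrite !scaler0 add0r /GRing.scale/=.
by field.
Qed.

Lemma continuous_gauss : continuous (fun x : R => expR (- x ^+ 2 / 2))%R.
Proof.
move=> x; apply/differentiable_continuous/derivable1_diffP.
exact: (@ex_derive _ _ _ _ _ _ _ (is_derive_gauss x)).
Qed.

Lemma cvg_gauss_y : expR (- x ^+ 2 / 2) @[x --> +oo%R] --> (0%R : R).
Proof.
under eq_fun do rewrite mulNr.
apply: (@cvg_comp _ _ _ (fun x : R => x ^+ 2 / 2)%R (fun x => expR (- x))%R).
  by apply/gt0_cvgMly => //; exact: cvgr_expr2.
exact: cvgr_expR.
Qed.

Lemma integral_rayleigh_tail (q : R) : (0 <= q)%R ->
  \int[mu]_(r in `[q, +oo[) (rayleigh r)%:E = (expR (- q ^+ 2 / 2))%:E.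
Proof.
move=> q0; rewrite (@ge0_continuous_FTC2y _ _ (fun x => - expR (- x ^+ 2 / 2))%R _ 0%R).
- by rewrite add0e -EFinN opprK.
- by move=> x qx; rewrite mulr_ge0 ?expR_ge0// (le_trans q0).
- apply: continuous_subspaceT => x; apply: cvgM; first exact: cvg_id.
  exact: continuous_gauss.
- by rewrite -oppr0; apply: cvgN; exact: cvg_gauss_y.
- by move=> x _; apply: derivableN; exact: (@ex_derive _ _ _ _ _ _ _ (is_derive_gauss x)).
- by apply: cvgN; apply: cvg_at_right_filter; exact: continuous_gauss.
- move=> x _; rewrite derive1E deriveN; last exact: (@ex_derive _ _ _ _ _ _ _ (is_derive_gauss x)).
  by rewrite (@derive_val _ _ _ _ _ _ _ (is_derive_gauss x)) opprK.
Qed.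

Let radial_fun n (r : R) : R := if (0 < r)%R then (rayleigh r * r ^+ n)%R else 0%R.

(** Never evaluated: it multiplies the ball volumes of a cone and of the whole space alike. That it
    is finite and nonzero follows later from the finite positive Gaussian mass. *)
Definition radial n : \bar R := \int[mu]_r (radial_fun n r)%:E.

Let measurable_radial_fun n : measurable_fun setT (radial_fun n).
Proof.
apply: measurable_fun_ifT => //; first exact: measurable_fun_ltr.
apply: measurable_funM; last exact: measurable_funX.
apply: measurable_funM => //; apply: continuous_measurable_fun.
exact: continuous_gauss.
Qed.

Let radial_fun_ge0 n r : (0 <= radial_fun n r)%R.
Proof.
rewrite /radial_fun; case: ifP => // r0.
by rewrite !mulr_ge0 ?expR_ge0 ?exprn_ge0 // ltW.
Qed.

Let integral_rayleigh_ge (Q : R) : (0 <= Q)%R ->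
  \int[mu]_r (if (Q <= r ^+ 2)%R then radial_fun 0 r else 0%R)%:E =
  (expR (- Q / 2))%:E.
Proof.
move=> Q0; rewrite -[in RHS](sqr_sqrtr Q0) -integral_rayleigh_tail ?sqrtr_ge0//.
rewrite [RHS]integral_mkcond; apply: eq_integral => r _; rewrite patchE.
rewrite /radial_fun expr0 mulr1.
have [r0|r0] := ltP 0%R r.
  rewrite -(@ler_sqrt _ Q) ?sqr_ge0// sqrtr_sqr gtr0_norm//.
  case: ifPn => [Qr|Qr]; case: ifPn => //.
    by rewrite notin_setE/= in_itv/= Qr.
  by rewrite inE/= in_itv/= andbT (negbTE Qr).
rewrite if_same; case: ifPn => //; rewrite inE/= in_itv/= andbT => Qr.
have -> : r = 0%R by apply/eqP; rewrite eq_le r0 (le_trans _ Qr) ?sqrtr_ge0.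
by rewrite /rayleigh mul0r.
Qed.

(* Writing [expR (- Q t / 2)] as the integral of [r * expR (- r ^+ 2 / 2)] over
   [r >= sqrt (Q t)] turns the Gaussian integral over a cone into a radial
   constant times the volume of the unit ball of the cone. *)
Lemma integral_gauss_cone n (K : set (n.-tuple R)) (Q : n.-tuple R -> R) :
  measurable K -> measurable_fun setT Q -> (forall t, 0 <= Q t)%R ->
  (forall r t, (0 < r)%R -> K (tuple_of (r *: row_of t)%R) <-> K t) ->
  (forall r t, Q (tuple_of (r *: row_of t)%R) = r ^+ 2 * Q t)%R ->
  \int[tuple_volume n]_t (\1_K t * expR (- Q t / 2))%:E =
  radial n * tuple_volume n (K `&` [set t | (Q t <= 1)%R]).
Proof.
move=> mK mQ Q0 Kcone Qhom.
pose g (rt : measurableTypeR R * n.-tuple (measurableTypeR R)) : \bar R :=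
  ((\1_K rt.2)%:E *
    (if (Q rt.2 <= rt.1 ^+ 2)%R then radial_fun 0 rt.1 else 0%R)%:E)%E.
have mg : measurable_fun setT g.
  apply: emeasurable_funM.
    apply/measurable_EFinP; apply: measurableT_comp => //.
  apply/measurable_EFinP; apply: measurable_fun_ifT => //=.
  - apply: measurable_fun_ler; first exact: measurableT_comp.
    by apply: measurable_funX.
  - exact: (measurableT_comp (measurable_radial_fun 0) measurable_fst).
have g0 rt : 0 <= g rt.
  by rewrite mule_ge0// lee_fin //; case: ifP.
have mB : measurable [set t : n.-tuple R | (Q t <= 1)%R].
  by rewrite -[X in measurable X]setTI; exact: measurable_fun_le.
have mKB : measurable (K `&` [set t | (Q t <= 1)%R]) by exact: measurableI.
transitivity (\int[tuple_volume n]_t \int[mu]_r g (r, t)).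
  apply: eq_integral => t _; rewrite /g/= ge0_integralZl//.
  - by rewrite integral_rayleigh_ge// EFinM.
  - apply/measurable_EFinP; apply: measurable_fun_ifT => //.
      by apply: measurable_fun_ler => //; exact: measurable_funX.
    exact: measurable_radial_fun.
  - by move=> r _; rewrite lee_fin; case: ifP.
rewrite -(fubini_tonelli (m1 := mu) (m2 := tuple_volume n) g)//.
transitivity (\int[mu]_r ((radial_fun n r)%:E *
    tuple_volume n (K `&` [set t | (Q t <= 1)%R]))); last first.
  rewrite ge0_integralZr//.
    apply/measurable_EFinP; exact: measurable_radial_fun.
  by move=> r _; rewrite lee_fin.
apply: eq_integral => r _; rewrite /g/=.
have [r0|r0] := ltP 0%R r; last first.
  rewrite /radial_fun ltNge r0/= mul0e; apply: integral0_eq => t _.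
  by rewrite if_same mule0.
(* By homogeneity [Q t <= r ^+ 2] says that [t / r] lies in the unit ball, and the cone [K] contains
   [t] and [t / r] together; the substitution [t |-> t / r] then produces the factor [r ^+ n] in
   [radial_fun n]. *)
transitivity (\int[tuple_volume n]_t ((radial_fun 0 r)%:E *
    (\1_(K `&` [set t | (Q t <= 1)%R]) (tuple_of (r^-1 *: row_of t)%R))%:E)).
  apply: eq_integral => t _; rewrite !indicE in_setI.
  have -> : (tuple_of (r^-1 *: row_of t)%R \in K) = (t \in K).
    by apply/idP/idP; rewrite !inE Kcone ?invr_gt0.
  rewrite (_ : (tuple_of _ \in _) = (Q t <= r ^+ 2)%R); last first.
    apply/idP/idP; rewrite inE/= Qhom exprVn mulrC ler_pdivrMr ?mul1r//;
      exact: exprn_gt0.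
  by case: (t \in K); case: (_ <= _)%R; rewrite ?mule0 ?mul0e ?mule1 ?mul1e.
rewrite ge0_integralZl//; last 2 first.
- apply/measurable_EFinP.
  apply: (measurable_indic_comp (T2 := n.-tuple R)) => //.
  apply: measurable_tuple_of => i; under eq_fun do rewrite mxE.
  by apply: measurable_funM => //; exact: measurable_row_of.
- by rewrite lee_fin radial_fun_ge0.
rewrite (ge0_integral_scale (f := fun t => (\1_(K `&` [set t | (Q t <= 1)%R]) t)%:E))//.
- rewrite integral_indic// setIT muleA -EFinM /radial_fun r0 expr0 mulr1.
  by rewrite exprVn invrK.
- by rewrite invr_gt0.
- by apply/measurable_EFinP; exact: measurable_indic.
Qed.

End gaussian_cone.

(** * One-dimensional Gaussian integrals and the function Phi *)

Section half_line_gauss.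
Context {R : realType}.
Local Notation mu := (@lebesgue_measure R).
Local Notation N := (@std_normal R).
Implicit Types (K : R -> R) (b y : R).

Let Ry : set (measurableTypeR R) := `[0%R, +oo[%classic.

Let mRy : measurable Ry. Proof. exact: measurable_itv. Qed.

(** The integrand may change sign, so the integral is obtained as a limit over the intervals from 0
    to [n], by dominated convergence with bound [|f|]. *)
Lemma integral_FTC2_halfline (f F : R -> R) :
  (forall x : R, is_derive x 1 F (f x)) -> continuous f ->
  mu.-integrable Ry (EFin \o f) -> F n%:R @[n --> \oo] --> 0 ->
  (\int[mu]_(x in Ry) (f x)%:E = (- F 0)%:E)%E.
Proof.
move=> dF cf intf F0.
have derF (x : R) : derivable F x 1 by exact: (@ex_derive _ _ _ _ _ _ _ (dF x)).
have cF : continuous F.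
  by move=> x; apply/differentiable_continuous/derivable1_diffP.
pose fn (n : nat) (x : R) := ((f \_ `[0, n%:R]) x)%:E.
have mf : measurable_fun setT f by exact: continuous_measurable_fun.
have mfn n : measurable_fun Ry (fn n).
  apply/measurable_EFinP; apply: measurable_funTS.
  by apply/(measurable_restrictT _ _).1 => //; exact: measurable_funTS.
have cvfn x : Ry x -> fn n x @[n --> \oo] --> (f x)%:E.
  rewrite /Ry/= in_itv/= andbT => x0; apply: cvg_near_cst; near=> n.
  rewrite /fn patchE ifT// inE/= in_itv/= x0/=.
  by near: n; exact: nbhs_infty_ger.
have domfn x (n : nat) : Ry x -> (`|fn n x| <= `|(f x)%:E|)%E.
  by move=> _; rewrite /fn patchE; case: ifP => //; rewrite abse0.
have [_ _ cvint] := @dominated_convergence _ _ R mu Ry mRy fn (EFin \o f)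
  (fun x => `|(f x)%:E|%E) mfn (measurable_int mu intf) (aeW mu cvfn)
  (integrable_abse intf) (aeW mu domfn).
have intE n : (0 < n)%N -> (\int[mu]_(x in Ry) fn n x = (F n%:R - F 0)%:E)%E.
  move=> n0; have -> : (\int[mu]_(x in Ry) fn n x =
      \int[mu]_(x in `[0%R, n%:R]) (f x)%:E)%E.
    rewrite integral_mkcond [RHS]integral_mkcond; apply: eq_integral => x _.
    rewrite !patchE /fn patchE; case: ifPn => xD; last first.
      case: ifPn => //; rewrite inE/= in_itv/= => /andP[x0 _].
      by move: xD; rewrite notin_setE /Ry/= in_itv/= x0.
    by case: ifP.
  rewrite (@continuous_FTC2 _ f F 0 n%:R) ?ltr0n//.
  - exact: continuous_subspaceT.
  - split; first by move=> x _; exact: derF.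
    + by apply: cvg_at_right_filter; exact: cF.
    + by apply: cvg_at_left_filter; exact: cF.
  - move=> x _; rewrite derive1E.
    by rewrite (@derive_val _ _ _ _ _ _ _ (dF x)).
have cvF : (\int[mu]_(x in Ry) fn n x)%E @[n --> \oo] --> (- F 0)%:E.
  have -> : - F 0 = 0 - F 0 by rewrite sub0r.
  apply: cvg_trans (_ : (F n%:R - F 0)%:E @[n --> \oo] --> (0 - F 0)%:E).
    apply: near_eq_cvg; exists 1%N => // n /= n0; exact/esym/intE.
  apply: cvg_EFin; first exact: nearW.
  by apply: cvgB => //; exact: cvg_cst.
exact: (cvg_unique _ cvint cvF).
Unshelve. all: by end_near. Qed.

(** Completing the square: an exponential tilt by [b] moves the mean of the normal density to
    [b]. *)
Lemma normal_pdf_expR b (t : R) :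
  expR (b * t) * normal_pdf 0 1 t = expR (b ^+ 2 / 2) * normal_pdf b 1 t.
Proof.
rewrite !normal_pdfE ?oner_neq0// /normal_fun mulrCA [RHS]mulrCA -!expRD.
congr (_ * expR _); rewrite expr1n; lra.
Qed.

Lemma integral_std_normal_expR b :
  (\int[N]_t (expR (b * t))%:E = (expR (b ^+ 2 / 2))%:E)%E.
Proof.
rewrite ge0_integral_std_normal; last 2 first.
- by apply/measurable_EFinP; apply: measurableT_comp => //; exact: measurable_funM.
- by move=> t; rewrite lee_fin expR_ge0.
under eq_integral do rewrite -EFinM normal_pdf_expR EFinM.
rewrite ge0_integralZl ?lee_fin ?expR_ge0//.
- by rewrite integral_normal_pdf mule1.
- by apply/measurable_EFinP; exact: measurable_normal_pdf.
- by move=> t _; rewrite lee_fin normal_pdf_ge0.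
Qed.

Lemma integrable_std_normal_expR b :
  N.-integrable setT (fun t : R => (expR (b * t))%:E).
Proof.
apply/integrableP; split.
  by apply/measurable_EFinP; apply: measurableT_comp => //; exact: measurable_funM.
under eq_integral do rewrite gee0_abs ?lee_fin ?expR_ge0//.
by rewrite integral_std_normal_expR ltry.
Qed.

(** The bound [exp (b |t|)] is at most [exp (b t) + exp (- b t)], and both terms have finite normal
    mean. *)
Lemma integrable_std_normal_le_expR b (g : R -> R) : measurable_fun setT g ->
  (forall t : R, `|g t| <= expR (b * `|t|)) -> N.-integrable setT (EFin \o g).
Proof.
move=> mg gb.
apply: (@le_integrable _ _ _ N setT _ _
    (fun t => (expR (b * t))%:E + (expR (- b * t))%:E)%E) => //.
- exact/measurable_EFinP.
- move=> t _ /=; rewrite lee_fin [leRHS]ger0_norm ?addr_ge0 ?expR_ge0//.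
  apply: le_trans (gb t) _.
  case: (ger0P t) => _; rewrite ?mulrN -?mulNr.
    by rewrite lerDl expR_ge0.
  by rewrite lerDr expR_ge0.
- by apply: integrableD => //; exact: integrable_std_normal_expR.
Qed.

Lemma integral_std_normal_in (D : set (measurableTypeR R)) (g : R -> R) :
  measurable D -> measurable_fun setT g ->
  (\int[N]_(t in D) (g t)%:E = \int[mu]_(t in D) (g t * normal_pdf 0 1 t)%:E)%E.
Proof.
move=> mD mg; rewrite integral_mkcond [RHS]integral_mkcond.
rewrite [LHS](integral_density (mu := mu) (p := normal_pdf 0 1))//.
- apply: eq_integral => t _; rewrite !patchE; case: ifP => _; first by rewrite EFinM.
  by rewrite mul0e.
- exact: measurable_normal_pdf.
- by move=> t; exact: normal_pdf_ge0.
- apply/(measurable_restrictT _ _).1 => //; apply: measurable_funTS.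
  exact/measurable_EFinP.
Qed.

(** One growth class containing [cos], [sin] and [expR]; it makes [K (y * t)] and [t * K (y * t)]
    integrable against the normal law, with bounds that are locally uniform in [y]. *)
Definition exp_bounded K := measurable_fun setT K /\ forall u, `|K u| <= expR `|u|.

Lemma exp_bounded_scale K y : exp_bounded K ->
  measurable_fun setT (fun t : R => K (y * t)) /\
  forall t : R, `|K (y * t)| <= expR (`|y| * `|t|).
Proof.
move=> [mK Kb]; split; last by move=> t; rewrite -normrM.
by apply: measurableT_comp => //; exact: measurable_funM.
Qed.

Lemma exp_bounded_scaleM K y : exp_bounded K ->
  measurable_fun setT (fun t : R => t * K (y * t)) /\
  forall t : R, `|t * K (y * t)| <= expR ((1 + `|y|) * `|t|).
Proof.
move=> /(exp_bounded_scale y)[mK Kb]; split; first exact: measurable_funM.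
move=> t; rewrite normrM mulrDl expRD mul1r; apply: ler_pM => //.
by rewrite (le_trans _ (expR_ge1Dx _))// lerDr.
Qed.

Lemma integrable_exp_bounded (D : set (measurableTypeR R)) K y :
  measurable D -> exp_bounded K ->
  N.-integrable D (fun t : R => (K (y * t))%:E).
Proof.
move=> mD /(exp_bounded_scale y)[mK Kb]; apply: (integrableS measurableT) => //.
exact: integrable_std_normal_le_expR Kb.
Qed.

Lemma integrable_exp_boundedM (D : set (measurableTypeR R)) K y :
  measurable D -> exp_bounded K ->
  N.-integrable D (fun t : R => (t * K (y * t))%:E).
Proof.
move=> mD /(exp_bounded_scaleM y)[mK Kb]; apply: (integrableS measurableT) => //.
exact: integrable_std_normal_le_expR Kb.
Qed.

(** With [expR] for [K] this yields [Phi] on the real axis, with [sin] on the imaginary axis; in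
    these cases and for [cos] it solves a linear first-order differential equation in [y]. *)
Definition half_gauss K y : R := \int[N]_(t in Ry) K (y * t).

Lemma is_derive_scale_arg K K' y : (forall u : R, is_derive u 1 K (K' u)) ->
  forall x : R, is_derive x 1 (fun z : R => K (y * z)) (y * K' (y * x)).
Proof.
move=> dK x.
have dy : is_derive x 1 (fun z : R => y * z) y.
  exact: (is_derive_eq (is_deriveZ y (is_derive_id x 1)) (mulr1 y)).
by apply: (is_derive_eq (is_derive1_comp (dK (y * x)) dy)); rewrite mulrC.
Qed.

Lemma is_derive_half_gauss K K' y :
  (forall u : R, is_derive u 1 K (K' u)) -> exp_bounded K -> exp_bounded K' ->
  is_derive y 1 (half_gauss K) (\int[N]_(t in Ry) (t * K' (y * t))).
Proof.
move=> dK bK bK'.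
have dKt (x t : R) : is_derive x 1 (fun z : R => K (z * t)) (t * K' (x * t)).
  rewrite (_ : (fun z : R => K (z * t)) = fun z : R => K (t * z)).
    by rewrite [x * t]mulrC; exact: is_derive_scale_arg.
  by apply/funext => z; rewrite mulrC.
have d1 (x t : R) : partial1of2 (fun x t : R => K (x * t)) x t = t * K' (x * t).
  rewrite /partial1of2 derive1E.
  by rewrite (@derive_val _ _ _ _ _ _ _ (dKt x t)).
(* Dominates the derivative in [x] uniformly on the window [|x - y| < 1], whence the exponent
   [|y| + 1]. *)
pose G (t : R) := `|t| * expR ((`|y| + 1) * `|t|).
have G0 t : 0 <= G t by rewrite mulr_ge0// expR_ge0.
have mG : measurable_fun setT G.
  apply: measurable_funM; first exact: normr_measurable.
  by apply: measurableT_comp => //; exact: measurable_funM.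
have intG : N.-integrable Ry (EFin \o G).
  apply: (integrableS measurableT) => //.
  apply: (@integrable_std_normal_le_expR (1 + (`|y| + 1))) => // t.
  rewrite ger0_norm// /G [leRHS](_ : _ = expR `|t| * expR ((`|y| + 1) * `|t|)); last first.
    by rewrite -expRD mulrDl mul1r.
  by rewrite ler_pM ?expR_ge0// (le_trans _ (expR_ge1Dx _))// lerDr.
have yI : `]y - 1, y + 1[%classic y.
  by rewrite /= in_itv/= ltrDl ltrBlDr ltrDl ltr01.
have Gub (x t : R) : `]y - 1, y + 1[%classic x -> Ry t ->
    `|partial1of2 (fun x t : R => K (x * t)) x t| <= G t.
  move=> /=; rewrite in_itv/= => /andP[yx xy] _.
  rewrite d1 normrM /G ler_wpM2l//.
  have [_ /(_ t)] := exp_bounded_scale x bK'; move/le_trans; apply.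
  rewrite ler_expR ler_wpM2r//.
  have : `|x - y| <= 1 by rewrite ler_norml; apply/andP; split; lra.
  move: (ler_normD (x - y) y); rewrite subrK; lra.
have der := @derivable_under_integral _ _ _ N (fun x t : R => K (x * t)) Ry mRy y _ _ yI
  (fun x _ => integrable_exp_bounded x mRy bK)
  (fun x t _ _ => @ex_derive _ _ _ _ _ _ _ (dKt x t)) G G0 intG Gub.
have dE := @differentiation_under_integral _ _ _ N (fun x t : R => K (x * t)) Ry mRy y _ _ yI
  (fun x _ => integrable_exp_bounded x mRy bK)
  (fun x t _ _ => @ex_derive _ _ _ _ _ _ _ (dKt x t)) G G0 intG Gub.
apply: DeriveDef; first exact: der.
rewrite -derive1E dE; apply: eq_Rintegral => t _; exact: d1.
Qed.

Lemma is_derive_normal_pdf (x : R) :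
  is_derive x 1 (normal_pdf 0 1 : R -> R) (- (x * normal_pdf 0 1 x)).
Proof.
have -> : normal_pdf 0 1 = (fun x : R => (Num.sqrt (2 * pi))^-1 * expR (- x ^+ 2 / 2)).
  by apply/funext => z; rewrite std_normal_pdfE.
have := is_deriveZ (Num.sqrt (2 * pi))^-1 (is_derive_gauss x).
by move/is_derive_eq; apply; rewrite /GRing.scale/= mulrN mulrCA.
Qed.

(** The normal density [p] satisfies [p' t = - t * p t], so [- p t * G (y * t)] is an antiderivative
    of the difference of the two integrands; its value at 0 gives the boundary term. *)
Lemma half_gauss_by_parts G G' y :
  (forall u : R, is_derive u 1 G (G' u)) -> exp_bounded G -> exp_bounded G' ->
  continuous G' ->
  \int[N]_(t in Ry) (t * G (y * t)) =
  (Num.sqrt (2 * pi))^-1 * G 0 + y * half_gauss G' y.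
Proof.
move=> dG bG bG' cG'.
pose F t := - (normal_pdf 0 1 t * G (y * t)).
pose f t := (t * G (y * t) - y * G' (y * t)) * normal_pdf 0 1 t.
have cG : continuous G.
  move=> x; apply/differentiable_continuous/derivable1_diffP.
  exact: (@ex_derive _ _ _ _ _ _ _ (dG x)).
have cGy : continuous (fun t => G (y * t)).
  move=> x; apply: (continuous_comp (f := fun t => y * t)); last exact: cG.
  exact: mulrl_continuous.
have cGy' : continuous (fun t => G' (y * t)).
  move=> x; apply: (continuous_comp (f := fun t => y * t)); last exact: cG'.
  exact: mulrl_continuous.
have dF (x : R) : is_derive x 1 F (f x).
  have dGy := is_derive_scale_arg y dG x.
  have := is_deriveN (is_deriveM (is_derive_normal_pdf x) dGy).
  move/is_derive_eq; apply; rewrite /f /GRing.scale/=; ring.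
have cf : continuous f.
  move=> x; apply: cvgM; last first.
    exact: continuous_normal_pdf (oner_neq0 _) x.
  apply: cvgB; first by apply: cvgM; [exact: cvg_id|exact: cGy].
  by apply: cvgM; [exact: cvg_cst|exact: cGy'].
have mg : measurable_fun setT (fun t : R => t * G (y * t) - y * G' (y * t)).
  apply: measurable_funB; first exact: (exp_bounded_scaleM y bG).1.
  by apply: measurable_funM => //; exact: (exp_bounded_scale y bG').1.
have intG : N.-integrable Ry (fun t : R => (t * G (y * t))%:E).
  exact: integrable_exp_boundedM.
have intG' : N.-integrable Ry (fun t : R => (y * G' (y * t))%:E).
  under eq_fun do rewrite EFinM.
  by apply: integrableZl => //; exact: integrable_exp_bounded.
have intg : N.-integrable Ry (EFin \o (fun t : R => t * G (y * t) - y * G' (y * t))).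
  rewrite (_ : _ \o _ = (fun t : R => (t * G (y * t))%:E - (y * G' (y * t))%:E)%E)//.
  exact: integrableB.
have intf : mu.-integrable Ry (EFin \o f).
  apply/integrable_mkcond => //.
  have /(integrable_mkcond _ mRy) intgD := intg.
  have mgD : measurable_fun setT ((EFin \o (fun t : R => t * G (y * t) - y * G' (y * t))) \_ Ry).
    exact: measurable_int intgD.
  have := (integrable_density (mu := mu) (@measurable_normal_pdf R 0 1)
    (normal_pdf_ge0 0 1) (fun A _ => erefl (N A)) mgD).1 intgD.
  apply: eq_integrable => // t _; rewrite !patchE; case: ifP => _.
    by rewrite -EFinM.
  by rewrite mul0e.
have F0 : F n%:R @[n --> \oo] --> 0.
  apply: norm_cvg0.
  (* Exponential growth at rate [|y|] against the density at [n] is, after completing the square, a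
     Gaussian centred at [|y|]. *)
  pose B (n : nat) := (Num.sqrt (2 * pi))^-1 * expR (y ^+ 2 / 2) *
    expR (- (n%:R - `|y|) ^+ 2 / 2).
  apply: (@squeeze_cvgr _ _ _ _ (cst 0) B).
  - apply: nearW => n; rewrite normr_ge0/= /F normrN normrM ger0_norm ?normal_pdf_ge0//.
    rewrite mulrC; apply: le_trans (ler_wpM2r (normal_pdf_ge0 0 1 _) ((exp_bounded_scale y bG).2 n%:R)) _.
    rewrite [`|n%:R|]ger0_norm// normal_pdf_expR real_normK ?num_real// /B.
    rewrite normal_pdf1E.
    by rewrite mulrA [_^-1 * _]mulrC.
  - exact: cvg_cst.
  - rewrite -(mulr0 ((Num.sqrt (2 * pi))^-1 * expR (y ^+ 2 / 2))).
    apply: cvgM; first exact: cvg_cst.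
    apply: (@cvg_comp _ _ _ (fun n : nat => n%:R - `|y|) (fun x : R => expR (- x ^+ 2 / 2))); last exact: cvg_gauss_y.
    by apply: (@cvg_comp _ _ _ (fun n : nat => n%:R : R) (fun x : R => x - `|y|));
      [exact: cvgr_idn|exact: cvg_addrr].
have := integral_FTC2_halfline dF cf intf F0.
rewrite -[LHS](integral_std_normal_in mRy mg) => E.
have : \int[N]_(t in Ry) (t * G (y * t) - y * G' (y * t)) = - F 0.
  by rewrite /Rintegral E.
rewrite RintegralB// RintegralZl//; last exact: integrable_exp_bounded.
move/eqP; rewrite subr_eq => /eqP ->.
by rewrite /F mulr0 opprK std_normal_pdfE expr0n/= oppr0 mul0r expR0 mulr1.
Qed.

End half_line_gauss.

(** * Closed forms of the half-line integrals, [Phi] on the two axes, and change of variance *)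

Section gauss_closed_forms.
Context {R : realType}.
Local Notation mu := (@lebesgue_measure R).
Local Notation N := (@std_normal R).
Implicit Types (b y : R).

Let Ry : set (measurableTypeR R) := `[0%R, +oo[%classic.

Let mRy : measurable Ry. Proof. exact: measurable_itv. Qed.

Lemma std_normal_set1 y : N [set y] = 0%E.
Proof.
have /null_content_dominatesP := @normal_prob_dominates R 0 1.
by apply => //; exact: lebesgue_measure_set1.
Qed.

Lemma ge0_integral_std_normal_opp (f : R -> \bar R) :
  measurable_fun setT f -> (forall x, 0 <= f x)%E ->
  (\int[N]_t f (- t)%R = \int[N]_t f t)%E.
Proof.
move=> mf f0.
have mfN : measurable_fun setT (fun t : R => f (- t)) by apply: measurableT_comp.
rewrite ge0_integral_std_normal// [RHS]ge0_integral_std_normal//.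
pose g t := (f t * (normal_pdf 0 1 t)%:E)%E.
have mg : measurable_fun setT g.
  by apply: emeasurable_funM => //; apply/measurable_EFinP; exact: measurable_normal_pdf.
have g0 x : (0 <= g x)%E by rewrite mule_ge0// lee_fin normal_pdf_ge0.
have N1 : -1 != 0 :> R by rewrite oppr_eq0 oner_eq0.
have E := ge0_integral_lebesgue_affine 0 N1 mg g0.
rewrite normrN1 invr1 mul1e in E; rewrite -[RHS]E.
apply: eq_integral => t _; rewrite /g mulN1r addr0.
by congr (_ * (_)%:E)%E; rewrite !std_normal_pdfE sqrrN.
Qed.

Lemma integral_std_normal_opp (f : R -> \bar R) : measurable_fun setT f ->
  (\int[N]_t f (- t)%R = \int[N]_t f t)%E.
Proof.
move=> mf; rewrite integralE [RHS]integralE; congr (_ - _)%E.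
  rewrite -[RHS]ge0_integral_std_normal_opp; [|exact: measurable_funepos|].
    by apply: eq_integral => x _; rewrite !funeposE.
  by move=> x; exact: funepos_ge0.
rewrite -[RHS]ge0_integral_std_normal_opp; [|exact: measurable_funeneg|].
  by apply: eq_integral => x _; rewrite !funenegE.
by move=> x; exact: funeneg_ge0.
Qed.

Lemma integral_std_normal_split (f : R -> \bar R) :
  N.-integrable setT f -> N.-integrable setT (fun t : R => f (- t)) ->
  (\int[N]_t f t = \int[N]_(t in Ry) f t + \int[N]_(t in Ry) f (- t)%R)%E.
Proof.
move=> intf intfN.
have mf : measurable_fun setT f by exact: measurable_int intf.
have mfN : measurable_fun setT (fun t : R => f (- t)) by exact: measurable_int intfN.
have mRyC : measurable (~` Ry) by exact: measurableC.
have mfD : measurable_fun setT (f \_ (~` Ry)).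
  by apply/(measurable_restrictT _ _).1 => //; exact: measurable_funTS.
rewrite -[X in integral N X f](setvU Ry) setUC integral_setU//; last 2 first.
  by rewrite setUv.
  by apply/disj_setPCl.
congr (_ + _)%E.
rewrite [LHS]integral_mkcond -[LHS]integral_std_normal_opp// [RHS]integral_mkcond.
apply: ae_eq_integral => //.
- by apply: (measurableT_comp mfD).
- by apply/(measurable_restrictT _ _).1 => //; exact: measurable_funTS.
(* The two integrands can differ only at 0, which lies in [Ry] and in its reflection. *)
- exists [set 0]; split; [exact: measurable_set1|exact: std_normal_set1|].
  move=> t /=; apply: contra_notP => t0 _; rewrite !patchE.
  have -> : (- t \in ~` Ry) = (t \in Ry); last by [].
  apply/idP/idP; rewrite !inE /Ry /= !in_itv/= !andbT oppr_ge0.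
    by move/negP; rewrite -ltNge => /ltW.
  move=> t1; apply/negP; rewrite -ltNge lt_neqAle t1 andbT eq_sym.
  exact/eqP.
Qed.

Lemma Rintegral_std_normal_split (f : R -> R) :
  N.-integrable setT (EFin \o f) -> N.-integrable setT (EFin \o (fun t : R => f (- t))) ->
  \int[N]_t f t = \int[N]_(t in Ry) f t + \int[N]_(t in Ry) f (- t).
Proof.
move=> intf intfN; rewrite /Rintegral integral_std_normal_split//.
rewrite fineD//; apply: integrable_fin_num => //; exact: integrableS intf || exact: integrableS intfN.
Qed.

Lemma std_normal_Ry : \int[N]_(t in Ry) (1 : R) = 2^-1.
Proof.
have intc : N.-integrable setT (EFin \o (fun _ : R => 1 : R)).
  exact: finite_measure_integrable_cst.
have := @Rintegral_std_normal_split (fun=> 1) intc intc.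
rewrite [LHS]Rintegral_cst// [fine _](_ : _ = 1); last first.
  exact: (congr1 fine (probability_setT N)).
lra.
Qed.

Lemma half_gauss_at0 (K : R -> R) : half_gauss K 0 = K 0 / 2.
Proof.
rewrite /half_gauss -std_normal_Ry -RintegralZl//.
  by apply: eq_Rintegral => t _; rewrite mul0r mulr1.
apply: (integrableS measurableT) => //; exact: finite_measure_integrable_cst.
Qed.

Lemma expR_norm_ge1 (u : R) : 1 <= expR `|u|.
Proof. by rewrite -expR0 ler_expR. Qed.

Lemma exp_bounded_cos : exp_bounded (@cos R).
Proof.
split; first by apply: continuous_measurable_fun; exact: continuous_cos.
by move=> u; rewrite (le_trans _ (expR_norm_ge1 u))// ler_norml cos_geN1 cos_le1.
Qed.

Lemma exp_bounded_sin : exp_bounded (@sin R).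
Proof.
split; first by apply: continuous_measurable_fun; exact: continuous_sin.
by move=> u; rewrite (le_trans _ (expR_norm_ge1 u))// ler_norml sin_geN1 sin_le1.
Qed.

Lemma exp_bounded_opp (K : R -> R) : exp_bounded K -> exp_bounded (fun u => - K u).
Proof.
move=> [mK bK]; split => [|u]; last by rewrite normrN.
exact: measurableT_comp.
Qed.

Lemma exp_bounded_expR : exp_bounded (@expR R).
Proof. by split => // u; rewrite ger0_norm ?expR_ge0// ler_expR ler_norm. Qed.

(** Differentiation under the integral followed by integration by parts closes up into a
    differential equation. Here the boundary term vanishes because [sin 0 = 0]; for [sin] and [expR]
    below it leaves the constant value of the density at 0. *)
Lemma is_derive_half_cos y :
  is_derive y 1 (half_gauss cos) (- (y * half_gauss cos y)).
Proof.
apply: (is_derive_eq (is_derive_half_gauss y (@is_derive_cos R) exp_bounded_cos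
  (exp_bounded_opp exp_bounded_sin))).
transitivity (- \int[N]_(t in Ry) (t * sin (y * t))).
  rewrite -mulN1r -RintegralZl//.
    by apply: eq_Rintegral => t _; rewrite mulrN mulN1r.
  by apply: integrable_exp_boundedM => //; exact: exp_bounded_sin.
rewrite (half_gauss_by_parts y (@is_derive_sin R) exp_bounded_sin exp_bounded_cos)//.
  by rewrite sin0 mulr0 add0r.
exact: continuous_cos.
Qed.

Lemma is_derive_half_sin y :
  is_derive y 1 (half_gauss sin) ((Num.sqrt (2 * pi))^-1 - y * half_gauss sin y).
Proof.
apply: (is_derive_eq (is_derive_half_gauss y (@is_derive_sin R) exp_bounded_sin
  exp_bounded_cos)).
rewrite (half_gauss_by_parts y (@is_derive_cos R) exp_bounded_cos
  (exp_bounded_opp exp_bounded_sin)).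
  rewrite cos0 mulr1; congr (_ + _).
  rewrite -mulrN; congr (_ * _); rewrite /half_gauss -mulN1r -RintegralZl//.
    by apply: eq_Rintegral => t _; rewrite mulN1r.
  by apply: integrable_exp_bounded => //; exact: exp_bounded_sin.
by move=> x; apply: cvgN; exact: continuous_sin.
Qed.

Lemma is_derive_half_expR y :
  is_derive y 1 (half_gauss expR) ((Num.sqrt (2 * pi))^-1 + y * half_gauss expR y).
Proof.
apply: (is_derive_eq (is_derive_half_gauss y (@is_derive_expR R) exp_bounded_expR
  exp_bounded_expR)).
rewrite (half_gauss_by_parts y (@is_derive_expR R) exp_bounded_expR
  exp_bounded_expR).
  by rewrite expR0 mulr1.
exact: continuous_expR.
Qed.

Lemma is_derive_expR_sqr (c y : R) :
  is_derive y 1 (fun x : R => expR (c * x ^+ 2 / 2)) (c * y * expR (c * y ^+ 2 / 2)).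
Proof.
apply: is_derive_eq; rewrite /GRing.scale/=.
by field.
Qed.

Lemma half_gauss_cosE y : half_gauss cos y = expR (- y ^+ 2 / 2) / 2.
Proof.
(* The integrating factor of the differential equation; [h] is therefore constant, equal to its
   value 1/2 at 0. *)
pose h (x : R) : R := expR (1 * x ^+ 2 / 2) * half_gauss cos x.
have dh (x : R) : is_derive x (1 : R) h 0.
  apply: (is_derive_eq (is_deriveM (is_derive_expR_sqr 1 x) (is_derive_half_cos x))).
  by rewrite /GRing.scale/=; ring.
have := is_derive_0_is_cst y 0 dh; rewrite /h half_gauss_at0 cos0.
rewrite expr0n/= !mulr0 !mul0r expR0 !mul1r => E.
apply: (mulfI (lt0r_neq0 (expR_gt0 (y ^+ 2 / 2)))).
by rewrite E mulrA -expRD mulNr subrr expR0 mul1r.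
Qed.

Lemma integral_segment (g H : R -> R) y :
  (forall x : R, is_derive x 1 H (g x)) -> continuous g ->
  \int[mu]_(s in `[0, 1]) (g (s * y) * y) = H y - H 0.
Proof.
move=> dH cg.
have dHy x : is_derive x (1 : R) (fun s : R => H (s * y)) (g (x * y) * y).
  rewrite (_ : (fun s : R => H (s * y)) = fun s : R => H (y * s)).
    by rewrite [x * y]mulrC [_ * y]mulrC; exact: is_derive_scale_arg.
  by apply/funext => s; rewrite mulrC.
have derH (x : R) : derivable (fun s : R => H (s * y)) x 1.
  exact: (@ex_derive _ _ _ _ _ _ _ (dHy x)).
have cH : continuous (fun s : R => H (s * y)).
  by move=> x; apply/differentiable_continuous/derivable1_diffP.
rewrite /Rintegral (@continuous_FTC2 _ _ (fun s : R => H (s * y)) 0 1)//.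
- by rewrite mul1r mul0r.
- apply: continuous_subspaceT => x; apply: cvgM; last exact: cvg_cst.
  apply: (continuous_comp (f := fun s : R => s * y)); last exact: cg.
  exact: mulrr_continuous.
- split; first by move=> x _; exact: derH.
  + by apply: cvg_at_right_filter; exact: cH.
  + by apply: cvg_at_left_filter; exact: cH.
- move=> x _; rewrite derive1E.
  by rewrite (@derive_val _ _ _ _ _ _ _ (dHy x)).
Qed.

Lemma continuous_expR_sqr (c : R) : continuous (fun x : R => expR (c * x ^+ 2 / 2)).
Proof.
move=> x; apply/differentiable_continuous/derivable1_diffP.
exact: (@ex_derive _ _ _ _ _ _ _ (is_derive_expR_sqr c x)).
Qed.

(** Multiplying [half_gauss expR] by its integrating factor leaves only the constant term of the
    differential equation, so the product is, up to [sqrt (2 pi)], the antiderivative needed for the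
    path integral in [Phi]. The imaginary direction works in the same way with [sin]. *)
Lemma integral_segment_expR y :
  \int[mu]_(s in `[0, 1]) (expR (- (s * y) ^+ 2 / 2) * y) =
  Num.sqrt (2 * pi) * (expR (- y ^+ 2 / 2) * half_gauss expR y - 2^-1).
Proof.
pose H (x : R) : R := Num.sqrt (2 * pi) * (expR (-1 * x ^+ 2 / 2) * half_gauss expR x).
have dH (x : R) : is_derive x 1 H (expR (- x ^+ 2 / 2)).
  apply: (is_derive_eq (is_deriveZ _ (is_deriveM
    (is_derive_expR_sqr (-1) x) (is_derive_half_expR x)))).
  rewrite /GRing.scale/= !mulN1r.
  by field; rewrite gt_eqF// sqrt2pi_gt0.
rewrite (@integral_segment (fun x : R => expR (- x ^+ 2 / 2)) H y dH continuous_gauss).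
rewrite /H half_gauss_at0 expR0 expr0n/= mulr0 mul0r expR0 mulN1r.
by rewrite !mul1r mulrBr.
Qed.

Lemma integral_segment_expRN y :
  \int[mu]_(s in `[0, 1]) (expR ((s * y) ^+ 2 / 2) * y) =
  Num.sqrt (2 * pi) * (expR (y ^+ 2 / 2) * half_gauss sin y).
Proof.
pose H (x : R) : R := Num.sqrt (2 * pi) * (expR (1 * x ^+ 2 / 2) * half_gauss sin x).
have dH (x : R) : is_derive x 1 H (expR (x ^+ 2 / 2)).
  apply: (is_derive_eq (is_deriveZ _ (is_deriveM
    (is_derive_expR_sqr 1 x) (is_derive_half_sin x)))).
  rewrite /GRing.scale/= !mul1r.
  by field; rewrite gt_eqF// sqrt2pi_gt0.
have cg : continuous (fun x : R => expR (x ^+ 2 / 2)).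
  rewrite (_ : (fun x : R => _) = fun x : R => expR (1 * x ^+ 2 / 2)).
    exact: continuous_expR_sqr.
  by apply/funext => x; rewrite mul1r.
rewrite (@integral_segment (fun x : R => expR (x ^+ 2 / 2)) H y dH cg).
by rewrite /H half_gauss_at0 sin0 mul0r !mulr0 subr0 mul1r.
Qed.

Local Open Scope complex_scope.

Let half_C : 2^-1 = (2^-1)%:C :> R[i].
Proof. by rewrite (fmorphV (real_complex R)) (rmorph_nat (real_complex R)). Qed.

Lemma expC_real (u : R) : expC u%:C = (expR u)%:C.
Proof. by rewrite /expC /= cos0 sin0 -[1 +i* 0]/(1 : R[i]) mulr1. Qed.

Let Phi_integrand_real (s y : R) :
  expC (- (s%:C * y%:C) ^+ 2 / 2) * y%:C = (expR (- (s * y) ^+ 2 / 2) * y)%:C.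
Proof.
have -> : - (s%:C * y%:C) ^+ 2 / 2 = (- (s * y) ^+ 2 / 2)%:C :> R[i].
  by rewrite half_C -!(rmorphM (real_complex R)) -(rmorphXn (real_complex R))
    -(rmorphN (real_complex R)) -!(rmorphM (real_complex R)).
by rewrite expC_real (rmorphM (real_complex R)).
Qed.

Let Phi_integrand_imag (s y : R) :
  expC (- (s%:C * (0 +i* y)) ^+ 2 / 2) * (0 +i* y) =
  0 +i* (expR ((s * y) ^+ 2 / 2) * y).
Proof.
have -> : - (s%:C * (0 +i* y)) ^+ 2 / 2 = ((s * y) ^+ 2 / 2)%:C :> R[i].
  by rewrite half_C !expr2; simpc; congr (_ +i* _); ring.
by rewrite expC_real; simpc.
Qed.

(** After completing the square this is the normal distribution function at [y]; the product form is
    kept because [half_gauss expR] is what each coordinate of an orthant integral contributes. *)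
Lemma Phi_real y : Phi (y%:C) = (expR (- y ^+ 2 / 2) * half_gauss expR y)%:C.
Proof.
rewrite /Phi.
rewrite (@eq_Rintegral _ _ _ mu _ (fun s => expR (- (s * y) ^+ 2 / 2) * y)); last first.
  by move=> s _; rewrite Phi_integrand_real.
rewrite [X in _ +i* X](@eq_Rintegral _ _ _ mu _ (fun=> 0)); last first.
  by move=> s _; rewrite Phi_integrand_real.
rewrite integral_segment_expR Rintegral_cst// mul0r half_C; simpc.
congr (_ +i* _); first by field; rewrite gt_eqF// sqrt2pi_gt0.
Qed.

(** Along the imaginary axis the path integral is purely imaginary, so the real part stays at its
    value at 0. *)
Lemma Phi_imag y : Phi (0 +i* y) = 2^-1 +i* (expR (y ^+ 2 / 2) * half_gauss sin y).
Proof.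
rewrite /Phi.
rewrite (@eq_Rintegral _ _ _ mu _ (fun=> 0)); last first.
  by move=> s _; rewrite Phi_integrand_imag.
rewrite [X in _ +i* X](@eq_Rintegral _ _ _ mu _ (fun s => expR ((s * y) ^+ 2 / 2) * y)); last first.
  by move=> s _; rewrite Phi_integrand_imag.
rewrite integral_segment_expRN Rintegral_cst// mul0r half_C; simpc.
congr (_ +i* _); by field; rewrite gt_eqF// sqrt2pi_gt0.
Qed.

Local Close Scope complex_scope.

Lemma integral_std_normal_cos b : \int[N]_t cos (b * t) = expR (- b ^+ 2 / 2).
Proof.
rewrite Rintegral_std_normal_split.
- rewrite -/(half_gauss cos b) half_gauss_cosE.
  under eq_Rintegral do rewrite mulrN -mulNr.
  rewrite -/(half_gauss cos (- b)) half_gauss_cosE sqrrN; lra.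
- by apply: integrable_exp_bounded => //; exact: exp_bounded_cos.
- rewrite (_ : _ \o _ = fun t : R => (cos (- b * t))%:E).
    by apply: integrable_exp_bounded => //; exact: exp_bounded_cos.
  by apply/funext => t /=; rewrite mulrN mulNr.
Qed.

Lemma integral_std_normal_sin b : \int[N]_t sin (b * t) = 0.
Proof.
have : \int[N]_t sin (b * t) = - \int[N]_t sin (b * t); last lra.
rewrite {1}/Rintegral -(integral_std_normal_opp (f := fun t : R => (sin (b * t))%:E)); last first.
  apply/measurable_EFinP; exact: (exp_bounded_scale b exp_bounded_sin).1.
rewrite -/(Rintegral _ _ (fun t : R => sin (b * - t))) -mulN1r -RintegralZl//.
  by apply: eq_Rintegral => t _; rewrite mulrN sinN mulN1r.
by apply: integrable_exp_bounded => //; exact: exp_bounded_sin.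
Qed.

(* The Gaussian weight [expR ((1 - c) * x ^+ 2 / 2)] turns [N(0, 1)] into a
   multiple of [N(0, 1 / c)]. *)
Lemma ge0_integral_std_normal_weight (c : R) (f : R -> \bar R) : 0 < c ->
  measurable_fun setT f -> (forall x, 0 <= f x)%E ->
  (\int[N]_x ((expR ((1 - c) * x ^+ 2 / 2))%:E * f x) =
   (Num.sqrt c)^-1%:E * \int[N]_x f (x / Num.sqrt c)%R)%E.
Proof.
move=> c0 mf f0; have sc0 : 0 < Num.sqrt c by rewrite sqrtr_gt0.
have mfc : measurable_fun setT (fun x : R => f (x / Num.sqrt c)).
  by apply: measurableT_comp => //; exact: measurable_funM.
have mw : measurable_fun setT (fun x : R => (expR ((1 - c) * x ^+ 2 / 2))%:E).
  apply/measurable_EFinP; apply: continuous_measurable_fun; exact: continuous_expR_sqr.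
rewrite ge0_integral_std_normal; last 2 first.
- exact: emeasurable_funM.
- by move=> x; rewrite mule_ge0// lee_fin expR_ge0.
rewrite ge0_integral_std_normal//.
pose g x := (f (x / Num.sqrt c)%R * (normal_pdf 0 1 x)%:E)%E.
have mg : measurable_fun setT g.
  by apply: emeasurable_funM => //; apply/measurable_EFinP; exact: measurable_normal_pdf.
have g0 x : (0 <= g x)%E by rewrite mule_ge0// lee_fin normal_pdf_ge0.
have E := ge0_integral_lebesgue_affine 0 (lt0r_neq0 sc0) mg g0.
rewrite gtr0_norm// in E; rewrite -[RHS]E.
apply: eq_integral => x _; rewrite /g addr0.
have -> : (Num.sqrt c * x / Num.sqrt c)%R = x by rewrite mulrAC divff ?gt_eqF// mul1r.
rewrite [in LHS]muleC muleA -EFinM muleC; congr (_ * (_)%:E)%E.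
rewrite !std_normal_pdfE -[LHS]mulrA -expRD exprMn sqr_sqrtr ?ltW//.
by congr (_ * expR _); field.
Qed.

Let weight_funepos (c : R) (f : R -> R) x :
  ((fun x => (expR ((1 - c) * x ^+ 2 / 2) * f x)%:E)^\+ x =
   (expR ((1 - c) * x ^+ 2 / 2))%:E * (EFin \o f)^\+ x)%E.
Proof. by rewrite !funeposE maxe_pMr ?lee_fin ?expR_ge0// mule0. Qed.

Let weight_funeneg (c : R) (f : R -> R) x :
  ((fun x => (expR ((1 - c) * x ^+ 2 / 2) * f x)%:E)^\- x =
   (expR ((1 - c) * x ^+ 2 / 2))%:E * (EFin \o f)^\- x)%E.
Proof.
rewrite !funenegE maxe_pMr ?lee_fin ?expR_ge0// mule0; congr maxe.
by rewrite -[(EFin \o f) x]/((f x)%:E) -!EFinN -EFinM mulrN.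
Qed.

Lemma integrable_std_normal_weight (c : R) (f : R -> R) : 0 < c ->
  measurable_fun setT f ->
  N.-integrable setT (fun x : R => (expR ((1 - c) * x ^+ 2 / 2) * f x)%:E) ->
  N.-integrable setT (fun x : R => (f (x / Num.sqrt c))%:E).
Proof.
move=> c0 mf /integrableP[_ fin]; apply/integrableP; split.
  apply/measurable_EFinP; apply: (measurableT_comp mf); exact: measurable_funM.
have mnf : measurable_fun setT (fun x : R => `|(f x)%:E|%E).
  by apply: measurableT_comp => //; exact/measurable_EFinP.
have E := ge0_integral_std_normal_weight c0 mnf (fun x => abse_ge0 _).
have : ((Num.sqrt c)^-1%:E * \int[N]_x `|(f (x / Num.sqrt c)%R)%:E| < +oo)%E.
  rewrite -E; apply: le_lt_trans fin; rewrite le_eqVlt; apply/orP; left; apply/eqP.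
  by apply: eq_integral => x _; rewrite EFinM abseM [`|(expR _)%:E|%E]gee0_abs ?lee_fin ?expR_ge0.
have : (0 <= \int[N]_x `|(f (x / Num.sqrt c)%R)%:E|)%E by exact: integral_ge0.
case: (\int[N]_x _)%E => [r| |] _ //.
  by move=> _; exact: ltry.
by rewrite mulry gtr0_sg ?invr_gt0 ?sqrtr_gt0// mul1e.
Qed.

Lemma integral_std_normal_weight (c : R) (f : R -> R) : 0 < c ->
  measurable_fun setT f ->
  N.-integrable setT (fun x : R => (expR ((1 - c) * x ^+ 2 / 2) * f x)%:E) ->
  \int[N]_x (expR ((1 - c) * x ^+ 2 / 2) * f x) =
   (Num.sqrt c)^-1 * \int[N]_x f (x / Num.sqrt c).
Proof.
move=> c0 mf intf; have intfc := integrable_std_normal_weight c0 mf intf.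
have E : (\int[N]_x (expR ((1 - c) * x ^+ 2 / 2) * f x)%R%:E =
   (Num.sqrt c)^-1%:E * \int[N]_x (f (x / Num.sqrt c)%R)%:E)%E.
  rewrite integralE.
  under eq_integral do rewrite weight_funepos.
  under [X in (_ - X)%E]eq_integral do rewrite weight_funeneg.
  have mF : measurable_fun setT (EFin \o f) by exact/measurable_EFinP.
  rewrite (ge0_integral_std_normal_weight c0 (measurable_funepos mF)); last first.
    by move=> x; exact: funepos_ge0.
  rewrite (ge0_integral_std_normal_weight c0 (measurable_funeneg mF)); last first.
    by move=> x; exact: funeneg_ge0.
  pose g (x : R) := (f (x / Num.sqrt c))%:E.
  have -> : (\int[N]_x (EFin \o f)^\+ (x / Num.sqrt c)%R = \int[N]_x g^\+ x)%E.
    by apply: eq_integral => x _; rewrite !funeposE.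
  have -> : (\int[N]_x (EFin \o f)^\- (x / Num.sqrt c)%R = \int[N]_x g^\- x)%E.
    by apply: eq_integral => x _; rewrite !funenegE.
  rewrite -muleBr//; last first.
    rewrite fin_num_adde_defl// fin_numN; exact: integrable_neg_fin_num.
  by rewrite [in RHS]integralE.
rewrite /Rintegral E fineM//; exact: integrable_fin_num.
Qed.

End gauss_closed_forms.

(** * Gaussian integrals over orthants *)

Lemma integrable_mull d (T : measurableType d) (R : realType)
    (m : {measure set T -> \bar R}) (r : R) (f : T -> R) :
  m.-integrable setT (EFin \o f) ->
  m.-integrable setT (EFin \o (fun x => r * f x)).
Proof.
move=> intf; rewrite (_ : _ \o _ = fun x => r%:E * (f x)%:E)%E//.
exact: integrableZl.
Qed.

Lemma integrable_mulr d (T : measurableType d) (R : realType)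
    (m : {measure set T -> \bar R}) (r : R) (f : T -> R) :
  m.-integrable setT (EFin \o f) ->
  m.-integrable setT (EFin \o (fun x => f x * r)).
Proof.
move=> /(integrable_mull r); congr (_.-integrable _ _).
by apply/funext => x /=; rewrite mulrC.
Qed.

Section orthant_integral.
Context {R : realType}.
Local Notation N := (@std_normal R).
Implicit Types (b : R -> R) (y : R).

(** The marking [s] selects the coordinates that are constrained to be nonnegative, and these are
    also the ones that enter the rank-one part of the quadratic form. With the indicator of the
    half-line for [b], [oweight] is the indicator of the orthant; with 1 for [b] it gives the whole
    space. *)
Definition osum n (s : 'I_n -> bool) (t : n.-tuple R) : R :=
  \sum_i (s i)%:R * tnth t i.

Definition oweight b n (s : 'I_n -> bool) (t : n.-tuple R) : R :=
  \prod_i (if s i then b (tnth t i) else 1).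

Lemma osum_cons n (s : 'I_n.+1 -> bool) x (t : n.-tuple R) :
  osum s (cons_tuple x t) = (s ord0)%:R * x + osum (s \o lift ord0) t.
Proof.
rewrite /osum big_ord_recl tnth0; congr (_ + _).
by apply: eq_bigr => i _; rewrite tnthS.
Qed.

Lemma oweight_cons b n (s : 'I_n.+1 -> bool) x (t : n.-tuple R) :
  oweight b s (cons_tuple x t) =
  (if s ord0 then b x else 1) * oweight b (s \o lift ord0) t.
Proof.
rewrite /oweight big_ord_recl tnth0; congr (_ * _).
by apply: eq_bigr => i _; rewrite tnthS.
Qed.

Lemma measurable_osum n (s : 'I_n -> bool) :
  measurable_fun [set: n.-tuple R] (osum s).
Proof.
apply: measurable_sum => i; apply: measurable_funM => //.
exact: measurable_tnth.
Qed.

Lemma measurable_oweight b n (s : 'I_n -> bool) : measurable_fun setT b ->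
  measurable_fun [set: n.-tuple R] (oweight b s).
Proof.
move=> mb; apply: measurable_prod => i _; case: (s i) => //.
by apply: (measurableT_comp mb); exact: measurable_tnth.
Qed.

Lemma oweight_ge0 b n (s : 'I_n -> bool) t : (forall x, 0 <= b x) ->
  0 <= oweight b s t.
Proof. by move=> b0; apply: prodr_ge0 => i _; case: ifP. Qed.

Lemma oweight_le1 b n (s : 'I_n -> bool) t : (forall x, 0 <= b x <= 1) ->
  oweight b s t <= 1.
Proof.
by move=> b01; apply: prodr_ile1 => i _; case: ifP => _; rewrite ?ler01 ?lexx.
Qed.

Lemma Rintegral_tuple_gaussS n (f : n.+1.-tuple R -> R) (M : R) :
  measurable_fun setT f -> (forall t, `|f t| <= M) ->
  \int[tuple_gauss n.+1]_t f t =
  \int[N]_x \int[tuple_gauss n]_t f (cons_tuple x t).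
Proof.
move=> mf fM; rewrite /Rintegral integral_tuple_gaussS; last first.
  exact: integrable_tuple_gauss_bounded fM.
congr fine; apply: eq_integral => x _; rewrite fineK//.
apply: integrable_fin_num => //.
apply: (@integrable_tuple_gauss_bounded _ _ (fun t => f (cons_tuple x t)) M) => //.
by apply: (measurableT_comp mf); exact: measurable_cons_tupler.
Qed.

Lemma integrable_std_normal_bounded (f : R -> R) (M : R) :
  measurable_fun setT f -> (forall t, `|f t| <= M) ->
  N.-integrable setT (EFin \o f).
Proof.
move=> mf fM.
apply: (@le_integrable _ _ _ N setT _ _ (cst M%:E)) => //.
- exact/measurable_EFinP.
- by move=> t _ /=; rewrite lee_fin (le_trans (fM t))// ler_norm.
- exact: finite_measure_integrable_cst.
Qed.

Lemma Rintegral_swap n (f : R -> n.-tuple R -> R) (M : R) :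
  measurable_fun setT (fun xt : R * n.-tuple R => f xt.1 xt.2) ->
  (forall x t, `|f x t| <= M) ->
  \int[N]_x \int[tuple_gauss n]_t f x t = \int[tuple_gauss n]_t \int[N]_x f x t.
Proof.
move=> mf fM.
pose T := (measurableTypeR R * n.-tuple (measurableTypeR R))%type.
have M0 : 0 <= M by rewrite (le_trans _ (fM 0 [tuple of nseq n 0])).
have mfE : measurable_fun [set: T] (fun xt : T => (f xt.1 xt.2)%:E).
  exact/measurable_EFinP.
have inner x : (tuple_gauss n).-integrable setT (EFin \o f x).
  apply: (@integrable_tuple_gauss_bounded _ _ _ M) => //.
  exact: (measurableT_comp mf (pair1_measurable x)).
have inner_le x : (\int[tuple_gauss n]_t `|(f x t)%:E| <= M%:E)%E.
  rewrite -[leRHS]mule1 -[1%E in leRHS](tuple_gaussT n) -integral_cst//.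
  apply: ge0_le_integral => //.
    have /integrableP[mfx _] := inner x.
    apply/measurable_EFinP; apply: measurableT_comp => //.
    exact/measurable_EFinP.
  by move=> t _; rewrite lee_fin.
have innerN t : N.-integrable setT (EFin \o f^~ t).
  apply: (@integrable_std_normal_bounded _ M) => //.
  exact: (measurableT_comp mf (pair2_measurable t)).
have intf : (N \x tuple_gauss n)%E.-integrable [set: T]
    (fun xt : T => (f xt.1 xt.2)%:E).
  apply/(integrable12ltyP N (tuple_gauss n) mfE).
  apply: (@le_lt_trans _ _ (\int[N]_x M%:E)%E); last first.
    rewrite integral_cst//; apply: lte_mul_pinfty => //.
    by rewrite [ltLHS](probability_setT N) ltry.
  apply: ge0_le_integral => //.
  - by move=> x _; exact: integral_ge0.
  - apply: (measurable_fun_fubini_tonelli_F (m2 := tuple_gauss n)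
      (fun xt : T => `|(f xt.1 xt.2)%:E|%E)) => //.
    exact: measurableT_comp.
  - by move=> x _; exact: inner_le.
have E := Fubini intf; rewrite /= in E.
rewrite /Rintegral.
transitivity (fine (\int[N]_x \int[tuple_gauss n]_t (f x t)%:E)%E).
  congr fine; apply: eq_integral => x _; rewrite fineK//.
  exact: integrable_fin_num (inner x).
rewrite E; congr fine; apply: eq_integral => t _; rewrite fineK//.
exact: integrable_fin_num (innerN t).
Qed.

(** The exponential of a sum factors over the coordinates: each marked one contributes [m], each
    unmarked one the total mass 1. *)
Lemma integral_oweight_expR b y m : measurable_fun setT b ->
  (forall x, 0 <= b x) ->
  (\int[N]_x (b x * expR (y * x))%:E = m%:E)%E ->
  forall n (s : 'I_n -> bool),
  (\int[tuple_gauss n]_t (oweight b s t * expR (y * osum s t))%:E =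
   (m ^+ (\sum_i s i))%:E)%E.
Proof.
move=> mb b0 Em.
have mint n (s : 'I_n -> bool) : measurable_fun setT
    (fun t : n.-tuple R => (oweight b s t * expR (y * osum s t))%:E).
  apply/measurable_EFinP; apply: measurable_funM; first exact: measurable_oweight.
  apply: measurableT_comp => //; apply: measurable_funM => //.
  exact: measurable_osum.
have int0 n (s : 'I_n -> bool) t : (0 <= (oweight b s t * expR (y * osum s t))%:E)%E.
  by rewrite lee_fin mulr_ge0 ?expR_ge0// oweight_ge0.
elim=> [|n IH] s.
  rewrite integral_tuple_gauss0; last exact: mint.
  by rewrite /oweight /osum !big_ord0 mulr0 expR0 mulr1.
rewrite ge0_integral_tuple_gaussS; [|exact: mint|exact: int0].
pose w x := (if s ord0 then b x else 1) * expR (y * ((s ord0)%:R * x)).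
have mw : measurable_fun setT w.
  apply: measurable_funM; first by case: (s ord0).
  by apply: measurableT_comp => //; do 2 apply: measurable_funM => //.
have w0 x : 0 <= w x by rewrite /w mulr_ge0 ?expR_ge0//; case: ifP.
transitivity (\int[N]_x ((w x)%:E * (m ^+ (\sum_i (s \o lift ord0) i))%:E))%E.
  apply: eq_integral => x _; rewrite -IH -ge0_integralZl.
  - apply: eq_integral => t _; rewrite -EFinM oweight_cons osum_cons mulrDr expRD.
    by rewrite /w; congr (_%:E); ring.
  - exact: measurableT.
  - exact: mint.
  - by move=> t _; exact: int0.
  - by rewrite lee_fin.
rewrite ge0_integralZr.
- rewrite big_ord_recl exprD EFinM; congr (_ * _)%E.
  rewrite /w; case: (s ord0).
    by under eq_integral do rewrite mul1r; rewrite expr1.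
  under eq_integral do rewrite mul0r mulr0 expR0 mulr1.
  by rewrite integral_cst// mul1e expr0; exact: probability_setT.
- exact: measurableT.
- exact/measurable_EFinP.
- by move=> x _; rewrite lee_fin.
- by rewrite -IH; apply: integral_ge0 => t _; exact: int0.
Qed.

Local Open Scope complex_scope.

(** Multiplicativity of the Fourier transform over independent coordinates. Cosine and sine
    integrals are carried together through the induction, since the addition formulas mix them
    exactly as a complex product does. *)
Lemma Rintegral_oweight_trig b y (C S : R) : measurable_fun setT b ->
  (forall x, 0 <= b x <= 1) ->
  \int[N]_x (b x * cos (y * x)) = C -> \int[N]_x (b x * sin (y * x)) = S ->
  forall n (s : 'I_n -> bool),
  \int[tuple_gauss n]_t (oweight b s t * cos (y * osum s t)) +i*
  \int[tuple_gauss n]_t (oweight b s t * sin (y * osum s t)) =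
  (C +i* S) ^+ (\sum_i s i).
Proof.
move=> mb b01 CE SE.
have mcos : measurable_fun setT (@cos R) by exact: (@exp_bounded_cos R).1.
have msin : measurable_fun setT (@sin R) by exact: (@exp_bounded_sin R).1.
have cos1 (u : R) : `|cos u| <= 1 by rewrite ler_norml cos_geN1 cos_le1.
have sin1 (u : R) : `|sin u| <= 1 by rewrite ler_norml sin_geN1 sin_le1.
have mint (g : R -> R) n (s : 'I_n -> bool) : measurable_fun setT g ->
    measurable_fun setT (fun t : n.-tuple R => oweight b s t * g (y * osum s t)).
  move=> mg; apply: measurable_funM; first exact: measurable_oweight.
  apply: measurableT_comp => //; apply: measurable_funM => //.
  exact: measurable_osum.
have bint (g : R -> R) n (s : 'I_n -> bool) t : (forall u, `|g u| <= 1) ->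
    `|oweight b s t * g (y * osum s t)| <= 1.
  move=> g1; rewrite normrM mulr_ile1// ger0_norm ?oweight_le1//.
  by apply: oweight_ge0 => x; case/andP: (b01 x).
have intg (g : R -> R) n (s : 'I_n -> bool) : measurable_fun setT g ->
    (forall u, `|g u| <= 1) -> (tuple_gauss n).-integrable setT
      (EFin \o (fun t : n.-tuple R => oweight b s t * g (y * osum s t))).
  move=> mg g1; apply: (@integrable_tuple_gauss_bounded _ _ _ 1).
    exact: mint.
  by move=> t; exact: bint.
elim=> [|n IH] s.
  rewrite !Rintegral_tuple_gauss0; [|exact: mint|exact: mint].
  by rewrite /oweight /osum !big_ord0 mulr0 cos0 sin0 mulr1 mulr0.
have := IH (s \o lift ord0).
set EC := \int[_]_t _; set ES := \int[_]_t _ => IHs.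
pose w x := if s ord0 then b x else 1.
pose z x := y * ((s ord0)%:R * x).
have mw : measurable_fun setT w by rewrite /w; case: (s ord0).
have mz : measurable_fun setT z by do 2 apply: measurable_funM => //.
have w1 x : `|w x| <= 1.
  rewrite /w; case: ifP => _; last by rewrite normr1.
  by have /andP[? ?] := b01 x; rewrite ger0_norm.
have intw (g : R -> R) : measurable_fun setT g -> (forall u, `|g u| <= 1) ->
    N.-integrable setT (EFin \o (fun x => w x * g (z x))).
  move=> mg g1; apply: (@integrable_std_normal_bounded _ 1).
    by apply: measurable_funM => //; apply: measurableT_comp.
  by move=> x; rewrite normrM mulr_ile1.
have CwE : \int[N]_x (w x * cos (z x)) +i* \int[N]_x (w x * sin (z x)) =
    (C +i* S) ^+ (s ord0).
  rewrite /w /z; case: (s ord0).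
    rewrite expr1 -CE -SE; congr (_ +i* _); apply: eq_Rintegral => x _;
      by rewrite mul1r.
  under eq_Rintegral do rewrite mul0r mulr0 cos0 mulr1.
  rewrite expr0; congr (_ +i* _).
    rewrite Rintegral_cst// mul1r; exact: (congr1 fine (probability_setT N)).
  under eq_Rintegral do rewrite mul0r mulr0 sin0 mulr0.
  by rewrite Rintegral_cst// mul0r.
rewrite big_ord_recl exprD -CwE.
rewrite -[\sum_(i < n) _]/(\sum_i (s \o lift ord0) i)%N -IHs.
have ECS : \int[tuple_gauss n.+1]_t (oweight b s t * cos (y * osum s t)) =
    \int[N]_x (w x * cos (z x)) * EC - \int[N]_x (w x * sin (z x)) * ES.
  rewrite (@Rintegral_tuple_gaussS _ _ 1); [|exact: mint|by move=> t; exact: bint].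
  rewrite -!RintegralZr//; [|exact: intw..].
  rewrite -RintegralB//; last 2 first.
    by apply: integrable_mulr; exact: intw.
    by apply: integrable_mulr; exact: intw.
  apply: eq_Rintegral => x _.
  rewrite /EC /ES -!RintegralZl//; [|exact: intg..].
  rewrite -RintegralB//; last 2 first.
    by apply: integrable_mull; exact: intg.
    by apply: integrable_mull; exact: intg.
  apply: eq_Rintegral => t _; rewrite oweight_cons osum_cons mulrDr cosD.
  by rewrite /w /z; ring.
have ESS : \int[tuple_gauss n.+1]_t (oweight b s t * sin (y * osum s t)) =
    \int[N]_x (w x * cos (z x)) * ES + \int[N]_x (w x * sin (z x)) * EC.
  rewrite (@Rintegral_tuple_gaussS _ _ 1); [|exact: mint|by move=> t; exact: bint].
  rewrite -!RintegralZr//; [|exact: intw..].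
  rewrite -RintegralD//; last 2 first.
    by apply: integrable_mulr; exact: intw.
    by apply: integrable_mulr; exact: intw.
  apply: eq_Rintegral => x _.
  rewrite /EC /ES -!RintegralZl//; [|exact: intg..].
  rewrite -RintegralD//; last 2 first.
    by apply: integrable_mull; exact: intg.
    by apply: integrable_mull; exact: intg.
  apply: eq_Rintegral => t _; rewrite oweight_cons osum_cons mulrDr sinD.
  by rewrite /w /z; ring.
by rewrite ECS ESS; simpc.
Qed.

Lemma measurable_ReIm_exp (d : measure_display) (T : measurableType d)
    (A B : T -> R) k : measurable_fun setT A -> measurable_fun setT B ->
  measurable_fun setT (fun x => complex.Re ((A x +i* B x) ^+ k)) /\
  measurable_fun setT (fun x => complex.Im ((A x +i* B x) ^+ k)).
Proof.
move=> mA mB; elim: k => [|k [mRe mIm]]; first by split.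
have E x : (A x +i* B x) ^+ k.+1 =
    (A x * complex.Re ((A x +i* B x) ^+ k) - B x * complex.Im ((A x +i* B x) ^+ k)) +i*
    (A x * complex.Im ((A x +i* B x) ^+ k) + B x * complex.Re ((A x +i* B x) ^+ k)).
  by rewrite exprS; case: (_ ^+ k) => u v; simpc.
split.
  rewrite (_ : (fun x => _) = fun x => A x * complex.Re ((A x +i* B x) ^+ k) -
      B x * complex.Im ((A x +i* B x) ^+ k)); last by apply/funext => x; rewrite E.
  by apply: measurable_funB; exact: measurable_funM.
rewrite (_ : (fun x => _) = fun x => A x * complex.Im ((A x +i* B x) ^+ k) +
    B x * complex.Re ((A x +i* B x) ^+ k)); last by apply/funext => x; rewrite E.
by apply: measurable_funD; exact: measurable_funM.
Qed.

(** The squared modulus is multiplicative, so it stays at most 1 under powers. *)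
Lemma ReIm_exp_le1 (A B : R) k : A ^+ 2 + B ^+ 2 <= 1 ->
  `|complex.Re ((A +i* B) ^+ k)| <= 1 /\ `|complex.Im ((A +i* B) ^+ k)| <= 1.
Proof.
move=> AB.
have : complex.Re ((A +i* B) ^+ k) ^+ 2 + complex.Im ((A +i* B) ^+ k) ^+ 2 <= 1.
  elim: k => [|k]; first by rewrite expr0/=; lra.
  rewrite (exprS (A +i* B)); case: ((A +i* B) ^+ k) => u v /= IH.
  have -> : (A * u - B * v) ^+ 2 + (A * v + B * u) ^+ 2 =
      (A ^+ 2 + B ^+ 2) * (u ^+ 2 + v ^+ 2) by ring.
  by rewrite mulr_ile1// addr_ge0// sqr_ge0.
set u := complex.Re _; set v := complex.Im _ => uv.
have le1 (w : R) : w ^+ 2 <= 1 -> `|w| <= 1.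
  by move=> w1; rewrite ler_norml; apply/andP; split; nra.
by split; apply: le1; apply: le_trans uv; rewrite ?lerDl ?lerDr sqr_ge0.
Qed.

(** Together with [gauss_sin], the real and imaginary parts of the Fourier transform of [b] times
    the normal density. *)
Definition gauss_cos b y := \int[N]_x (b x * cos (y * x)).
Definition gauss_sin b y := \int[N]_x (b x * sin (y * x)).

Section oscillating.
Variables (b : R -> R) (a : R) (n : nat) (s : 'I_n -> bool).
Hypotheses (mb : measurable_fun setT b) (b01 : forall x, 0 <= b x <= 1).
Local Notation k := (\sum_i s i)%N.

Let mcos : measurable_fun setT (@cos R). Proof. exact: (@exp_bounded_cos R).1. Qed.
Let msin : measurable_fun setT (@sin R). Proof. exact: (@exp_bounded_sin R).1. Qed.
Let cos1 (u : R) : `|cos u| <= 1. Proof. by rewrite ler_norml cos_geN1 cos_le1. Qed.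
Let sin1 (u : R) : `|sin u| <= 1. Proof. by rewrite ler_norml sin_geN1 sin_le1. Qed.

Let swap (g : R -> R) : measurable_fun setT g -> (forall u, `|g u| <= 1) ->
  \int[N]_x \int[tuple_gauss n]_t (oweight b s t * g (a * x * osum s t)) =
  \int[tuple_gauss n]_t (oweight b s t * \int[N]_x g (a * osum s t * x)).
Proof.
move=> mg g1; rewrite (@Rintegral_swap _ _ 1).
- apply: eq_Rintegral => t _; rewrite -RintegralZl//.
    by apply: eq_Rintegral => x _; rewrite mulrAC.
  apply: (@integrable_std_normal_bounded _ 1) => //.
  by apply: measurableT_comp => //; exact: measurable_funM.
- apply: measurable_funM.
    by apply: measurableT_comp => //; exact: measurable_oweight.
  apply: measurableT_comp => //; apply: measurable_funM.
    by apply: measurable_funM.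
  by apply: measurableT_comp => //; exact: measurable_osum.
- move=> x t; rewrite normrM mulr_ile1// ger0_norm ?oweight_le1//.
  by apply: oweight_ge0 => z; case/andP: (b01 z).
Qed.

(* [expR (- a ^+ 2 * y ^+ 2 / 2)] is the mean of [cos (a * x * y)] over a normal
   [x]; exchanging the integrals leaves a trigonometric integral over the tuple,
   which factorizes over the coordinates. *)
Lemma Rintegral_oweight_gauss_Re :
  \int[tuple_gauss n]_t (oweight b s t * expR (- a ^+ 2 * osum s t ^+ 2 / 2)) =
  \int[N]_x complex.Re ((gauss_cos b (a * x) +i* gauss_sin b (a * x)) ^+ k).
Proof.
transitivity (\int[N]_x \int[tuple_gauss n]_t (oweight b s t * cos (a * x * osum s t))).
  rewrite swap//; apply: eq_Rintegral => t _; congr (_ * _).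
  by rewrite integral_std_normal_cos exprMn mulNr.
apply: eq_Rintegral => x _.
by rewrite -(Rintegral_oweight_trig mb b01 (erefl (gauss_cos b (a * x)))
  (erefl (gauss_sin b (a * x)))).
Qed.

(** The exchange used for the real part now leaves the normal mean of an odd function. This is why
    the means of powers of [Phi] at imaginary arguments are real. *)
Lemma Rintegral_oweight_gauss_Im :
  \int[N]_x complex.Im ((gauss_cos b (a * x) +i* gauss_sin b (a * x)) ^+ k) = 0.
Proof.
transitivity (\int[N]_x \int[tuple_gauss n]_t (oweight b s t * sin (a * x * osum s t))).
  apply: eq_Rintegral => x _.
  by rewrite -(Rintegral_oweight_trig mb b01 (erefl (gauss_cos b (a * x)))
    (erefl (gauss_sin b (a * x)))).
rewrite swap//.
under eq_Rintegral do rewrite integral_std_normal_sin mulr0.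
by rewrite Rintegral_cst// mul0r.
Qed.

End oscillating.

(** Here [exp (a ^+ 2 * S ^+ 2 / 2)] is the normal mean of [exp (a * x * S)]; all integrands are
    nonnegative, so Tonelli applies before any finiteness is known. *)
Lemma integral_oweight_gauss_exp b a n (s : 'I_n -> bool) (m : R -> R) :
  measurable_fun setT b -> (forall x, 0 <= b x) ->
  (forall y, (\int[N]_x (b x * expR (y * x))%:E = (m y)%:E)%E) ->
  (\int[tuple_gauss n]_t (oweight b s t * expR (a ^+ 2 * osum s t ^+ 2 / 2))%:E =
   \int[N]_x (m (a * x) ^+ (\sum_i s i))%:E)%E.
Proof.
move=> mb b0 mE.
pose T := (measurableTypeR R * n.-tuple (measurableTypeR R))%type.
pose f (xt : T) := (oweight b s xt.2 * expR (a * xt.1 * osum s xt.2))%:E.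
have mf : measurable_fun setT f.
  apply/measurable_EFinP; apply: measurable_funM.
    by apply: measurableT_comp => //; exact: measurable_oweight.
  apply: measurableT_comp => //; apply: measurable_funM.
    by apply: measurable_funM.
  by apply: measurableT_comp => //; exact: measurable_osum.
have f0 xt : (0 <= f xt)%E.
  by rewrite lee_fin mulr_ge0 ?expR_ge0// oweight_ge0.
have E := fubini_tonelli (m1 := N) (m2 := tuple_gauss n) f mf f0.
transitivity (\int[tuple_gauss n]_t \int[N]_x f (x, t))%E.
  apply: eq_integral => t _; rewrite /f/=.
  under [RHS]eq_integral do rewrite EFinM mulrAC.
  rewrite ge0_integralZl//.
  - by rewrite integral_std_normal_expR EFinM exprMn.
  - apply/measurable_EFinP; apply: measurableT_comp => //; exact: measurable_funM.
  - by rewrite lee_fin oweight_ge0.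
rewrite -E; apply: eq_integral => x _; rewrite /f/=.
exact: (integral_oweight_expR mb b0 (mE (a * x))).
Qed.

End orthant_integral.

(** * The orthant integral as a mean of a power of [Phi] *)

Section orthant_Phi.
Context {R : realType}.
Local Notation N := (@std_normal R).
Local Notation Ry := (`[0%R, +oo[%classic : set R).
Local Open Scope complex_scope.

Definition ind_ge0 : R -> R := \1_Ry.

Lemma measurable_ind_ge0 : measurable_fun setT ind_ge0.
Proof. exact: measurable_indic. Qed.

Lemma ind_ge0_bounds x : 0 <= ind_ge0 x <= 1.
Proof. by rewrite /ind_ge0 indicE; case: (_ \in _); rewrite /= ?lexx ?ler01. Qed.

Lemma Rintegral_ind_ge0 (K : R -> R) y :
  \int[N]_x (ind_ge0 x * K (y * x)) = half_gauss K y.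
Proof.
rewrite /half_gauss [RHS]Rintegral_mkcond; apply: eq_Rintegral => x _.
by rewrite /ind_ge0 patchE indicE; case: ifP => _ /=; rewrite ?mul1r ?mul0r.
Qed.

Lemma measurable_half_gauss (K : R -> R) (dK : R -> R -> R) :
  (forall y : R, is_derive y 1 (half_gauss K) (dK y (half_gauss K y))) ->
  measurable_fun setT (half_gauss K).
Proof.
move=> d; apply: continuous_measurable_fun => y.
apply/differentiable_continuous/derivable1_diffP.
exact: (@ex_derive _ _ _ _ _ _ _ (d y)).
Qed.

Lemma measurable_half_gauss_sin : measurable_fun setT (@half_gauss R sin).
Proof.
exact: (measurable_half_gauss (dK := fun y h => (Num.sqrt (2 * pi))^-1 - y * h)
  (@is_derive_half_sin R)).
Qed.

Lemma measurable_half_gauss_expR : measurable_fun setT (@half_gauss R expR).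
Proof.
exact: (measurable_half_gauss (dK := fun y h => (Num.sqrt (2 * pi))^-1 + y * h)
  (@is_derive_half_expR R)).
Qed.

Lemma half_gauss_sin_le y : `|half_gauss sin y| <= 2^-1 :> R.
Proof.
have isin := integrable_exp_bounded y (measurable_itv _ : measurable Ry)
  (@exp_bounded_sin R).
apply: (le_trans (le_normr_Rintegral _ isin)) => //.
rewrite -[leRHS](@std_normal_Ry R); apply: le_Rintegral => //.
- exact: integrable_norm isin.
- by apply: finite_measure_integrable_cst.
- by move=> x _; rewrite ler_norml sin_geN1 sin_le1.
Qed.

Lemma half_gauss_expR_ge0 y : 0 <= half_gauss expR y :> R.
Proof. by apply: Rintegral_ge0 => x _; exact: expR_ge0. Qed.

Lemma half_gauss_expR_le y : half_gauss expR y <= expR (y ^+ 2 / 2) :> R.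
Proof.
rewrite -lee_fin -integral_std_normal_expR /half_gauss /Rintegral fineK; last first.
  apply: integrable_fin_num => //.
  exact: (integrable_exp_bounded y _ (@exp_bounded_expR R)).
apply: ge0_subset_integral => //.
by apply/measurable_EFinP; apply: measurableT_comp => //; exact: measurable_funM.
Qed.

Lemma integral_ind_ge0_expR y :
  (\int[N]_x (ind_ge0 x * expR (y * x))%:E = (half_gauss expR y)%:E)%E.
Proof.
rewrite -Rintegral_ind_ge0 /Rintegral fineK//; apply: integrable_fin_num => //.
apply: (@le_integrable _ _ _ N setT _ _ (fun x => (expR (y * x))%:E)) => //.
- apply/measurable_EFinP; apply: measurable_funM; first exact: measurable_ind_ge0.
  apply: measurableT_comp => //; exact: measurable_funM.
- move=> x _ /=; rewrite lee_fin normrM ler_piMl// ger0_norm//.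
  by case/andP: (ind_ge0_bounds x).
- exact: (integrable_exp_bounded y _ (@exp_bounded_expR R)).
Qed.

(** The left side is the Fourier transform of the half-line weight: this is how [Phi] at imaginary
    points enters. *)
Lemma Phi_gauss y :
  gauss_cos ind_ge0 y +i* gauss_sin ind_ge0 y =
  (expR (- y ^+ 2 / 2))%:C * Phi (0 +i* y).
Proof.
rewrite /gauss_cos /gauss_sin !Rintegral_ind_ge0 half_gauss_cosE Phi_imag.
simpc; congr (_ +i* _).
by rewrite mulrA -expRD addNr expR0 mul1r.
Qed.

Lemma gauss1 (y : R) : gauss_cos (fun=> 1) y +i* gauss_sin (fun=> 1) y =
  (expR (- y ^+ 2 / 2))%:C.
Proof.
rewrite /gauss_cos /gauss_sin.
under eq_Rintegral do rewrite mul1r.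
under [X in _ +i* X]eq_Rintegral do rewrite mul1r.
by rewrite integral_std_normal_cos integral_std_normal_sin.
Qed.

(** [Phi (i y)] alone grows with [y]; times the Gaussian factor its real and imaginary parts are
    bounded by 1/2 each. This boundedness supplies the integrability for [mu > 0]. *)
Lemma ReIm_Phi_imag_le1 (y : R) k :
  `|complex.Re (((expR (- y ^+ 2 / 2))%:C * Phi (0 +i* y)) ^+ k)| <= 1 /\
  `|complex.Im (((expR (- y ^+ 2 / 2))%:C * Phi (0 +i* y)) ^+ k)| <= 1.
Proof.
rewrite -Phi_gauss; apply: ReIm_exp_le1.
rewrite /gauss_cos /gauss_sin !Rintegral_ind_ge0 half_gauss_cosE.
have : `|half_gauss sin y| <= 2^-1 :> R by exact: half_gauss_sin_le.
rewrite ler_norml => /andP[h1 h2].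
have e0 := expR_ge0 (- y ^+ 2 / 2).
have e1 : expR (- y ^+ 2 / 2) <= 1.
  by rewrite -expR0 ler_expR mulNr oppr_le0 mulr_ge0 ?sqr_ge0.
nra.
Qed.

Lemma oweight1 n (s : 'I_n -> bool) (t : n.-tuple R) : oweight (fun=> 1) s t = 1.
Proof. by rewrite /oweight big1// => i _; case: ifP. Qed.

Section ratio.
Variables (n : nat) (s : 'I_n -> bool) (mu : R).
Local Notation k := (\sum_i s i)%N.
Local Notation c := (1 + k%:R * mu).
Hypothesis c0 : 0 < c.
Local Notation lam := (- mu / c).
Let f x := Phi (sqrt_real lam * x%:C) ^+ k.
Let w (b : R -> R) (t : n.-tuple R) := oweight b s t * expR (- mu * osum s t ^+ 2 / 2).

Let m1 : measurable_fun setT ((fun=> 1) : R -> R). Proof. by []. Qed.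

(** The [k] marked coordinates contribute [k] factors [exp (- mu * x ^+ 2 / 2)], together
    [exp ((1 - c) * x ^+ 2 / 2)]. Absorbing this weight divides [x] by [sqrt c], which turns
    [sqrt (- mu)] into [sqrt lam] and leaves the factor [1 / sqrt c] in front. *)
Lemma orthant_gauss_Phi :
  [/\ N.-integrable setT (EFin \o (fun x => complex.Re (f x))),
      N.-integrable setT (EFin \o (fun x => complex.Im (f x))),
      \int[N]_x complex.Im (f x) = 0,
      (\int[tuple_gauss n]_t (w ind_ge0 t)%:E =
        ((Num.sqrt c)^-1 * \int[N]_x complex.Re (f x))%:E)%E &
      (\int[tuple_gauss n]_t (w (fun=> 1) t)%:E = (Num.sqrt c)^-1%:E)%E].
Proof.
have sc0 : 0 < Num.sqrt c by rewrite sqrtr_gt0.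
(* For [mu <= 0] the argument of [Phi] is real, and [g] below is the normal distribution function,
   with values between 0 and 1. The weight may grow, but [c > 0] keeps it integrable. *)
have [mu0|mu0] := leP mu 0.
  pose a := Num.sqrt (- mu).
  have aE : a ^+ 2 = - mu by rewrite sqr_sqrtr// oppr_ge0.
  have lam0 : 0 <= lam by rewrite divr_ge0 ?oppr_ge0// ltW.
  pose g x : R := expR (- x ^+ 2 / 2) * half_gauss expR x.
  have g0 x : 0 <= g x by rewrite mulr_ge0 ?expR_ge0 ?half_gauss_expR_ge0.
  have g1 x : g x <= 1.
    apply: (le_trans (ler_wpM2l (expR_ge0 _) (half_gauss_expR_le x))).
    by rewrite -expRD mulNr addNr expR0.
  have mg : measurable_fun setT g.
    apply: measurable_funM; last exact: measurable_half_gauss_expR.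
    apply: (eq_measurable_fun (fun x : R => expR ((-1) * x ^+ 2 / 2))).
      by move=> x _; rewrite mulN1r.
    by apply: continuous_measurable_fun; exact: continuous_expR_sqr.
  have fE x : f x = (g (a * (x / Num.sqrt c)) ^+ k)%:C.
    rewrite /f /sqrt_real lam0 -(rmorphM (real_complex R)) Phi_real.
    rewrite -(rmorphXn (real_complex R)) /g; congr ((expR (- _ ^+ 2 / 2) * half_gauss _ _)^+ k)%:C;
      by rewrite sqrtrM ?oppr_ge0// sqrtrV ?ltW// mulrAC mulrA.
  have mgk : measurable_fun setT (fun x => g (a * x) ^+ k).
    apply: measurable_funX; apply: (measurableT_comp mg); exact: measurable_funM.
  have ReE : (fun x => complex.Re (f x)) = fun x => g (a * (x / Num.sqrt c)) ^+ k.
    by apply/funext => x; rewrite fE.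
  have ImE : (fun x => complex.Im (f x)) = fun x => 0.
    by apply/funext => x; rewrite fE.
  have intRe : N.-integrable setT (EFin \o (fun x => complex.Re (f x))).
    rewrite ReE; apply: (@integrable_std_normal_bounded _ _ 1).
      by apply: (measurableT_comp mgk); exact: measurable_funM.
    by move=> x; rewrite normrX exprn_ile1// ger0_norm.
  split => //.
  - rewrite ImE; exact: finite_measure_integrable_cst.
  - by rewrite ImE Rintegral_cst// mul0r.
  - rewrite /w -aE (integral_oweight_gauss_exp a s measurable_ind_ge0
      (fun x => (andP (ind_ge0_bounds x)).1) integral_ind_ge0_expR).
    transitivity (\int[N]_x ((expR ((1 - c) * x ^+ 2 / 2))%:E * (g (a * x) ^+ k)%:E))%E.
      apply: eq_integral => x _; rewrite -EFinM; congr (_%:E).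
      rewrite /g exprMn mulrA -expRM_natl -expRD.
      rewrite [X in expR X](_ : _ = 0) ?expR0 ?mul1r//.
      by rewrite exprMn aE; field.
    rewrite (ge0_integral_std_normal_weight (f := fun x => (g (a * x) ^+ k)%:E) c0).
    + rewrite EFinM ReE; congr (_ * _)%E; rewrite /Rintegral fineK//.
      by move: (intRe); rewrite ReE => /integrable_fin_num; apply.
    + exact/measurable_EFinP.
    + by move=> x; rewrite lee_fin exprn_ge0.
  - rewrite /w -aE (integral_oweight_gauss_exp (m := fun y => expR (y ^+ 2 / 2)) a s m1)//; last first.
      by move=> y; under eq_integral do rewrite mul1r; exact: integral_std_normal_expR.
    transitivity (\int[N]_x ((expR ((1 - c) * x ^+ 2 / 2))%:E * 1))%E.
      apply: eq_integral => x _; rewrite mule1; congr (_%:E).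
      by rewrite -expRM_natl exprMn aE; congr expR; field.
    rewrite (ge0_integral_std_normal_weight (f := fun x => 1%E) c0)//.
    by rewrite integral_cst// mul1e [X in (_ * X)%E](probability_setT N) mule1.
(* For [mu > 0] the argument of [Phi] is imaginary, the weight [exp (- mu S ^+ 2 / 2)] is a normal
   mean of cosines, and every exchange of integrals rests on bounded integrands. *)
pose a := Num.sqrt mu.
have aE : - a ^+ 2 = - mu by rewrite sqr_sqrtr// ltW.
pose g x := Phi (0 +i* (a * x)) ^+ k.
have fE x : f x = g (x / Num.sqrt c).
  rewrite /f /g /sqrt_real ifF; last first.
    by apply/negbTE; rewrite -ltNge mulNr oppr_lt0 divr_gt0.
  congr (Phi _ ^+ k); simpc; congr (_ +i* _).
  by rewrite sqrtrM ?ltW// sqrtrV ?ltW// mulrAC mulrA.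
have [mRe mIm] : measurable_fun setT (fun x => complex.Re (g x)) /\
    measurable_fun setT (fun x => complex.Im (g x)).
  rewrite /g; under eq_fun do rewrite Phi_imag.
  under [X in _ /\ measurable_fun _ X]eq_fun do rewrite Phi_imag.
  apply: (measurable_ReIm_exp (A := fun=> 2^-1)
    (B := fun x => expR ((a * x) ^+ 2 / 2) * half_gauss sin (a * x))) => //.
  apply: (@measurableT_comp _ _ _ _ _ _ (fun x : R => expR (x ^+ 2 / 2) * half_gauss sin x)).
    apply: measurable_funM; last exact: measurable_half_gauss_sin.
    apply: (eq_measurable_fun (fun x : R => expR (1 * x ^+ 2 / 2))).
      by move=> x _; rewrite mul1r.
    by apply: continuous_measurable_fun; exact: continuous_expR_sqr.
  exact: measurable_funM.
have gE x : ((expR (- (a * x) ^+ 2 / 2))%:C * Phi (0 +i* (a * x))) ^+ k =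
    (expR ((1 - c) * x ^+ 2 / 2))%:C * g x.
  rewrite exprMn -(rmorphXn (real_complex R)) -expRM_natl; congr ((expR _)%:C * _).
  by rewrite exprMn -[a ^+ 2]opprK aE; field.
have ReM (r : R) z : complex.Re (r%:C * z) = r * complex.Re z.
  by case: z => u v; simpc.
have ImM (r : R) z : complex.Im (r%:C * z) = r * complex.Im z.
  by case: z => u v; simpc.
have mweight : measurable_fun setT (fun x : R => expR ((1 - c) * x ^+ 2 / 2)).
  by apply: continuous_measurable_fun; exact: continuous_expR_sqr.
(* The weighted function is bounded although [g] is not; the change of variance then transfers
   integrability to the rescaled [f]. *)
have iRe : N.-integrable setT
    (fun x : R => (expR ((1 - c) * x ^+ 2 / 2) * complex.Re (g x))%:E).
  apply: (@integrable_std_normal_bounded _ _ 1); first exact: measurable_funM.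
  by move=> x; rewrite -ReM -gE; exact: (ReIm_Phi_imag_le1 _ _).1.
have iIm : N.-integrable setT
    (fun x : R => (expR ((1 - c) * x ^+ 2 / 2) * complex.Im (g x))%:E).
  apply: (@integrable_std_normal_bounded _ _ 1); first exact: measurable_funM.
  by move=> x; rewrite -ImM -gE; exact: (ReIm_Phi_imag_le1 _ _).2.
have ReE : (fun x => complex.Re (f x)) = fun x => complex.Re (g (x / Num.sqrt c)).
  by apply/funext => x; rewrite fE.
have ImE : (fun x => complex.Im (f x)) = fun x => complex.Im (g (x / Num.sqrt c)).
  by apply/funext => x; rewrite fE.
have wE (b : R -> R) : measurable_fun setT b -> (forall x, 0 <= b x <= 1) ->
    (\int[tuple_gauss n]_t (w b t)%:E = (\int[N]_x complex.Re
     ((gauss_cos b (a * x) +i* gauss_sin b (a * x)) ^+ k))%:E)%E.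
  move=> mb b01; rewrite -Rintegral_oweight_gauss_Re//= aE /Rintegral fineK//.
  apply: integrable_fin_num => //.
  apply: (@integrable_tuple_gauss_bounded _ _ _ 1).
    apply: measurable_funM; first exact: measurable_oweight.
    apply: measurableT_comp => //; apply: measurable_funM => //.
    apply: measurable_funM => //; apply: measurable_funX; exact: measurable_osum.
  move=> t; rewrite ger0_norm; last first.
    by rewrite mulr_ge0 ?expR_ge0// oweight_ge0// => x; case/andP: (b01 x).
  rewrite mulr_ile1 ?expR_ge0 ?oweight_le1//.
    by rewrite oweight_ge0// => x; case/andP: (b01 x).
  rewrite -expR0 ler_expR !mulNr oppr_le0.
  by rewrite mulr_ge0// mulr_ge0 ?sqr_ge0 ?ltW.
split.
- rewrite ReE; exact: (integrable_std_normal_weight c0 mRe iRe).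
- rewrite ImE; exact: (integrable_std_normal_weight c0 mIm iIm).
- rewrite ImE; have := integral_std_normal_weight c0 mIm iIm.
  rewrite (_ : \int[N]_x _ = 0).
    by move/esym/eqP; rewrite mulf_eq0 invr_eq0 gt_eqF//= => /eqP.
  rewrite -[RHS](Rintegral_oweight_gauss_Im a s measurable_ind_ge0 ind_ge0_bounds).
  by apply: eq_Rintegral => x _; rewrite Phi_gauss gE ImM.
- rewrite wE; [|exact: measurable_ind_ge0|exact: ind_ge0_bounds].
  congr (_%:E); rewrite [in RHS]ReE -(integral_std_normal_weight c0 mRe iRe).
  by apply: eq_Rintegral => x _; rewrite Phi_gauss gE ReM.
- rewrite wE//; last by move=> x; rewrite ler01 lexx.
  congr (_%:E).
  transitivity (\int[N]_x (expR ((1 - c) * x ^+ 2 / 2) * 1)).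
    apply: eq_Rintegral => x _; rewrite gauss1 -(rmorphXn (real_complex R)) -expRM_natl/=.
    by rewrite mulr1; congr expR; rewrite exprMn -[a ^+ 2]opprK aE; field.
  rewrite (integral_std_normal_weight (f := fun=> 1) c0)//; last first.
    apply: (@integrable_std_normal_bounded _ _ 1); first exact: measurable_funM.
    move=> x; rewrite mulr1 ger0_norm ?expR_ge0// -[leRHS]expR0 ler_expR.
    rewrite opprD addrA subrr add0r mulNr mulNr oppr_le0.
    by rewrite mulr_ge0 ?invr_ge0// mulr_ge0 ?sqr_ge0// mulr_ge0 ?(ltW mu0) ?ler0n.
  by rewrite Rintegral_cst// mul1r [X in _ * X](congr1 fine (probability_setT N)) mulr1.
Qed.

End ratio.

Lemma has_mean_std_normal dT (T : measurableType dT) (Pr : probability T R)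
    (xi : {RV Pr >-> R}) (f : R -> R[i]) : standard_normal xi ->
  N.-integrable setT (EFin \o (fun x => complex.Re (f x))) ->
  N.-integrable setT (EFin \o (fun x => complex.Im (f x))) ->
  has_mean Pr (fun t => f (xi t))
    (\int[N]_x complex.Re (f x) +i* \int[N]_x complex.Im (f x)).
Proof.
move=> hxi.
have mxi : measurable_fun setT (xi : T -> measurableTypeR R).
  by move=> _ A mA; rewrite setTI; exact: (@measurable_funPTI _ _ _ _ xi A mA).
(* [std_normal] lives on [measurableTypeR R], whose display is not the one of [R]. *)
pose xi' : {RV Pr >-> measurableTypeR R} :=
  @mfun_Sub _ _ T (measurableTypeR R) xi (mem_set mxi).
have E (h : R -> \bar R) : (\int[distribution Pr xi']_x h x = \int[N]_x h x)%E.
  by apply: (eq_measure_integral N) => A mA _; exact: hxi.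
have transfer (g : R -> R) : N.-integrable setT (EFin \o g) ->
    Pr.-integrable setT (fun t => (g (xi t))%:E) /\
    (\int[Pr]_t (g (xi t))%:E = (\int[N]_x g x)%:E)%E.
  move=> gint; have /integrableP[mg fin] := gint.
  have mgr : measurable_fun setT g by exact/measurable_EFinP.
  have gi : Pr.-integrable setT (fun t => (g (xi t))%:E).
    apply/integrableP; split.
      by apply/measurable_EFinP; apply: (measurableT_comp mgr).
    rewrite -(ge0_integral_distribution xi' (f := fun x => `|(g x)%:E|%E)).
    - by rewrite E.
    - by apply/measurable_EFinP; apply: measurableT_comp.
    - by move=> x; exact: abse_ge0.
  split => //.
  rewrite -(integral_distribution (X := xi') (f := fun x => (g x)%:E) mg gi) E.
  by rewrite /Rintegral fineK//; exact: integrable_fin_num.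
by move=> /transfer[? ?] /transfer[? ?]; split => //; rewrite unlock.
Qed.

(** Both integrals in the last hypothesis carry the nonzero factor [1 / sqrt c]; cancelling it
    leaves [r], which will be a solid angle, as the mean. *)
Lemma has_mean_Phi n (s : 'I_n -> bool) (mu r : R) dT (T : measurableType dT)
    (Pr : probability T R) (xi : {RV Pr >-> R}) : standard_normal xi ->
  0 < 1 + (\sum_i s i)%:R * mu ->
  (\int[tuple_gauss n]_t (oweight ind_ge0 s t * expR (- mu * osum s t ^+ 2 / 2))%:E =
   r%:E * \int[tuple_gauss n]_t (expR (- mu * osum s t ^+ 2 / 2))%:E)%E ->
  has_mean Pr (fun t =>
    Phi (sqrt_real (- mu / (1 + (\sum_i s i)%:R * mu)) * (xi t)%:C) ^+ (\sum_i s i))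
    r%:C.
Proof.
move=> hxi c0; have [iRe iIm Im0 Eind E1] := orthant_gauss_Phi c0.
have -> : (\int[tuple_gauss n]_t (expR (- mu * osum s t ^+ 2 / 2))%:E =
    (Num.sqrt (1 + (\sum_i s i)%:R * mu))^-1%:E)%E.
  by rewrite -E1; apply: eq_integral => t _; rewrite oweight1 mul1r.
rewrite Eind -EFinM => -[]; rewrite [r * _]mulrC.
have sc0 : 0 < Num.sqrt (1 + (\sum_i s i)%:R * mu) by rewrite sqrtr_gt0.
move=> /mulfI <-; last by rewrite invr_eq0 gt_eqF.
by have := has_mean_std_normal hxi iRe iIm; rewrite Im0.
Qed.

End orthant_Phi.

(** * Solid angles from Gram matrices *)

Section dot_product.
Context {R : realType} {d : nat}.
Implicit Types (u v w x : 'rV[R]_d).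

Lemma dotvC u v : dotv u v = dotv v u.
Proof. by apply: eq_bigr => i _; rewrite mulrC. Qed.

Lemma dotv_linear a u v w : dotv (a *: u + v) w = a * dotv u w + dotv v w.
Proof.
rewrite /dotv mulr_sumr -big_split/=; apply: eq_bigr => i _.
by rewrite !mxE mulrDl mulrA.
Qed.

Lemma dotvDl u v w : dotv (u + v) w = dotv u w + dotv v w.
Proof. by have := dotv_linear 1 u v w; rewrite scale1r mul1r. Qed.

Lemma dot0v v : dotv 0 v = 0.
Proof. by rewrite /dotv big1// => i _; rewrite mxE mul0r. Qed.

Lemma dotvZl a u v : dotv (a *: u) v = a * dotv u v.
Proof. by have := dotv_linear a u 0 v; rewrite addr0 dot0v addr0. Qed.

Lemma dotvDr u v w : dotv u (v + w) = dotv u v + dotv u w.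
Proof. by rewrite ![dotv u _]dotvC dotvDl. Qed.

Lemma dotvZr a u v : dotv u (a *: v) = a * dotv u v.
Proof. by rewrite ![dotv u _]dotvC dotvZl. Qed.

Lemma dotvNl u v : dotv (- u) v = - dotv u v.
Proof. by rewrite -scaleN1r dotvZl mulN1r. Qed.

Lemma dotvNr u v : dotv u (- v) = - dotv u v.
Proof. by rewrite dotvC dotvNl dotvC. Qed.

Lemma dotv_sumr (I : Type) (r : seq I) (P : pred I) (F : I -> 'rV[R]_d) u :
  dotv u (\sum_(i <- r | P i) F i) = \sum_(i <- r | P i) dotv u (F i).
Proof.
apply: (big_morph (dotv u)) => [v w|]; first exact: dotvDr.
by rewrite dotvC dot0v.
Qed.

Lemma dotv_suml (I : Type) (r : seq I) (P : pred I) (F : I -> 'rV[R]_d) u :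
  dotv (\sum_(i <- r | P i) F i) u = \sum_(i <- r | P i) dotv (F i) u.
Proof. by rewrite dotvC dotv_sumr; apply: eq_bigr => i _; rewrite dotvC. Qed.

Lemma dotv_ge0 u : 0 <= dotv u u.
Proof. by apply: sumr_ge0 => i _; rewrite -expr2 sqr_ge0. Qed.

Lemma dotv_eq0 u : dotv u u = 0 -> u = 0.
Proof.
move=> /eqP; rewrite psumr_eq0 => [/allP u0|i _]; last by rewrite -expr2 sqr_ge0.
apply/rowP => i; rewrite mxE; have := u0 i (mem_index_enum i).
by rewrite /= mulf_eq0 orbb => /eqP.
Qed.

Lemma dotv_gt0 u : u != 0 -> 0 < dotv u u.
Proof. by move=> u0; rewrite lt0r dotv_ge0 andbT; apply: contra_neq u0 => /dotv_eq0. Qed.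

Lemma enorm_sqr u : enorm u ^+ 2 = dotv u u.
Proof. by rewrite sqr_sqrtr// dotv_ge0. Qed.

Lemma dotv_cauchy_schwarz u v : dotv u v ^+ 2 <= dotv u u * dotv v v.
Proof.
have [->|v0] := eqVneq v 0; first by rewrite dotvC !dot0v expr0n mulr0.
have vv := dotv_gt0 v0.
have := dotv_ge0 (dotv v v *: u - dotv u v *: v).
rewrite !(dotvDl, dotvDr, dotvNl, dotvNr, dotvZl, dotvZr) (dotvC v u).
set a := dotv u v; set b := dotv u u; set c := dotv v v in vv *.
have -> : c * (c * b - a * a) + (c * - (a * a) - a * - (a * c)) =
  c * (b * c - a ^+ 2) by ring.
by rewrite pmulr_rge0// subr_ge0.
Qed.

End dot_product.

(** * Inner products, orthonormal bases and Gram determinants *)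

Section inner_product.
Context {R : realType} {d : nat}.
Implicit Types (u v w x : 'rV[R]_d) (V : {vspace 'rV[R]_d}).

Definition inner_product (g : 'rV[R]_d -> 'rV[R]_d -> R) :=
  [/\ forall u v, g u v = g v u,
      forall a u v w, g (a *: u + v) w = a * g u w + g v w &
      forall u, u != 0 -> 0 < g u u].

Definition lin_indep n (X : 'I_n -> 'rV[R]_d) :=
  forall c : 'I_n -> R, \sum_i c i *: X i = 0 -> forall i, c i = 0.

Definition spans V n (X : 'I_n -> 'rV[R]_d) :=
  forall v, v \in V <-> exists c : 'I_n -> R, v = \sum_i c i *: X i.

Lemma dim_lin_indep V n (X : 'I_n -> 'rV[R]_d) :
  lin_indep X -> spans V X -> \dim V = n.
Proof.
move=> Xfree XV; pose t := [tuple X i | i < n].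
have -> : V = <<t>>%VS.
  apply/vspaceP => v; apply/idP/idP => [/XV[c ->]|/coord_span ->].
    by apply: memv_suml => i _; apply/memvZ/memv_span/map_f; rewrite mem_enum.
  apply/XV; exists (fun i => coord t i v); apply: eq_bigr => i _.
  by rewrite -tnth_nth tnth_mktuple.
have /eqP -> : free t; last by rewrite size_tuple.
apply/freeP => c E i; apply: Xfree; rewrite -[RHS]E; apply: eq_bigr => j _.
by rewrite -tnth_nth tnth_mktuple.
Qed.

Lemma spans_vbasis V : spans V (tnth (vbasis V)).
Proof.
move=> v; split => [vV|[c ->]].
  exists (fun i => coord (vbasis V) i v); rewrite [LHS](coord_vbasis vV).
  by apply: eq_bigr => i _; rewrite -tnth_nth.
by apply: memv_suml => i _; apply/memvZ/vbasis_mem; exact: mem_tnth.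
Qed.

Lemma lin_indep_vbasis V : lin_indep (tnth (vbasis V)).
Proof.
move=> c E; have /freeP := basis_free (vbasisP V); apply.
by rewrite -[RHS]E; apply: eq_bigr => i _; rewrite -tnth_nth.
Qed.

(** A row annihilated by [M] would be a linear relation among the [X i]. *)
Lemma change_of_basis V n (X Y : 'I_n -> 'rV[R]_d) :
  lin_indep X -> (forall i, X i \in V) -> spans V Y ->
  exists2 M : 'M[R]_n, M \in unitmx & forall i, X i = \sum_j M i j *: Y j.
Proof.
move=> Xfree XV YV.
have /choice[c cE] : forall i, exists c : 'I_n -> R, X i = \sum_j c j *: Y j.
  by move=> i; apply/YV.
exists (\matrix_(i, j) c i j); last first.
  by move=> i; rewrite cE; apply: eq_bigr => j _; rewrite mxE.
rewrite -row_free_unit; apply: inj_row_free => r rM.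
apply/rowP => i; rewrite mxE; apply: (Xfree (r 0)).
under eq_bigr do rewrite cE scaler_sumr.
rewrite exchange_big big1// => j _; under eq_bigr do rewrite scalerA.
rewrite -scaler_suml; have /rowP/(_ j) := rM; rewrite !mxE.
by under eq_bigr do rewrite mxE; move=> ->; rewrite scale0r.
Qed.

Section theory.
Variable g : 'rV[R]_d -> 'rV[R]_d -> R.
Hypothesis ip : inner_product g.

Lemma ipC u v : g u v = g v u. Proof. by case: ip. Qed.

Lemma ip0l v : g 0 v = 0.
Proof.
case: ip => _ gL _; have := gL 1 0 0 v; rewrite scaler0 addr0 mul1r => /eqP.
by rewrite -subr_eq0 opprD addrA subrr add0r oppr_eq0 => /eqP.
Qed.

Lemma ipDl u v w : g (u + v) w = g u w + g v w.
Proof. by case: ip => _ gL _; have := gL 1 u v w; rewrite scale1r mul1r. Qed.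

Lemma ipZl a u v : g (a *: u) v = a * g u v.
Proof. by case: ip => _ gL _; have := gL a u 0 v; rewrite addr0 ip0l addr0. Qed.

Lemma ipDr u v w : g u (v + w) = g u v + g u w.
Proof. by rewrite ![g u _]ipC ipDl. Qed.

Lemma ipZr a u v : g u (a *: v) = a * g u v.
Proof. by rewrite ![g u _]ipC ipZl. Qed.

Lemma ipNl u v : g (- u) v = - g u v.
Proof. by rewrite -scaleN1r ipZl mulN1r. Qed.

Lemma ipNr u v : g u (- v) = - g u v.
Proof. by rewrite ipC ipNl ipC. Qed.

Lemma ip_suml (I : Type) (r : seq I) (P : pred I) (F : I -> 'rV[R]_d) v :
  g (\sum_(i <- r | P i) F i) v = \sum_(i <- r | P i) g (F i) v.
Proof.
apply: (big_morph (g^~ v)) => [u w|]; [exact: ipDl|exact: ip0l].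
Qed.

Lemma ip_sumr (I : Type) (r : seq I) (P : pred I) (F : I -> 'rV[R]_d) v :
  g v (\sum_(i <- r | P i) F i) = \sum_(i <- r | P i) g v (F i).
Proof. by rewrite ipC ip_suml; apply: eq_bigr => i _; rewrite ipC. Qed.

Lemma ip_comb n (c e : 'I_n -> R) (X Y : 'I_n -> 'rV[R]_d) :
  g (\sum_i c i *: X i) (\sum_j e j *: Y j) =
  \sum_i \sum_j c i * e j * g (X i) (Y j).
Proof.
rewrite ip_suml; apply: eq_bigr => i _; rewrite ip_sumr; apply: eq_bigr => j _.
by rewrite ipZl ipZr mulrA.
Qed.

Lemma ip_eq0 u : g u u = 0 -> u = 0.
Proof.
by move=> gu; apply/eqP; apply: contraT => /(let: And3 _ _ p := ip in p u); rewrite gu ltxx.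
Qed.

Lemma ip_ge0 u : 0 <= g u u.
Proof.
have [->|u0] := eqVneq u 0; first by rewrite ip0l.
by case: ip => _ _ /(_ u u0)/ltW.
Qed.

Definition orthonormal n (B : 'I_n -> 'rV[R]_d) :=
  forall i j, g (B i) (B j) = (i == j)%:R.

Lemma ip_orthonormal n (B : 'I_n -> 'rV[R]_d) (c : 'I_n -> R) j : orthonormal B ->
  g (\sum_i c i *: B i) (B j) = c j.
Proof.
move=> oB; rewrite ip_suml (bigD1 j)//= big1 => [|i ij].
  by rewrite ipZl oB eqxx mulr1 addr0.
by rewrite ipZl oB (negbTE ij) mulr0.
Qed.

Lemma orthonormal_lin_indep n (B : 'I_n -> 'rV[R]_d) : orthonormal B -> lin_indep B.
Proof. by move=> oB c c0 i; rewrite -(ip_orthonormal c i oB) c0 ip0l. Qed.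

(** Gram-Schmidt along the generating list: a vector equal to its projection [p] is dropped,
    otherwise the normalised residue is put in front. *)
Lemma orthonormal_span (X : seq 'rV[R]_d) :
  exists m (B : 'I_m -> 'rV[R]_d), orthonormal B /\ spans <<X>>%VS B.
Proof.
elim: X => [|x X [m [B [oB BX]]]].
  exists 0, (fun=> 0); split=> [[]//|v]; rewrite span_nil memv0.
  by split => [/eqP ->|[c ->]]; [exists (fun=> 0); rewrite big_ord0|rewrite big_ord0].
rewrite span_cons; pose p := \sum_i g x (B i) *: B i.
have pX : p \in <<X>>%VS by apply/BX; exists (fun i => g x (B i)).
have [xp|xp] := eqVneq x p.
  exists m, B; split => // v; rewrite (addv_idPr _)//.
  by rewrite -memvE xp.
have xp0 : 0 < g (x - p) (x - p) by case: ip => _ _; apply; rewrite subr_eq0.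
pose r := Num.sqrt (g (x - p) (x - p)).
have r0 : r != 0 by rewrite gt_eqF// sqrtr_gt0.
have xpB j : g (x - p) (B j) = 0.
  by rewrite ipDl ipNl (ip_orthonormal _ _ oB) subrr.
pose B' i := oapp B (r^-1 *: (x - p)) (unlift ord0 i).
have sumB' (c : 'I_m.+1 -> R) : \sum_i c i *: B' i =
    (c ord0 / r) *: (x - p) + \sum_i c (lift ord0 i) *: B i.
  rewrite big_ord_recl /B' unlift_none/= scalerA; congr (_ + _).
  by apply: eq_bigr => i _; rewrite liftK.
exists m.+1, B'; split.
  move=> i j; rewrite /B'.
  case: (unliftP ord0 i) => [i' ->|->]; case: (unliftP ord0 j) => [j' ->|->]//=.
  - by rewrite ipZr ipC xpB mulr0.
  - by rewrite ipZl xpB mulr0.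
  - rewrite ipZl ipZr mulrA -expr2 exprVn sqr_sqrtr ?ltW// mulVf//.
    by rewrite gt_eqF.
move=> v; split => [/memv_addP[_ /vlineP[a ->] [w /BX[c ->] ->]]|[c ->]].
  (* From [a x = a (x - p) + a p]: the residue has length [r], and [p] has coefficients
     [g x (B i')]. *)
  exists (fun i => oapp (fun i' => c i' + a * g x (B i')) (a * r) (unlift ord0 i)).
  rewrite sumB' unlift_none/= mulfK// scalerBr -addrA; congr (_ + _).
  have -> : \sum_(i < m) oapp (fun i' => c i' + a * g x (B i')) (a * r)
      (unlift ord0 (lift ord0 i)) *: B i = \sum_i c i *: B i + a *: p.
    rewrite /p scaler_sumr -big_split; apply: eq_bigr => i _.
    by rewrite liftK/= scalerDl scalerA.
  by rewrite addrCA addNr addr0.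
rewrite sumB' scalerBr -addrA; apply/memv_addP.
exists (c ord0 / r *: x); first by apply/vlineP; exists (c ord0 / r).
exists (- ((c ord0 / r) *: p) + \sum_i c (lift ord0 i) *: B i) => //.
apply: rpredD; first by rewrite rpredN memvZ.
by apply/BX; exists (fun i => c (lift ord0 i)).
Qed.

Lemma orthonormal_basis V :
  exists m (B : 'I_m -> 'rV[R]_d), orthonormal B /\ spans V B.
Proof.
have [m [B [oB BX]]] := orthonormal_span (vbasis V).
by exists m, B; split => //; rewrite (span_basis (vbasisP V)) in BX.
Qed.

(** Relative to an orthonormal basis the Gram matrix is [M M^T] with [M] invertible. Hence the
    density factor in [metric_volume] is positive and can be cancelled. *)
Lemma det_gram_gt0 V :
  0 < \det (\matrix_(i, j) g (tnth (vbasis V) i) (tnth (vbasis V) j)).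
Proof.
have [m [B [oB BX]]] := orthonormal_basis V.
have m_dim := dim_lin_indep (orthonormal_lin_indep oB) BX; subst m.
have [|M uM ME] := change_of_basis (@lin_indep_vbasis V) _ BX.
  by move=> i; apply: vbasis_mem; exact: mem_tnth.
rewrite (_ : matrix_of_fun _ _ = M *m M^T); last first.
  apply/matrixP => i j; rewrite !mxE !ME ip_comb; apply: eq_bigr => k _.
  rewrite (bigD1 k)//= big1 => [|l lk]; first by rewrite oB eqxx mulr1 addr0 mxE.
  by rewrite oB eq_sym (negbTE lk) mulr0.
rewrite det_mulmx det_tr -expr2 exprn_even_gt0//=.
by rewrite -unitfE -unitmxE.
Qed.

End theory.
End inner_product.

Lemma divMl_cancel {R : realType} (a x y : R) : 0 < a -> a * x / (a * y) = x / y.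
Proof. by move=> a0; rewrite invfM mulrACA divff ?gt_eqF// mul1r. Qed.

Lemma mule_fin_num {R : realType} (c : R) (y : \bar R) : 0 < c ->
  (c%:E * y)%E \is a fin_num -> y \is a fin_num.
Proof.
move=> c0; case: y => [y| |] //.
  by rewrite gt0_muley ?lte_fin.
by rewrite gt0_muleNy ?lte_fin.
Qed.

(** A product involving an infinite factor is infinite or zero. This yields finiteness of both the
    radial constant and the ball volume from that of a Gaussian integral. *)
Lemma mule_eq_fin_num {R : realType} (x y : \bar R) (p : R) : p != 0 ->
  (x * y = p%:E)%E -> x \is a fin_num /\ y \is a fin_num.
Proof.
move=> p0.
have oo (r : R) (e : \bar R) : e = +oo%E \/ e = -oo%E -> (r%:E * e = p%:E)%E -> False.
  have [r0|r0|->] := ltgtP r 0; last by rewrite mul0e => _ [/esym/eqP]; rewrite (negbTE p0).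
    by case=> ->; rewrite ?lt0_muley ?lt0_muleNy ?lte_fin.
  by case=> ->; rewrite ?gt0_muley ?gt0_muleNy ?lte_fin.
case: x => [r| |]; case: y => [v| |] // E; exfalso.
- by apply: oo E; left.
- by apply: oo E; right.
- by rewrite muleC in E; apply: oo E; left.
- by rewrite muleC in E; apply: oo E; right.
Qed.

(** * The solid angle of an orthant cone in terms of its Gram matrix *)

Section solid_angle_orthant.
Context {R : realType} {d : nat} (kappa : R) (x : 'rV[R]_d).
Local Notation g := (klein_metric kappa x).
Hypothesis ip : inner_product g.

Lemma linear_hull_unique (A : set 'rV[R]_d) V : is_linear_hull A V -> linear_hull A = V.
Proof.
move=> [AV Vmin]; have [AL Lmin] := linear_hullP A.
by apply: subv_anti; rewrite Lmin//= Vmin.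
Qed.

Section gram.
Variables (n : nat) (E : 'I_n -> 'rV[R]_d) (s : 'I_n -> bool) (mu : R).
Hypothesis c0 : 0 < 1 + (\sum_i s i)%:R * mu.
Hypothesis gE : forall i j, g (E i) (E j) = (i == j)%:R + mu * (s i)%:R * (s j)%:R.

Let comb (t : n.-tuple R) := \sum_i tnth t i *: E i.

Definition orthant : set (n.-tuple R) := [set t | forall i, s i -> 0 <= tnth t i].
Definition gram_form (t : n.-tuple R) := sqsum t + mu * osum s t ^+ 2.
Local Notation K := orthant.
Local Notation Q := gram_form.

Lemma metric_combE t : g (comb t) (comb t) = gram_form t.
Proof.
rewrite ip_comb// /gram_form /sqsum.
transitivity (\sum_i (tnth t i ^+ 2 + mu * osum s t * ((s i)%:R * tnth t i))).
  apply: eq_bigr => i _; under eq_bigr do rewrite gE mulrDr.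
  rewrite big_split/=; congr (_ + _).
    rewrite (bigD1 i)//= big1 => [|j ij]; first by rewrite eqxx mulr1 addr0 expr2.
    by rewrite eq_sym (negbTE ij) mulr0.
  rewrite /osum mulr_sumr mulr_suml; apply: eq_bigr => j _; ring.
by rewrite big_split/= -mulr_sumr -/(osum s t); ring.
Qed.

(** Pairing a relation with [E j] gives [c j + mu s_j S = 0] with [S] the sum of the marked
    coefficients; summing over marked [j] gives [(1 + k mu) S = 0], so [S] and then every [c j]
    vanish. *)
Lemma gram_lin_indep : lin_indep E.
Proof.
move=> c cE0.
have E1 j : c j + mu * (s j)%:R * (\sum_i (s i)%:R * c i) = 0.
  rewrite -[RHS](ip0l ip (E j)) -cE0 (ip_suml ip).
  under [RHS]eq_bigr do rewrite (ipZl ip) gE mulrDr.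
  rewrite big_split/=; congr (_ + _).
    rewrite (bigD1 j)//= big1 => [|i ij]; first by rewrite eqxx mulr1 addr0.
    by rewrite (negbTE ij) mulr0.
  by rewrite mulr_sumr; apply: eq_bigr => i _; ring.
have S0 : \sum_i (s i)%:R * c i = 0.
  have : (1 + (\sum_i s i)%:R * mu) * (\sum_i (s i)%:R * c i) = 0.
    rewrite mulrDl mul1r natr_sum -mulrA mulr_suml -big_split/=.
    rewrite big1// => i _; transitivity ((s i)%:R * (0 : R)); last by rewrite mulr0.
    by rewrite -[in RHS](E1 i); case: (s i) => /=; ring.
  by move/eqP; rewrite mulf_eq0 gt_eqF//= => /eqP.
by move=> j; have := E1 j; rewrite S0 mulr0 addr0.
Qed.

Lemma gram_form_ge0 t : 0 <= gram_form t.
Proof. by rewrite -metric_combE ip_ge0. Qed.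

Let K_indic t : \1_K t = oweight ind_ge0 s t :> R.
Proof.
rewrite indicE /oweight; have [Kt|nKt] := pselect (K t).
  rewrite mem_set// big1// => i _; case: ifPn => // si.
  by rewrite /ind_ge0 indicE mem_set//= in_itv/= andbT; exact: Kt.
rewrite memNset//; apply/esym/eqP/prodf_eq0.
have /existsNP[i /not_implyP[si ti]] := nKt.
exists i => //; rewrite si /ind_ge0 indicE memNset//=.
by rewrite in_itv/= andbT.
Qed.

Lemma measurable_orthant : measurable (K : set (n.-tuple (measurableTypeR R))).
Proof.
have -> : K = (oweight ind_ge0 s) @^-1` [set 1].
  apply/seteqP; split => t; rewrite /preimage/= -K_indic indicE.
    by move=> Kt; rewrite mem_set.
  by case: (pselect (K t)) => // nKt; rewrite memNset// => /esym/eqP; rewrite oner_eq0.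
rewrite -[X in measurable X]setTI; apply: measurable_oweight => //.
exact: measurable_ind_ge0.
Qed.

Lemma measurable_gram_form : measurable_fun setT Q.
Proof.
apply: measurable_funD; first exact: measurable_sqsum.
by apply: measurable_funM => //; apply: measurable_funX; exact: measurable_osum.
Qed.

Lemma measurable_gram_ball : measurable [set t : n.-tuple (measurableTypeR R) | Q t <= 1].
Proof.
rewrite (_ : [set t | _] = Q @^-1` `]-oo, 1]); last first.
  by apply/seteqP; split => t; rewrite /= in_itv.
by rewrite -[X in measurable X]setTI; exact: measurable_gram_form.
Qed.

Let Qhom r t : Q (tuple_of (r *: row_of t)) = r ^+ 2 * Q t.
Proof.
rewrite /Q /sqsum /osum mulrDr mulr_sumr; congr (_ + _).
  by apply: eq_bigr => i _; rewrite tnth_mktuple !mxE exprMn.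
rewrite [RHS]mulrCA -exprMn mulr_sumr; congr (_ * _ ^+ 2).
by apply: eq_bigr => i _; rewrite tnth_mktuple !mxE mulrCA.
Qed.

Let Kcone r t : (0 < r) -> K (tuple_of (r *: row_of t)) <-> K t.
Proof.
move=> r0; split => Kt i si; have := Kt i si; rewrite tnth_mktuple !mxE.
  by rewrite pmulr_rge0.
by move=> ti; rewrite mulr_ge0// ltW.
Qed.

Let mK := measurable_orthant.
Let mQ := measurable_gram_form.
Let mB := measurable_gram_ball.

(** The part [sqsum] of [Q] goes into the Gaussian density, so only the rank-one part remains as a
    weight. *)
Let gauss_volume (A : set (n.-tuple (measurableTypeR R))) : measurable A ->
  (forall r t, 0 < r -> A (tuple_of (r *: row_of t)) <-> A t) ->
  (radial n * tuple_volume n (A `&` [set t | Q t <= 1]%R) =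
   (Num.sqrt (2 * pi) ^+ n)%:E *
   \int[tuple_gauss n]_t (\1_A t * expR (- mu * osum s t ^+ 2 / 2))%:E)%E.
Proof.
move=> mA Acone; rewrite -integral_gauss_cone//; last exact: gram_form_ge0.
rewrite -ge0_integral_tuple_volume_gauss.
- apply: eq_integral => t _; rewrite -EFinM mulrCA -expRD; congr (_ * expR _)%:E.
  by rewrite /Q; field.
- apply/measurable_EFinP; apply: measurable_funM; first exact: measurable_indic.
  apply: measurableT_comp => //; apply: measurable_funM => //.
  by apply: measurable_funM => //; apply: measurable_funX; exact: measurable_osum.
- by move=> t; rewrite lee_fin mulr_ge0 ?expR_ge0.
Qed.

Let volK := tuple_volume n (K `&` [set t | Q t <= 1]).
Let volT := tuple_volume n [set t | Q t <= 1].
Let IK := (\int[tuple_gauss n]_t (oweight ind_ge0 s t * expR (- mu * osum s t ^+ 2 / 2))%:E)%E.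
Let I1 := (\int[tuple_gauss n]_t (expR (- mu * osum s t ^+ 2 / 2))%:E)%E.

(** The quotient of [gauss_volume] for the orthant and for the whole space. The radial constant may
    be cancelled because its product with [volT] is the positive real [p]; [volK] is finite by
    monotonicity. *)
Lemma orthant_ball_ratio : [/\ volK \is a fin_num, volT \is a fin_num,
  0 < fine volT & IK = ((fine volK / fine volT)%:E * I1)%E].
Proof.
have VK : (radial n * volK = (Num.sqrt (2 * pi) ^+ n)%:E * IK)%E.
  rewrite gauss_volume//; congr (_ * _)%E; apply: eq_integral => t _.
  by rewrite K_indic.
have VT : (radial n * volT = (Num.sqrt (2 * pi) ^+ n)%:E * I1)%E.
  rewrite /volT -[X in tuple_volume n X]setTI gauss_volume//.
  by congr (_ * _)%E; apply: eq_integral => t _; rewrite indicT mul1r.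
have [_ _ _ IKE I1E] := orthant_gauss_Phi c0.
have I1E' : I1 = (Num.sqrt (1 + (\sum_i s i)%:R * mu))^-1%:E.
  by rewrite -I1E; apply: eq_integral => t _; rewrite oweight1 mul1r.
rewrite I1E' -EFinM in VT.
set p := _ * _ in VT.
have p0 : 0 < p by rewrite mulr_gt0 ?exprn_gt0 ?sqrt2pi_gt0// invr_gt0 sqrtr_gt0.
have volT0 : (0 <= volT)%E by exact: measure_ge0.
have volK0 : (0 <= volK)%E by exact: measure_ge0.
have volKT : (volK <= volT)%E.
  apply: le_measure; rewrite ?inE//; first exact: measurableI.
have [fr fT] := mule_eq_fin_num (lt0r_neq0 p0) VT.
have fK : volK \is a fin_num.
  by rewrite ge0_fin_numE//; apply: le_lt_trans volKT _; rewrite -ge0_fin_numE.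
move: VT VK volT0; rewrite -(fineK fr) -(fineK fT) -(fineK fK) -EFinM => -[rT].
set r := fine (radial n) in rT *; set vT := fine volT in rT *.
rewrite -EFinM => rK; rewrite lee_fin => vT0.
have vT_neq0 : vT != 0 by apply: contra_eq_neq rT => ->; rewrite mulr0 lt_eqF.
split => //; first by rewrite lt0r vT_neq0.
have r_neq0 : r != 0 by apply: contra_eq_neq rT => ->; rewrite mul0r lt_eqF.
rewrite /IK IKE -EFinM in rK; case: rK => rK.
rewrite I1E' /IK IKE -EFinM; congr (_%:E).
apply: (@mulfI _ (Num.sqrt (2 * pi) ^+ n)).
  by rewrite expf_neq0// gt_eqF// sqrt2pi_gt0.
rewrite -rK [RHS](_ : _ = fine volK / vT * p); last by rewrite /p/=; ring.
by rewrite -rT; field; exact: vT_neq0.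
Qed.

Section coordinates.
Variables (e : 'I_n -> 'rV[R]_d) (M : 'M[R]_n).
Hypotheses (uM : M \in unitmx) (ME : forall i, E i = \sum_j M i j *: e j).

Lemma comb_mulmx t : \sum_j tnth (tuple_mulmx M t) j *: e j = comb t.
Proof.
rewrite /comb; under [RHS]eq_bigr do rewrite ME scaler_sumr.
rewrite exchange_big; apply: eq_bigr => j _.
rewrite tnth_mktuple mxE scaler_suml; apply: eq_bigr => i _.
by rewrite mxE scalerA.
Qed.

(** The same [c] serves for every [S], so it drops out of quotients of volumes. Measurability in the
    coordinates of [e] is transported by the inverse matrix. *)
Lemma volume_coordinates : exists2 c : R, 0 < c &
  forall S : set 'rV[R]_d,
  measurable [set t : n.-tuple (measurableTypeR R) | S (comb t)] ->
  (tuple_volume n [set t | S (comb t)] =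
   c%:E * volume [set t : n.-tuple R | S (\sum_j tnth t j *: e j)%R])%E.
Proof.
have [c cpos cE] := scales_volume_unitmx uM; exists c => // S mS.
pose S' := [set t : n.-tuple R | S (\sum_j tnth t j *: e j)].
have SE t : S' (tuple_mulmx M t) = S (comb t) by rewrite /S'/= comb_mulmx.
have mS' : measurable (S' : set (n.-tuple (measurableTypeR R))).
  rewrite (_ : S' = tuple_mulmx (invmx M) @^-1` [set t | S (comb t)]).
    rewrite -[X in measurable X]setTI; apply: measurable_tuple_mulmx => //.
  apply/seteqP; split => t; rewrite /preimage/= -SE /tuple_mulmx tuple_ofK mulmxKV//;
    by rewrite row_ofK.
have VI (A : set (n.-tuple (measurableTypeR R))) : measurable A ->
    (tuple_volume n A = \int[tuple_volume n]_t (\1_A t)%:E)%E.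
  by move=> mA; rewrite integral_indic// setIT.
rewrite volumeE// (VI _ mS) (VI _ mS') -cE.
- apply: eq_integral => t _; congr (_%:E); rewrite !indicE; congr (_ %:R).
  by congr nat_of_bool; apply/idP/idP; rewrite !inE SE.
- by apply/measurable_EFinP; exact: measurable_indic.
- by move=> t; rewrite lee_fin.
Qed.

End coordinates.

End gram.

(** Numerator and denominator of [solid_angle] share the Gram factor of [vbasis] and the constant of
    the change of coordinates, so the quotient of volumes can be read in the coordinates of [E],
    where only the Gram matrix of [E] matters. *)
Lemma solid_angle_gram n (E : 'I_n -> 'rV[R]_d) (s : 'I_n -> bool) (mu : R) :
  0 < 1 + (\sum_i s i)%:R * mu ->
  (forall i j, g (E i) (E j) = (i == j)%:R + mu * (s i)%:R * (s j)%:R) ->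
  let K := [set u | exists2 t : 'I_n -> R, (forall i, s i -> 0 <= t i) &
                      u = \sum_i t i *: E i] in
  (\int[tuple_gauss n]_t (oweight ind_ge0 s t * expR (- mu * osum s t ^+ 2 / 2))%:E =
   (solid_angle kappa x K)%:E *
   \int[tuple_gauss n]_t (expR (- mu * osum s t ^+ 2 / 2))%:E)%E.
Proof.
move=> c0 gE K.
have Efree := gram_lin_indep c0 gE.
pose V := <<[tuple E i | i < n]>>%VS.
have VE : spans V E.
  move=> v; split => [/coord_span ->|[c ->]].
    exists (fun i => coord [tuple E i | i < n] i v); apply: eq_bigr => i _.
    by rewrite -tnth_nth tnth_mktuple.
  by apply: memv_suml => i _; apply/memvZ/memv_span/map_f; rewrite mem_enum.
have hullK : linear_hull K = V.
  apply: linear_hull_unique; split=> [u [t _ ->]|W KW]; first by apply/VE; exists t.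
  apply/subvP => v /VE[c ->]; apply: memv_suml => i _; apply/memvZ/KW.
  exists (fun j => (j == i)%:R); first by move=> j _; rewrite ler0n.
  rewrite (bigD1 i)//= eqxx scale1r big1 ?addr0// => j ji.
  by rewrite (negbTE ji) scale0r.
have n_dim := dim_lin_indep Efree VE.
(* Identifies [n] with the dimension of the hull, so that [E] and [vbasis V] are indexed alike. *)
rewrite /solid_angle hullK; clearbody V; subst n.
have [|M uM ME] := change_of_basis Efree _ (@spans_vbasis _ _ V).
  move=> i; apply/VE; exists (fun j => (j == i)%:R).
  rewrite (bigD1 i)//= eqxx scale1r big1 ?addr0// => j ji.
  by rewrite (negbTE ji) scale0r.
have [c cpos cE] := volume_coordinates uM ME.
have [fK fT vT0 ->] := orthant_ball_ratio c0 gE.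
congr (_%:E * _)%E; rewrite /metric_volume.
set G := (Num.sqrt _)%:E.
have G0 : exists2 r, 0 < r & G = r%:E.
  by eexists; [|reflexivity]; rewrite sqrtr_gt0; exact: det_gram_gt0.
have [r r0 ->] := G0.
pose B := [set u | g u u <= 1].
have combE t : B (\sum_i tnth t i *: E i) = (gram_form s mu t <= 1) :> Prop.
  by rewrite /B/= (metric_combE gE).
(* By independence of [E], the coefficients witnessing membership in [K] are the coordinates
   themselves. *)
have KE : [set t : (\dim V).-tuple R | (K `&` B) (\sum_i tnth t i *: E i)] =
    orthant s `&` [set t | gram_form s mu t <= 1].
  apply/seteqP; split => [t [[t' t'0 tE]]|t [Kt Bt]].
    rewrite combE => Bt; split => // i si.
    suff -> : tnth t i = t' i by exact: t'0.
    apply/eqP; rewrite -subr_eq0; apply/eqP; move: i {si}; apply: Efree.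
    under eq_bigr do rewrite scalerBl.
    by rewrite big_split/= sumrN tE subrr.
  by split; [exists (tnth t)|rewrite combE].
have LE : [set t : (\dim V).-tuple R | ([set u | u \in V] `&` B) (\sum_i tnth t i *: E i)] =
    [set t | gram_form s mu t <= 1].
  apply/seteqP; split => [t [_]|t Bt]; first by rewrite combE.
  by split; rewrite ?combE//; apply/VE; exists (tnth t).
have mB := measurable_gram_ball s mu.
have mKB := measurableI _ _ (measurable_orthant s) mB.
move: fK fT vT0.
have := cE (K `&` B); rewrite KE => ->//.
have := cE ([set u | u \in V] `&` B); rewrite LE => ->//.
set vK := volume _; set vT := volume _ => fK fT vT0.
have fK' := mule_fin_num cpos fK; have fT' := mule_fin_num cpos fT.
by rewrite !fineM//= !divMl_cancel.
Qed.

End solid_angle_orthant.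

(** * Angles at a face of a polytope *)

Section klein_inner_product.
Context {R : realType} {d : nat} (kappa : R) (x : 'rV[R]_d).
Hypothesis xB : klein_ball kappa x.
Local Notation g := (klein_metric kappa x).

Lemma klein_ball_gt0 : 0 < 1 + kappa * dotv x x.
Proof.
have xx := dotv_ge0 x.
have [k0|k0] := leP 0 kappa.
  by rewrite (lt_le_trans ltr01)// lerDl mulr_ge0.
case: xB => [|xk]; first by rewrite leNgt k0.
have sk : 0 < Num.sqrt (- kappa) by rewrite sqrtr_gt0 oppr_gt0.
have : enorm x ^+ 2 < (Num.sqrt (- kappa))^-1 ^+ 2.
  by rewrite ltr_pXn2r// ?nnegrE ?sqrtr_ge0// invr_ge0 ltW.
rewrite enorm_sqr exprVn sqr_sqrtr; last by rewrite oppr_ge0 ltW.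
by rewrite -div1r ltr_pdivlMr ?oppr_gt0// mulrN; lra.
Qed.

Lemma klein_inner_product : inner_product g.
Proof.
have s0 := klein_ball_gt0.
split=> [u v|a u v w|u u0]; rewrite /klein_metric !enorm_sqr.
- by rewrite (dotvC u v) [kappa * dotv x u * _]mulrAC.
- by rewrite dotv_linear dotvDr dotvZr; field; rewrite gt_eqF.
have uu := dotv_gt0 u0.
(* Over the common denominator, positivity is Cauchy-Schwarz for [kappa >= 0]; for negative [kappa]
   the numerator regroups as [|u|^2 (1 + kappa |x|^2) - kappa <x, u>^2]. *)
have -> : dotv u u / (1 + kappa * dotv x x)
    - kappa * dotv x u * dotv x u / (1 + kappa * dotv x x) ^+ 2 =
    (dotv u u + kappa * (dotv u u * dotv x x - dotv x u ^+ 2)) / (1 + kappa * dotv x x) ^+ 2.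
  by field; rewrite gt_eqF.
rewrite divr_gt0 ?exprn_gt0//.
have CS := dotv_cauchy_schwarz x u.
have [k0|k0] := leP 0 kappa.
  rewrite (lt_le_trans uu)// lerDl mulr_ge0//; lra.
have : 0 <= - kappa * dotv x u ^+ 2 by rewrite mulr_ge0 ?sqr_ge0//; lra.
have : 0 < dotv u u * (1 + kappa * dotv x x) by rewrite mulr_gt0.
nra.
Qed.

(** The metric tensor is a multiple of the identity plus a rank-one matrix, so Sherman-Morrison
    inverts it explicitly. This turns a Euclidean normal into the vector representing the same
    functional for [g]. *)
Lemma klein_metric_dual f u :
  g ((1 + kappa * dotv x x) *: (f + (kappa * dotv x f) *: x)) u = dotv f u.
Proof.
have s0 := klein_ball_gt0.
rewrite /klein_metric !enorm_sqr !(dotvZl, dotvZr, dotvDl, dotvDr).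
by field; rewrite gt_eqF.
Qed.

End klein_inner_product.

(** * Feasible directions and faces of polyhedra *)

Section feasible_directions.
Context {R : realType} {d : nat}.
Implicit Types (x u : 'rV[R]_d).

(** Refers only to the points of [P], hence is the bridge from an arbitrary system of inequalities
    to explicit facet normals. *)
Definition feasible (P : set 'rV[R]_d) x u := exists2 e : R, 0 < e & P (x + e *: u).

Lemma feasible_halfspaces (I : finType) (c : I -> 'rV[R]_d) (t : I -> R) x u :
  (forall r, dotv (c r) x <= t r) ->
  feasible [set y | forall r, dotv (c r) y <= t r] x u <->
  forall r, dotv (c r) x = t r -> dotv (c r) u <= 0.
Proof.
move=> xP; split=> [[e e0 Pe] r xt|Tu].
  by have := Pe r; rewrite dotvDr xt dotvZr gerDl pmulr_rle0.
have /choice[e eE] r : exists e : R, 0 < e /\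
    forall e', 0 < e' -> e' <= e -> dotv (c r) (x + e' *: u) <= t r.
  have [xt|xt] := eqVneq (dotv (c r) x) (t r).
    exists 1; split=> // e' e'0 _.
    by rewrite dotvDr xt dotvZr gerDl pmulr_rle0// Tu.
  have {}xt : dotv (c r) x < t r by rewrite lt_neqAle xt xP.
  have un : 0 < 1 + `|dotv (c r) u| by rewrite ltr_pwDl.
  (* A step length that the positive slack can afford; adding 1 keeps the denominator nonzero. *)
  exists ((t r - dotv (c r) x) / (1 + `|dotv (c r) u|)).
  split; first by rewrite divr_gt0// subr_gt0.
  move=> e' e'0; rewrite ler_pdivlMr// dotvDr dotvZr mulrDr mulr1 => le.
  have : e' * dotv (c r) u <= e' * `|dotv (c r) u| by rewrite ler_pM2l// ler_norm.
  lra.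
(* The default 1 keeps the minimum positive even for an empty family. *)
exists (\big[Num.min/1]_r e r).
  by apply: lt_bigmin => // r _; case: (eE r).
move=> r; apply: (eE r).2.
  by apply: lt_bigmin => // r' _; case: (eE r').
exact: bigmin_le_cond.
Qed.

End feasible_directions.

Section polyhedron_face.
Context {R : realType} {d : nat} (m : nat) (a : 'I_m -> 'rV[R]_d) (b : 'I_m -> R).
Variables (F : set 'rV[R]_d) (x : 'rV[R]_d).
Local Notation P := (polyhedron a b).
Hypotheses (FP : is_face F P) (xF : relint F x).

Let subFP y : F y -> P y.
Proof. by case: FP => _ [c [t [_ ->]]] []. Qed.

Let Fx : F x. Proof. by case: xF. Qed.

Lemma enormZ (r : R) (u : 'rV[R]_d) : 0 <= r -> enorm (r *: u) = r * enorm u.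
Proof.
move=> r0; rewrite /enorm dotvZl dotvZr mulrA -expr2 sqrtrM ?sqr_ge0//.
by rewrite sqrtr_sqr ger0_norm.
Qed.

Lemma relint_move u : u \in direction F -> exists2 e : R, 0 < e & F (x + e *: u).
Proof.
case: xF => _ [e e0 He] uF.
have un : 0 < 1 + enorm u by rewrite ltr_pwDl// sqrtr_ge0.
exists (e / (1 + enorm u)); first by rewrite divr_gt0.
apply: He; rewrite addrC addrA addNr add0r ?memvZ//.
rewrite enormZ; last by rewrite ltW// divr_gt0.
by rewrite mulrAC ltr_pdivrMr// ltr_pM2l// ltrDr.
Qed.

(** If the inequality were tight at [x] but strict at some [y] of [F], a small move from [x] away
    from [y] would stay in [F] and violate it. *)
Lemma relint_slack r : (forall y, F y -> dotv (a r) y = b r) \/ dotv (a r) x < b r.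
Proof.
have [|nt] := pselect (forall y, F y -> dotv (a r) y = b r); [by left|right].
have /existsNP[y /not_implyP[Fy /eqP yb]] := nt.
have yb' : dotv (a r) y < b r by rewrite lt_neqAle yb (subFP Fy).
rewrite lt_neqAle (subFP Fx r) andbT; apply/eqP => xb.
have [e e0 Fe] : exists2 e : R, 0 < e & F (x + e *: (x - y)).
  by apply: relint_move; apply: (linear_hullP _).1; exists x, y.
have := subFP Fe r; rewrite dotvDr dotvZr dotvDr dotvNr xb.
have := mulr_gt0 e0 (_ : 0 < b r - dotv (a r) y); rewrite subr_gt0 => /(_ yb'); lra.
Qed.

(** At a relative interior point the inequalities tight at [x] are exactly those tight on all of
    [F]. In particular the cone does not depend on [a] and [b]. *)
Lemma tangent_coneE : tangent_cone a b F = [set u | feasible P x u].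
Proof.
apply/seteqP; split=> u /=; rewrite feasible_halfspaces; try exact: subFP.
  by move=> Tu r xt; apply: Tu; case: (relint_slack r) => //; rewrite xt ltxx.
by move=> Tu r tight; apply: Tu; exact: tight.
Qed.

(** [F] is cut out by a supporting functional [c]; if both [u] and [- u] are feasible then [c]
    vanishes on [u], so the feasible point in direction [u] lies in [F]. *)
Lemma directionE u : u \in direction F <-> feasible P x u /\ feasible P x (- u).
Proof.
split=> [uF|].
  have uF' : - u \in direction F by rewrite memvN.
  by split; [have [e e0 Fe] := relint_move uF|
    have [e e0 Fe] := relint_move uF']; exists e => //; exact: subFP.
case=> -[e e0 Pe] [e' e'0 Pe'].
have [_ [c [t [cP FE]]]] := FP.
have cx : dotv c x = t by move: Fx; rewrite FE => -[].
have := cP _ Pe; have := cP _ Pe'.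
rewrite !dotvDr !dotvZr dotvNr cx !gerDl mulrN oppr_le0 !pmulr_rle0// pmulr_rge0// => cu cu'.
have Fe : F (x + e *: u).
  rewrite FE; split => //=.
  by rewrite dotvDr dotvZr cx (le_anti (introT andP (conj cu' cu))) mulr0 addr0.
suff : e *: u \in direction F.
  by move=> /(memvZ e^-1); rewrite scalerA mulVf ?gt_eqF// scale1r.
by apply: (linear_hullP _).1; exists (x + e *: u), x; split=> //; rewrite addrC addrA addNr add0r.
Qed.

End polyhedron_face.

(** * Tangent and normal cones in explicit bases *)

Section polytope_angles.
Context {R : realType} {d : nat} (kappa : R).
Variables (m : nat) (a : 'I_m -> 'rV[R]_d) (b : 'I_m -> R).
Variables (P F : set 'rV[R]_d) (x : 'rV[R]_d).
Hypotheses (PE : P = polyhedron a b) (FP : is_face F P) (xF : relint F x).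
Hypothesis xB : klein_ball kappa x.
Local Notation g := (klein_metric kappa x).

Variables (n : nat) (f : 'I_n -> 'rV[R]_d) (del : 'I_n -> R) (lam : R).
Hypotheses (del0 : forall j, 0 < del j) (lam0 : 0 < 1 + n%:R * lam).
Hypothesis feasP : forall u, feasible P x u <-> forall j, dotv (f j) u <= 0.
(** By [klein_metric_dual] the left side is, up to the factor [s], the product for [g] of the
    vectors representing [f i] and [f j]. *)
Hypothesis gramP : forall i j, dotv (f i) (f j) + kappa * dotv x (f i) * dotv x (f j) =
  del i * del j * ((i == j)%:R + lam).

Let ip : inner_product g := klein_inner_product xB.
Let s := 1 + kappa * dotv x x.
Let s0 : 0 < s := klein_ball_gt0 xB.
(** Chosen so that [1 + mu J] is the inverse of [1 + lam J], with [J] the all-ones matrix of size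
    [n]. *)
Let mu := - lam / (1 + n%:R * lam).
(* [w] consists of the rescaled outer normals at [x] with respect to [g]; its Gram
   matrix is the identity plus [lam] in all entries, and [w'] is its dual basis. *)
Let w j := (Num.sqrt s * del j)^-1 *: (s *: (f j + (kappa * dotv x (f j)) *: x)).
Let w' j := w j + mu *: \sum_i w i.

Let gw j u : g (w j) u = (Num.sqrt s * del j)^-1 * dotv (f j) u.
Proof. by rewrite /w (ipZl ip) klein_metric_dual. Qed.

Let gww i j : g (w i) (w j) = (i == j)%:R + lam.
Proof.
rewrite gw /w !dotvZr dotvDr dotvZr (dotvC _ x).
rewrite (_ : _ + _ = del i * del j * ((i == j)%:R + lam)); last by rewrite -gramP; ring.
have sE : s = Num.sqrt s ^+ 2 by rewrite sqr_sqrtr// ltW.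
set r := Num.sqrt s in sE *; have r0 : 0 < r by rewrite sqrtr_gt0.
by rewrite sE; field; rewrite !gt_eqF// del0.
Qed.

Let gw'w i j : g (w' i) (w j) = (i == j)%:R.
Proof.
rewrite (ipDl ip) gww (ipZl ip) (ip_suml ip).
under eq_bigr do rewrite gww.
rewrite big_split/= sumr_const card_ord (bigD1 j)//= big1 => [|l lj]; last first.
  by rewrite (negbTE lj).
by rewrite eqxx addr0 -[lam *+ n]mulr_natl /mu divfK ?(gt_eqF lam0)// addrK.
Qed.

Let gw'w' i j : g (w' i) (w' j) = (i == j)%:R + mu.
Proof.
rewrite {2}/w' (ipDr ip) gw'w (ipZr ip) (ip_sumr ip); congr (_ + _).
under eq_bigr do rewrite gw'w.
by rewrite (bigD1 i)//= eqxx big1 ?addr0 ?mulr1// => l li; rewrite eq_sym (negbTE li).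
Qed.

Let mu0 : 1 + n%:R * mu = (1 + n%:R * lam)^-1.
Proof. by rewrite /mu; field; rewrite gt_eqF. Qed.

Let feasE u : feasible P x u <-> forall j, g u (w j) <= 0.
Proof.
have wj j : 0 < (Num.sqrt s * del j)^-1 by rewrite invr_gt0 mulr_gt0// sqrtr_gt0.
split=> [/feasP uf j|uf]; first by rewrite (ipC ip) gw pmulr_rle0.
by apply/feasP => j; rewrite -(pmulr_rle0 _ (wj j)) -gw (ipC ip).
Qed.

Let dirE u : u \in direction F <-> forall j, g u (w j) = 0.
Proof.
have FP' : is_face F (polyhedron a b) by rewrite -PE.
rewrite (directionE FP' xF) -PE !feasE; split=> [[u1 u2] j|u0].
  by apply: le_anti; rewrite u1 -oppr_le0 -(ipNl ip) u2.
by split=> j; rewrite ?(ipNl ip) u0 ?oppr0.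
Qed.

(** What remains of [u] after removing everything the normals [w j] detect: the component along the
    face. *)
Let z u := u - \sum_j g u (w j) *: w' j.

Let z_dir u : z u \in direction F.
Proof.
apply/dirE => j; rewrite /z (ipDl ip) (ipNl ip) (ip_suml ip).
rewrite (bigD1 j)//= big1 => [|i ij]; last by rewrite (ipZl ip) gw'w (negbTE ij) mulr0.
by rewrite (ipZl ip) gw'w eqxx mulr1 addr0 subrr.
Qed.

Let zE u : u = \sum_j g u (w j) *: w' j + z u.
Proof. by rewrite /z addrC subrK. Qed.

Section basis.
Variables (p : nat) (B : 'I_p -> 'rV[R]_d).
Hypotheses (oB : orthonormal g B) (BF : spans (direction F) B).

(** The signed vectors are [- w' j], since feasibility means a nonpositive product with each [w j];
    the free ones span the direction of the face. *)
Let E (i : 'I_(n + p)) := match fintype.split i with inl j => - w' j | inr l => B l end.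
Let sg (i : 'I_(n + p)) := match fintype.split i with inl _ => true | inr _ => false end.

Let El j : E (lshift p j) = - w' j.
Proof. by rewrite /E (unsplitK (inl j)). Qed.
Let Er l : E (rshift n l) = B l.
Proof. by rewrite /E (unsplitK (inr l)). Qed.
Let sl j : sg (lshift p j) = true.
Proof. by rewrite /sg (unsplitK (inl j)). Qed.
Let sr l : sg (rshift n l) = false.
Proof. by rewrite /sg (unsplitK (inr l)). Qed.

Let Bw l j : g (B l) (w j) = 0.
Proof.
apply: (dirE (B l)).1; apply/BF; exists (fun i => (i == l)%:R).
by rewrite (bigD1 l)//= eqxx scale1r big1 ?addr0// => i il; rewrite (negbTE il) scale0r.
Qed.

Let Bw' l j : g (B l) (w' j) = 0.
Proof.
rewrite (ipDr ip) Bw add0r (ipZr ip) (ip_sumr ip) big1 ?mulr0// => i _; exact: Bw.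
Qed.

Lemma face_basis_gram i j : g (E i) (E j) = (i == j)%:R + mu * (sg i)%:R * (sg j)%:R.
Proof.
rewrite -(splitK i) -(splitK j).
case: (fintype.split i) => i'; case: (fintype.split j) => j' /=;
  rewrite ?El ?Er ?sl ?sr ?(ipNl ip) ?(ipNr ip) /= ?mulr0 ?mulr1 ?addr0.
- by rewrite opprK gw'w' (inj_eq (@lshift_inj _ _)).
- by rewrite (ipC ip) Bw' oppr0 eq_lrshift.
- by rewrite Bw' oppr0 eq_rlshift.
- by rewrite oB (inj_eq (@rshift_inj _ _)).
Qed.

Lemma face_basis_sum (c : 'I_(n + p) -> R) : \sum_i c i *: E i =
  - (\sum_j c (lshift p j) *: w' j) + \sum_l c (rshift n l) *: B l.
Proof.
rewrite big_split_ord/=; congr (_ + _); last by apply: eq_bigr => l _; rewrite Er.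
by rewrite -sumrN; apply: eq_bigr => j _; rewrite El scalerN.
Qed.

Lemma face_basis_signs : (\sum_i sg i = n)%N.
Proof.
rewrite big_split_ord/= [X in (_ + X)%N]big1 => [|l _]; last by rewrite sr.
rewrite addn0; under eq_bigr do rewrite sl.
by rewrite sum_nat_const card_ord muln1.
Qed.

Lemma face_basis_spans u : exists c : 'I_(n + p) -> R,
  (forall j, c (lshift p j) = - g u (w j)) /\ u = \sum_i c i *: E i.
Proof.
have [c cE] := (BF (z u)).1 (z_dir u).
exists (fun i => match fintype.split i with inl j => - g u (w j) | inr l => c l end).
split=> [j|]; first by rewrite (unsplitK (inl j)).
rewrite face_basis_sum {1}(zE u) cE; congr (_ + _).
  by rewrite -sumrN; apply: eq_bigr => j _; rewrite (unsplitK (inl j)) scaleNr opprK.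
by apply: eq_bigr => l _; rewrite (unsplitK (inr l)).
Qed.

Lemma face_basis_dim : (n + p = d)%N.
Proof.
have gE := face_basis_gram.
have c0 : 0 < 1 + (\sum_i sg i)%:R * mu by rewrite face_basis_signs mu0 invr_gt0.
have Efree := gram_lin_indep ip c0 gE.
have <- : \dim {:'rV[R]_d} = d by rewrite dimvf /dim/= mul1n.
apply/esym; apply: (dim_lin_indep Efree) => v; split => [_|[c ->]]; last exact: memvf.
by have [c [_ ->]] := face_basis_spans v; exists c.
Qed.

(** The coordinate of [u] on [- w' j] is [- g u (w j)], so the feasibility inequalities are
    precisely the sign conditions. *)
Lemma tangent_cone_basis : tangent_cone a b F =
  [set u | exists2 t : 'I_(n + p) -> R, (forall i, sg i -> 0 <= t i) & u = \sum_i t i *: E i].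
Proof.
have FP' : is_face F (polyhedron a b) by rewrite -PE.
rewrite (tangent_coneE FP' xF) -PE; apply/seteqP; split=> u /=.
  move=> /feasE uf; have [c [cE uE]] := face_basis_spans u; exists c => // i.
  rewrite -(splitK i); case: (fintype.split i) => j /=; last by rewrite sr.
  by move=> _; rewrite cE oppr_ge0.
move=> [t t0 ->]; apply/feasE => j.
rewrite face_basis_sum (ipDl ip) (ipNl ip) !(ip_suml ip).
rewrite [X in _ + X]big1 => [|l _]; last by rewrite (ipZl ip) Bw mulr0.
rewrite (bigD1 j)//= big1 => [|i ij]; last by rewrite (ipZl ip) gw'w (negbTE ij) mulr0.
by rewrite (ipZl ip) gw'w eqxx mulr1 !addr0 oppr_le0 t0// sl.
Qed.

End basis.

(** Farkas' lemma made explicit by the dual basis: the coefficients [g v (w' j)] are nonnegative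
    because [- w' j] is feasible, and the remainder is orthogonal both to the [w' j] and to the
    direction of [F], hence zero. *)
Lemma normal_cone_basis : normal_cone kappa x a b F =
  [set u | exists2 t : 'I_n -> R, (forall i, true -> 0 <= t i) & u = \sum_i t i *: w i].
Proof.
have FP' : is_face F (polyhedron a b) by rewrite -PE.
rewrite /normal_cone (tangent_coneE FP' xF) -PE; apply/seteqP; split=> v /=; last first.
  move=> [t t0 ->] u /feasE uf; rewrite (ip_suml ip); apply: sumr_le0 => i _.
  by rewrite (ipZl ip) mulr_ge0_le0 ?t0// (ipC ip).
move=> vN.
have vdir u : u \in direction F -> g v u = 0.
  move=> /dirE u0; apply: le_anti; apply/andP; split.
    by apply: vN; apply/feasE => j; rewrite u0.
  by rewrite -oppr_le0 -(ipNr ip); apply: vN; apply/feasE => j; rewrite (ipNl ip) u0 oppr0.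
exists (fun j => g v (w' j)).
  move=> j _; rewrite -oppr_le0 -(ipNr ip); apply: vN; apply/feasE => i.
  by rewrite (ipNl ip) gw'w oppr_le0 ler0n.
apply/eqP; rewrite -subr_eq0; apply/eqP/(ip_eq0 ip).
set v' := v - _.
have v'w' j : g v' (w' j) = 0.
  rewrite /v' (ipDl ip) (ipNl ip) (ip_suml ip) (bigD1 j)//= big1 => [|i ij].
    by rewrite (ipZl ip) (ipC ip (w j)) gw'w eqxx mulr1 addr0 subrr.
  by rewrite (ipZl ip) (ipC ip (w i)) gw'w eq_sym (negbTE ij) mulr0.
have v'z u : u \in direction F -> g v' u = 0.
  move=> uF; rewrite /v' (ipDl ip) (ipNl ip) (ip_suml ip) vdir// big1 ?oppr0 ?addr0// => i _.
  by rewrite (ipZl ip) (ipC ip (w i)) (dirE u).1// mulr0.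
rewrite {2}(zE v') (ipDr ip) (v'z (z v'))// (ip_sumr ip) big1 ?addr0// => i _.
by rewrite (ipZr ip) v'w' mulr0.
Qed.

(** The normal cone has rank-one parameter [lam], the tangent cone [mu]. In [has_mean_Phi] the
    parameter is passed through [t |-> - t / (1 + n t)], which sends [lam] to [mu] and [mu] back to
    [lam]. *)
Lemma polytope_angles dT (T : measurableType dT) (Pr : probability T R)
    (xi : {RV Pr >-> R}) : standard_normal xi ->
  [/\ (n + affine_dim F = d)%N,
      has_mean Pr (fun t => Phi (sqrt_real (- lam / (1 + n%:R * lam)) * (xi t)%:C)%C ^+ n)
        (external_angle kappa x a b F)%:C%C &
      has_mean Pr (fun t => Phi (sqrt_real lam * (xi t)%:C)%C ^+ n)
        (internal_angle kappa x a b F)%:C%C].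
Proof.
move=> hxi.
have [p [B [oB BF]]] := orthonormal_basis ip (direction F).
have pF : affine_dim F = p := dim_lin_indep (orthonormal_lin_indep ip oB) BF.
split.
- by rewrite pF; exact: face_basis_dim BF.
- rewrite /external_angle normal_cone_basis.
  have sn : (\sum_(i < n) true = n)%N by rewrite sum_nat_const card_ord muln1.
  rewrite -{1 2}sn; apply: has_mean_Phi => //; first by rewrite sn.
  apply: solid_angle_gram => //; first by rewrite sn.
  by move=> i j; rewrite gww !mulr1.
- rewrite /internal_angle (tangent_cone_basis BF).
  have sn := face_basis_signs p.
  have c0 : 0 < 1 + n%:R * mu by rewrite mu0 invr_gt0.
  have -> : lam = - mu / (1 + n%:R * mu).
    by rewrite mu0 /mu; field; rewrite gt_eqF.
  rewrite -{1 2}sn; apply: has_mean_Phi => //; first by rewrite sn.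
  apply: solid_angle_gram => //; first by rewrite sn.
  exact: face_basis_gram.
Qed.

End polytope_angles.

(** * From a finite list of facet inequalities to the angles *)

Section tight_facets.
Context {R : realType} {d : nat} (kappa : R).

Variables (m : nat) (a : 'I_m -> 'rV[R]_d) (b : 'I_m -> R).
Variables (P F : set 'rV[R]_d) (x : 'rV[R]_d).
Hypotheses (PE : P = polyhedron a b) (FP : is_face F P) (xF : relint F x).
Hypothesis xB : klein_ball kappa x.

Variables (I : finType) (c : I -> 'rV[R]_d) (t : I -> R) (del : I -> R) (lam : R).
Hypothesis PcE : P = [set y | forall r, dotv (c r) y <= t r].
Hypothesis del0 : forall r, 0 < del r.
Let tight := [set r | dotv (c r) x == t r]%SET.
(** For tight [r] the product of [c r] with [x] is [t r]; substituting it removes [x] from the Gram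
    condition of the preceding section. *)
Hypothesis gramP : forall r r', r \in tight -> r' \in tight ->
  dotv (c r) (c r') + kappa * t r * t r' = del r * del r' * ((r == r')%:R + lam).
Hypothesis sumN0 : tight != finset.set0 -> \sum_(r in tight) (del r)^-1 *: c r != 0.

Let n := #|tight|.
Let f (j : 'I_n) := c (enum_val j).
Let del' (j : 'I_n) := del (enum_val j).

Let xf j : dotv x (f j) = t (enum_val j).
Proof. by have := enum_valP j; rewrite inE dotvC => /eqP. Qed.

Let gramf i j : dotv (f i) (f j) + kappa * dotv x (f i) * dotv x (f j) =
  del' i * del' j * ((i == j)%:R + lam).
Proof. by rewrite !xf gramP ?enum_valP// (inj_eq enum_val_inj). Qed.

(** Evaluate the form [|v|^2 + kappa <x, v>^2], positive definite because [x] lies in the ball, at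
    the sum of the rescaled tight normals: the value is [n (1 + n lam)]. *)
Lemma tight_gram_gt0 : 0 < 1 + n%:R * lam.
Proof.
have s0 := klein_ball_gt0 xB.
have [n0|n0] := posnP n; first by rewrite n0 mul0r addr0.
pose v := \sum_(r in tight) (del r)^-1 *: c r.
have vE : v = \sum_(j < n) (del' j)^-1 *: f j by rewrite /v big_enum_val.
have v0 : v != 0 by apply: sumN0; rewrite -card_gt0.
have vv := dotv_gt0 v0.
have CS := dotv_cauchy_schwarz x v.
have q0 : 0 < dotv v v + kappa * dotv x v ^+ 2.
  have [k0|k0] := leP 0 kappa.
    by rewrite (lt_le_trans vv)// lerDl mulr_ge0// sqr_ge0.
  have : 0 < dotv v v * (1 + kappa * dotv x x) by rewrite mulr_gt0.
  nra.
suff qE : dotv v v + kappa * dotv x v ^+ 2 = n%:R * (1 + n%:R * lam).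
  by move: q0; rewrite qE pmulr_rgt0// ltr0n.
transitivity (\sum_(i < n) \sum_(j < n) ((i == j)%:R + lam)).
  have [y yE] : exists y : 'I_n -> R, forall j, dotv x (f j) = y j by eexists.
  have [G GE] : exists G : 'I_n -> 'I_n -> R, forall i j, dotv (f i) (f j) = G i j.
    by eexists.
  have -> : dotv x v = \sum_(i < n) (del' i)^-1 * y i.
    by rewrite vE dotv_sumr; apply: eq_bigr => i _; rewrite dotvZr yE.
  have -> : dotv v v = \sum_(i < n) \sum_(j < n) (del' i)^-1 * ((del' j)^-1 * G i j).
    rewrite vE dotv_suml; apply: eq_bigr => i _; rewrite dotv_sumr.
    by apply: eq_bigr => j _; rewrite dotvZl dotvZr GE.
  rewrite expr2 mulr_suml mulr_sumr -big_split/=.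
  apply: eq_bigr => i _; rewrite !mulr_sumr -big_split/=.
  apply: eq_bigr => j _.
  transitivity ((del' i)^-1 * (del' j)^-1 * (G i j + kappa * y i * y j)).
    by ring.
  rewrite -GE -!yE gramf; field.
  by rewrite !gt_eqF ?/del'.
transitivity (\sum_(i < n) (1 + n%:R * lam)).
  apply: eq_bigr => i _; rewrite big_split/= sumr_const card_ord mulr_natl.
  congr (_ + _); rewrite (bigD1 i)//= eqxx big1 ?addr0// => j ji.
  by rewrite eq_sym (negbTE ji).
by rewrite sumr_const card_ord [RHS]mulr_natl.
Qed.

Lemma tight_facet_angles k dT (T : measurableType dT) (Pr : probability T R)
    (xi : {RV Pr >-> R}) : standard_normal xi -> affine_dim F = k ->
  let n := (d - k)%N in
  [/\ (k + n = d)%N, 0 < 1 + n%:R * lam,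
      has_mean Pr (fun t => Phi (sqrt_real (- lam / (1 + n%:R * lam)) * (xi t)%:C)%C ^+ n)
        (external_angle kappa x a b F)%:C%C &
      has_mean Pr (fun t => Phi (sqrt_real lam * (xi t)%:C)%C ^+ n)
        (internal_angle kappa x a b F)%:C%C].
Proof.
move=> hxi Fk.
have Px : P x.
  by case: FP => _ [? [? [_ FE]]]; case: xF; rewrite FE => -[].
have feasP u : feasible P x u <-> forall j, dotv (f j) u <= 0.
  rewrite PcE feasible_halfspaces; last by move: Px; rewrite PcE.
  split=> [uP j|uP r /eqP xt].
    by apply: uP; apply/eqP; have := enum_valP j; rewrite inE.
  have rt : r \in tight by rewrite inE.
  by have := uP (enum_rank_in rt r); rewrite /f enum_rankK_in.
have del'0 j : 0 < del' j by exact: del0.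
have [nd ext int] := polytope_angles PE FP xF xB del'0 tight_gram_gt0 feasP gramf hxi.
rewrite Fk in nd.
have -> : (d - k)%N = n by rewrite -nd addnK.
by split=> //; [rewrite addnC|exact: tight_gram_gt0].
Qed.

End tight_facets.

(** * Cubes *)

Section geodesic.
Context {R : realType} {d : nat} (kappa : R).

Lemma cosh_arcosh (q : R) : 1 <= q ->
  (expR (arcosh q) + expR (- arcosh q)) / 2 = q.
Proof.
move=> q1; have q0 : 0 <= q ^+ 2 - 1 by rewrite subr_ge0 expr_ge1// (le_trans ler01).
have r0 : 0 < q + Num.sqrt (q ^+ 2 - 1) by rewrite ltr_pwDl// ?sqrtr_ge0// (lt_le_trans ltr01).
rewrite /arcosh expRN lnK ?posrE//.
have rE := sqr_sqrtr q0; set r := Num.sqrt _ in r0 rE *.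
have -> : (q + r)^-1 = q - r.
  by apply: (@mulfI _ (q + r)); rewrite ?gt_eqF// divff ?gt_eqF// mulrC -subr_sqr rE; ring.
by field.
Qed.

(** [C] is the quotient [q] of the distance formula once [arccos] or [arcosh] can be inverted at
    [q]; the bounds on [q] that permit this also give the position of [C] relative to 1. *)
Lemma curvature_cos_dist (l : R) x y : kappa != 0 ->
  klein_ball kappa x -> klein_ball kappa y -> @geodesic_dist R d kappa x y = l ->
  curvature_cos kappa l = (1 + kappa * dotv x y) /
    Num.sqrt ((1 + kappa * dotv x x) * (1 + kappa * dotv y y)) /\
  (0 < kappa -> curvature_cos kappa l <= 1) /\
  (kappa < 0 -> 1 <= curvature_cos kappa l).
Proof.
move=> k0 xB yB; rewrite /geodesic_dist (negbTE k0) !enorm_sqr.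
have sx := klein_ball_gt0 xB; have sy := klein_ball_gt0 yB.
set D := Num.sqrt _; set q := _ / D.
have D0 : 0 < D by rewrite sqrtr_gt0 mulr_gt0.
have DE : D ^+ 2 = (1 + kappa * dotv x x) * (1 + kappa * dotv y y).
  by rewrite sqr_sqrtr// ltW// mulr_gt0.
have gge := ip_ge0 (klein_inner_product xB) (y - x).
(* The defect [1 - q ^+ 2] is [kappa] times a nonnegative multiple of the squared length of [y - x]
   in the metric at [x]. *)
have qE : q ^+ 2 = 1 - kappa * ((1 + kappa * dotv x x) ^+ 2 * klein_metric kappa x (y - x) (y - x)) / D ^+ 2.
  rewrite /q exprMn exprVn DE /klein_metric !enorm_sqr !(dotvDl, dotvDr, dotvNl, dotvNr) (dotvC y x).
  by field; rewrite !gt_eqF.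
set w := _ ^+ 2 * _ in qE.
have w0 : 0 <= w by rewrite mulr_ge0 ?sqr_ge0.
have wD : 0 <= w / D ^+ 2 by rewrite divr_ge0 ?sqr_ge0.
rewrite -mulrA in qE.
rewrite /curvature_cos; have [kneg|kpos] := ltP kappa 0.
  rewrite ltNge (ltW kneg)/= => <-.
  have sk : Num.sqrt (- kappa) != 0 by rewrite gt_eqF// sqrtr_gt0 oppr_gt0.
  rewrite [_ * (arcosh q / _)]mulrC divfK//.
  have q1 : 1 <= q.
    have q21 : 1 <= q ^+ 2 by rewrite qE; nra.
    (* Selects the branch [1 <= q]: by Cauchy-Schwarz [|kappa <x, y>| < 1] inside the ball. *)
    have q0 : 0 < q.
      rewrite divr_gt0//.
      have CS := dotv_cauchy_schwarz x y; have xx := dotv_ge0 x; have yy := dotv_ge0 y.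
      have h : (kappa * dotv x y) ^+ 2 < 1.
        have : (kappa * dotv x x) * (kappa * dotv y y) < 1.
          have ax : - (kappa * dotv x x) < 1 by lra.
          have ay : - (kappa * dotv y y) < 1 by lra.
          have bx : 0 <= - (kappa * dotv x x) by rewrite -mulNr mulr_ge0// oppr_ge0 ltW.
          have by' : 0 <= - (kappa * dotv y y) by rewrite -mulNr mulr_ge0// oppr_ge0 ltW.
          by rewrite -mulrNN; nra.
        have : 0 <= kappa ^+ 2 * (dotv x x * dotv y y - dotv x y ^+ 2).
          by rewrite mulr_ge0 ?sqr_ge0// subr_ge0.
        nra.
      nra.
    nra.
  by rewrite cosh_arcosh//; split=> //; split.
have {}kpos : 0 < kappa by rewrite lt_neqAle eq_sym k0.
rewrite (negbTE k0) kpos => <-.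
have sk : Num.sqrt kappa != 0 by rewrite gt_eqF// sqrtr_gt0.
rewrite [_ * (acos q / _)]mulrC divfK//.
have q1 : -1 <= q <= 1.
  have : q ^+ 2 <= 1 by rewrite qE; nra.
  by move=> ?; apply/andP; split; nra.
by rewrite acosK//; split=> //; split=> // _; case/andP: q1.
Qed.

End geodesic.

Section cube_angles.
Context {R : realType} {d : nat} (kappa : R).

Definition cube_normal (r : 'I_d * bool) : 'rV[R]_d := (-1) ^+ r.2 *: delta_mx 0 r.1.

Lemma dotv_delta i (y : 'rV[R]_d) : dotv (delta_mx 0 i) y = y 0 i.
Proof.
rewrite /dotv (bigD1 i)//= mxE !eqxx mul1r big1 ?addr0// => j ji.
by rewrite mxE (negbTE ji) andbF mul0r.
Qed.

Lemma dotv_cube_normal r (y : 'rV[R]_d) : dotv (cube_normal r) y = (-1) ^+ r.2 * y 0 r.1.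
Proof. by rewrite dotvZl dotv_delta. Qed.

Lemma cube_halfspaces tau :
  cube tau = [set y | forall r, dotv (cube_normal r) y <= tau].
Proof.
apply/seteqP; split=> y /= yP => [[i e]|i].
  rewrite dotv_cube_normal/=; have /andP[y1 y2] := yP i.
  by case: e; rewrite ?expr0 ?expr1 ?mul1r// mulN1r; lra.
have := yP (i, true); have := yP (i, false); rewrite !dotv_cube_normal/= expr0 expr1 mul1r mulN1r.
by move=> y1 y2; apply/andP; split=> //; lra.
Qed.

(** Tight normals belonging to different coordinates are orthogonal, and opposite facets are never
    both tight as [tau > 0]. So with unit scaling the Gram condition reads
    [delta_ij + kappa * tau ^+ 2]. *)
Lemma cube_angles (tau : R) (m : nat) (a : 'I_m -> 'rV[R]_d) b F x k
    dT (T : measurableType dT) (Pr : probability T R) (xi : {RV Pr >-> R}) :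
  0 < tau -> cube tau = polyhedron a b -> is_face F (cube tau) ->
  relint F x -> klein_ball kappa x -> affine_dim F = k -> standard_normal xi ->
  let lam := kappa * tau ^+ 2 in let n := (d - k)%N in
  [/\ (k + n = d)%N, 0 < 1 + n%:R * lam,
      has_mean Pr (fun t => Phi (sqrt_real (- lam / (1 + n%:R * lam)) * (xi t)%:C)%C ^+ n)
        (external_angle kappa x a b F)%:C%C &
      has_mean Pr (fun t => Phi (sqrt_real lam * (xi t)%:C)%C ^+ n)
        (internal_angle kappa x a b F)%:C%C].
Proof.
move=> tau0 PE FP xF xB Fk hxi; rewrite PE in FP.
apply: (tight_facet_angles PE (t := fun=> tau) (del := fun=> 1) _ xF xB (cube_halfspaces tau)) => //.
- by rewrite PE.
- move=> [i e] [j e']; rewrite !inE !dotv_cube_normal/= => /eqP xi_ /eqP xj.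
  rewrite !mxE/= !mul1r; congr (_ + _); last by rewrite expr2 mulrA.
  rewrite xpair_eqE eq_sym; have [ij|] := eqVneq i j; last by rewrite !mulr0.
  rewrite -ij in xj *.
  have [ee|ee] := eqVneq e e'; first by rewrite -ee mulr1 -expr2 sqrr_sign.
  by exfalso; move: xi_ xj ee; case: e; case: e' => //=; rewrite expr0 expr1 mul1r mulN1r => ? ?; lra.
- move=> /set0Pn[r rt]; apply/eqP => v0.
  (* Every tight normal has product [tau > 0] with [x], so their sum cannot vanish. *)
  suff : 0 < dotv (\sum_(r in [set r | dotv (cube_normal r) x == tau]%SET) 1^-1 *: cube_normal r) x.
    by rewrite v0 dot0v ltxx.
  rewrite dotv_suml (bigD1 r)//= ltr_wpDr//.
    apply: sumr_ge0 => i /andP[+ _]; rewrite inE => /eqP it.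
    by rewrite invr1 scale1r it ltW.
  by move: rt; rewrite inE => /eqP rt; rewrite invr1 scale1r rt.
Qed.

Lemma regular_cube_curvature l tau : (2 <= d)%N ->
  @regular_cube R d kappa l tau ->
  let lam := kappa * tau ^+ 2 in
  0 < 1 + d%:R * lam /\ curvature_cos kappa l - 1 = - 2 * lam / (1 + d%:R * lam).
Proof.
move=> d2 [tau0 sub dist] lam.
pose i0 : 'I_d := Ordinal (ltnW d2 : (0 < d)%N).
pose u : 'rV[R]_d := const_mx tau.
pose v : 'rV[R]_d := \row_j (if j == i0 then - tau else tau).
have uv : cube_vertex tau u by move=> i; rewrite mxE; left.
have vv : cube_vertex tau v by move=> i; rewrite mxE; case: ifP; [right|left].
have vertex_ball (w : 'rV[R]_d) : cube_vertex tau w -> klein_ball kappa w.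
  by move=> wv; apply: sub => i; have := ltW tau0; case: (wv i) => -> ?; apply/andP; split; lra.
have dot_vertex (w : 'rV[R]_d) : cube_vertex tau w -> dotv w w = d%:R * tau ^+ 2.
  move=> wv; rewrite /dotv (eq_bigr (fun=> tau ^+ 2)); last first.
    by move=> i _; rewrite -expr2; case: (wv i) => -> //; rewrite sqrrN.
  by rewrite sumr_const card_ord [RHS]mulr_natl.
have dlam : 1 + kappa * (d%:R * tau ^+ 2) = 1 + d%:R * lam by rewrite /lam mulrCA.
have c0 : 0 < 1 + d%:R * lam.
  by rewrite -dlam -(dot_vertex u uv); exact: klein_ball_gt0 (vertex_ball u uv).
split=> //.
have [k0|k0] := eqVneq kappa 0.
  by rewrite /curvature_cos /lam k0 ltxx eqxx !(mul0r, mulr0) subrr.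
have adj : Defs.adjacent u v.
  exists i0; rewrite !mxE eqxx; split; first lra.
  by move=> j ji; rewrite !mxE (negbTE ji).
have uvE : dotv u v = d%:R * tau ^+ 2 - 2 * tau ^+ 2.
  rewrite -(dot_vertex u uv) /dotv [in RHS](bigD1 i0)//= [LHS](bigD1 i0)//= !mxE eqxx.
  rewrite (eq_bigr (fun i => u 0 i * u 0 i)); first by ring.
  by move=> j ji; rewrite !mxE (negbTE ji).
have [-> _] := curvature_cos_dist k0 (vertex_ball u uv) (vertex_ball v vv) (dist u v uv vv adj).
rewrite !dot_vertex// uvE dlam -expr2 sqrtr_sqr gtr0_norm// mulrBr.
rewrite addrA dlam (mulrCA kappa 2) -/lam.
by field; rewrite gt_eqF.
Qed.

End cube_angles.

(** * Simplices *)

Section simplex_barycentric.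
Context {R : realType} {d : nat}.
Variable v : 'I_d.+1 -> 'rV[R]_d.
Hypothesis vfree : affinely_independent v.

(** The affine functions [A i + c i] are the barycentric coordinates. They are the columns of the
    inverse [U] of the matrix [W] with rows [(1, v i)]: [W U = 1] is the duality with the vertices,
    and [U W = 1] gives the remaining identities. *)
Lemma barycentric_exists : exists (A : 'I_d.+1 -> 'rV[R]_d) (c : 'I_d.+1 -> R),
  [/\ forall i j, dotv (A i) (v j) + c i = (i == j)%:R,
      \sum_i c i = 1, \sum_i A i = 0, \sum_i c i *: v i = 0 &
      forall u, u = \sum_i dotv (A i) u *: v i].
Proof.
pose W : 'M[R]_d.+1 := \matrix_(i, j) oapp (fun j' => v i 0 j') 1 (unlift ord0 j).
have W0 i : W i ord0 = 1 by rewrite mxE unlift_none.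
have W1 i j : W i (lift ord0 j) = v i 0 j by rewrite mxE liftK.
have uW : W \in unitmx.
  rewrite -row_free_unit; apply: inj_row_free => r /rowP rW.
  apply/rowP => i; rewrite mxE; apply: (vfree (w := fun i => r 0 i)).
    by have := rW ord0; rewrite !mxE => E; rewrite -[RHS]E; apply: eq_bigr => j _; rewrite W0 mulr1.
  apply/rowP => j; have := rW (lift ord0 j); rewrite !mxE => E; rewrite -[RHS]E.
  by rewrite summxE; apply: eq_bigr => l _; rewrite W1 mxE.
pose U := invmx W.
have /matrixP WU := mulmxV uW; have /matrixP UW := mulVmx uW.
rewrite -/U in WU UW.
exists (fun i => \row_j U (lift ord0 j) i), (fun i => U ord0 i); split.
- move=> i j; have := WU j i; rewrite !mxE big_ord_recl W0 mul1r eq_sym => E; rewrite -[RHS]E.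
  rewrite addrC; congr (_ + _); apply: eq_bigr => l _.
  by rewrite W1 mxE mulrC.
- have := UW ord0 ord0; rewrite !mxE eqxx => E; rewrite -[RHS]E.
  by apply: eq_bigr => i _; rewrite W0 mulr1.
- apply/rowP => j; have := UW (lift ord0 j) ord0; rewrite !mxE/= => E; rewrite -[RHS]E.
  by rewrite summxE; apply: eq_bigr => i _; rewrite W0 mulr1 mxE.
- apply/rowP => j; have := UW ord0 (lift ord0 j); rewrite !mxE/= => E; rewrite -[RHS]E.
  by rewrite summxE; apply: eq_bigr => i _; rewrite W1 mxE.
- move=> u; apply/rowP => j; rewrite summxE.
  transitivity (\sum_l u 0 l * (\sum_i U (lift ord0 l) i * W i (lift ord0 j))).
    have UWl l : \sum_i U (lift ord0 l) i * W i (lift ord0 j) = (l == j)%:R.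
      by have := UW (lift ord0 l) (lift ord0 j); rewrite !mxE (inj_eq lift_inj).
    under eq_bigr do rewrite UWl.
    rewrite (bigD1 j)//= eqxx mulr1 big1 ?addr0// => l lj.
    by rewrite (negbTE lj) mulr0.
  under eq_bigr do rewrite mulr_sumr.
  rewrite exchange_big; apply: eq_bigr => i _; rewrite [RHS]mxE /dotv mulr_suml.
  by apply: eq_bigr => l _; rewrite W1 [in RHS]mxE; ring.
Qed.

Section functionals.
Variables (A : 'I_d.+1 -> 'rV[R]_d) (c : 'I_d.+1 -> R).
Hypotheses (Av : forall i j, dotv (A i) (v j) + c i = (i == j)%:R)
  (sumc : \sum_i c i = 1) (sumA : \sum_i A i = 0) (sumcv : \sum_i c i *: v i = 0)
  (decomp : forall u, u = \sum_i dotv (A i) u *: v i).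

Lemma simplex_halfspaces :
  convex_hull v = [set y | forall r, dotv (- A r) y <= c r].
Proof.
apply/seteqP; split=> y /= => [[w [w0 w1 ->]] r|yP].
  rewrite dotvNl dotv_sumr.
  have -> : \sum_i dotv (A r) (w i *: v i) = w r - c r.
    rewrite (eq_bigr (fun i => w i * (r == i)%:R - w i * c r)); last first.
      by move=> i _; rewrite dotvZr -Av; ring.
    rewrite sumrB -mulr_suml w1 mul1r (bigD1 r)//= eqxx mulr1 big1 ?addr0// => i ir.
    by rewrite eq_sym (negbTE ir) mulr0.
  by have := w0 r; lra.
exists (fun i => dotv (A i) y + c i); split.
- by move=> i; have := yP i; rewrite dotvNl; lra.
- by rewrite big_split/= sumc -dotv_suml sumA dot0v add0r.
- under eq_bigr do rewrite scalerDl.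
  by rewrite big_split/= sumcv addr0 -decomp.
Qed.

Lemma simplex_angles (kappa : R) (del : 'I_d.+1 -> R) (lam : R)
    (m : nat) (a : 'I_m -> 'rV[R]_d) b F x k
    dT (T : measurableType dT) (Pr : probability T R) (xi : {RV Pr >-> R}) :
  convex_hull v = polyhedron a b -> is_face F (convex_hull v) ->
  relint F x -> klein_ball kappa x -> affine_dim F = k -> standard_normal xi ->
  (forall i, 0 < del i) ->
  (forall i j, dotv (A i) (A j) + kappa * c i * c j = del i * del j * ((i == j)%:R + lam)) ->
  let n := (d - k)%N in
  [/\ (k + n = d)%N, 0 < 1 + n%:R * lam,
      has_mean Pr (fun t => Phi (sqrt_real (- lam / (1 + n%:R * lam)) * (xi t)%:C)%C ^+ n)
        (external_angle kappa x a b F)%:C%C &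
      has_mean Pr (fun t => Phi (sqrt_real lam * (xi t)%:C)%C ^+ n)
        (internal_angle kappa x a b F)%:C%C].
Proof.
move=> PE FP xF xB Fk hxi del0 gram; rewrite PE in FP.
apply: (tight_facet_angles PE (del := del) _ xF xB simplex_halfspaces) => //.
- by rewrite PE.
- by move=> i j _ _; rewrite dotvNl dotvNr opprK.
move=> /set0Pn[i it]; apply/eqP => sum0.
(* Barycentric coordinates sum to 1, so they cannot all vanish at [x]. *)
have [j jt] : exists j, j \notin [set r | dotv (- A r) x == c r]%SET.
  apply/existsP; rewrite -negb_forall; apply/negP => /forallP allt.
  have : \sum_r (dotv (A r) x + c r) = 0.
    by rewrite big1// => r _; have := allt r; rewrite inE dotvNl => /eqP <-; rewrite subrr.
  rewrite big_split/= sumc -dotv_suml sumA dot0v add0r => /eqP.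
  by rewrite oner_eq0.
(* Among the tight functionals only [A i] distinguishes the vertices [v i] and [v j], so a single
   nonzero term survives. *)
have := congr1 (fun u => dotv u (v i - v j)) sum0.
rewrite dot0v dotv_suml (bigD1 i)//= big1 => [|r /andP[rt ri]].
  rewrite addr0 dotvZl dotvNl dotvDr dotvNr.
  have -> : dotv (A i) (v i) - dotv (A i) (v j) = 1.
    have ij : i != j by apply: contraNneq jt => <-.
    by have := Av i i; have := Av i j; rewrite eqxx (negbTE ij) => /= h1 h2; lra.
  by move=> /eqP; rewrite mulrN1 oppr_eq0 invr_eq0 gt_eqF.
rewrite dotvZl dotvNl dotvDr dotvNr.
have -> : dotv (A r) (v i) - dotv (A r) (v j) = 0.
  have rj : r != j by apply: contraNneq jt => <-.
  have := Av r i; have := Av r j; rewrite (negbTE rj) (negbTE ri) => /= h1 h2; lra.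
by rewrite oppr0 mulr0.
Qed.

(* With the matrices [H i l = 1 + kappa * <v i, v l>] and
   [K l j = <A l, A j> + kappa * c l * c j], this reads [H *m K = kappa%:M]. *)
Lemma gram_product (kappa : R) i j :
  \sum_l (1 + kappa * dotv (v i) (v l)) * (dotv (A l) (A j) + kappa * c l * c j) =
  kappa * (i == j)%:R.
Proof.
have E1 : \sum_l dotv (A l) (A j) = 0 by rewrite -dotv_suml sumA dot0v.
have E2 : \sum_l dotv (v i) (v l) * dotv (A l) (A j) = dotv (v i) (A j).
  rewrite {2}(decomp (A j)) dotv_sumr; apply: eq_bigr => l _.
  by rewrite dotvZr mulrC.
have E3 : \sum_l dotv (v i) (v l) * c l = 0.
  transitivity (dotv (v i) (\sum_l c l *: v l)).
    by rewrite dotv_sumr; apply: eq_bigr => l _; rewrite dotvZr mulrC.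
  by rewrite sumcv dotvC dot0v.
transitivity (\sum_l (dotv (A l) (A j) + kappa * c j * c l +
    kappa * (dotv (v i) (v l) * dotv (A l) (A j)) +
    kappa ^+ 2 * c j * (dotv (v i) (v l) * c l))).
  by apply: eq_bigr => l _; ring.
rewrite !big_split/= -!mulr_sumr E1 E2 E3 sumc eq_sym -(Av j i) (dotvC (v i)).
by ring.
Qed.

(** A diagonally scaled [alpha 1 + beta J] is inverted by solving for the weighted column sums
    [S j]: summing [KE] over [i] determines them, and [KE] then gives [K]. Nonvanishing of [alpha]
    and of the denominator is forced by [kappa != 0]. *)
Lemma gram_inverse (kappa alpha beta : R) (e : 'I_d.+1 -> R) : (0 < d)%N ->
  kappa != 0 -> (forall i, e i != 0) ->
  (forall i j, 1 + kappa * dotv (v i) (v j) = e i * e j * (alpha * (i == j)%:R + beta)) ->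
  [/\ alpha != 0, alpha + d.+1%:R * beta != 0 &
   forall i j, dotv (A i) (A j) + kappa * c i * c j =
     kappa / alpha / (e i * e j) * ((i == j)%:R - beta / (alpha + d.+1%:R * beta))].
Proof.
move=> d0 k0 e0 HE.
pose K i j := dotv (A i) (A j) + kappa * c i * c j.
pose S j := \sum_l e l * K l j.
have KE i j : alpha * e i * K i j + beta * S j = kappa * (i == j)%:R / e i.
  apply: (@mulfI _ (e i)) => //.
  rewrite [RHS]mulrC divfK// -gram_product mulrDr /S !mulr_sumr.
  transitivity (\sum_l (e i * (alpha * e i * K i j) * (i == l)%:R + e i * (beta * (e l * K l j)))).
    rewrite big_split/=; congr (_ + _).
    by rewrite (bigD1 i)//= eqxx mulr1 big1 ?addr0// => l li; rewrite eq_sym (negbTE li) mulr0.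
  apply: eq_bigr => l _; rewrite HE -/(K l j).
  by have [->|_] := eqVneq i l; rewrite ?mulr0; ring.
have SE j : (alpha + d.+1%:R * beta) * S j = kappa / e j.
  transitivity (\sum_i (alpha * e i * K i j + beta * S j)).
    rewrite big_split/= sumr_const card_ord -(mulr_natl (beta * S j)).
    rewrite mulrDl /S mulr_sumr; congr (_ + _); last by rewrite -/(S j) mulrA.
    by apply: eq_bigr => l _; rewrite mulrA.
  under eq_bigr do rewrite KE.
  by rewrite (bigD1 j)//= eqxx mulr1 big1 ?addr0// => l lj; rewrite (negbTE lj) mulr0 mul0r.
have D0 : alpha + d.+1%:R * beta != 0.
  apply: contra_eq_neq (SE ord0) => ->; rewrite mul0r eq_sym.
  by rewrite mulf_neq0// invr_eq0.
(* With [alpha = 0] an off-diagonal entry would make [beta * S ord0] zero and the diagonal one would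
   make it nonzero; two indices exist because [0 < d]. *)
have alpha0 : alpha != 0.
  apply/eqP => a0.
  have n0 : (ord_max == ord0 :> 'I_d.+1) = false.
    by apply/negbTE; rewrite -val_eqE/= -lt0n.
  have := KE ord_max ord0; rewrite n0 a0 !mul0r add0r mulr0 mul0r => S0.
  have := KE ord0 ord0; rewrite eqxx a0 !mul0r add0r S0 mulr1 => /esym/eqP.
  by rewrite mulf_eq0 invr_eq0 (negbTE k0) (negbTE (e0 _)).
split=> // i j; have := KE i j; rewrite -/(K i j).
have -> : S j = kappa / e j / (alpha + d.+1%:R * beta) by rewrite -SE mulrAC divff// mul1r.
move=> E; apply: (@mulfI _ (alpha * e i)); first by rewrite mulf_neq0.
rewrite -[LHS](addrK (beta * (kappa / e j / (alpha + d.+1%:R * beta)))) E.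
have dE : (i == j)%:R / e i = (i == j)%:R / e j.
  by have [->|_] := eqVneq i j; rewrite ?mul0r.
rewrite -[kappa * _ / _]mulrA dE; set D := alpha + _ * beta in D0 *.
by field; rewrite D0 alpha0 !e0.
Qed.

(** Serves the flat case, where [gram_product] only says that zero is zero. Weighting the squared
    distances from [v i] by the functionals [A l] and using that these sum to zero expresses
    [L * A i] through [v i] and a vector [B] independent of [i]. *)
Lemma gram_equidistant (L : R) : L != 0 ->
  (forall i j, i != j -> dotv (v i - v j) (v i - v j) = L) ->
  forall i j, dotv (A i) (A j) = 2 / L * ((i == j)%:R - (d.+1%:R)^-1).
Proof.
move=> L0 dist.
pose B := \sum_l dotv (v l) (v l) *: A l.
have A0 u : \sum_l dotv (A l) u = 0 by rewrite -dotv_suml sumA dot0v.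
have dual w u : \sum_l dotv w (v l) * dotv (A l) u = dotv w u.
  rewrite [in RHS](decomp u) dotv_sumr; apply: eq_bigr => l _.
  by rewrite dotvZr mulrC.
have AE i u : L * dotv (A i) u = 2 * dotv (v i) u - dotv B u.
  have E1 : \sum_l dotv (v i - v l) (v i - v l) * dotv (A l) u = - (L * dotv (A i) u).
    transitivity (\sum_l (L * dotv (A l) u - L * dotv (A l) u * (i == l)%:R)).
      apply: eq_bigr => l _; have [->|il] := eqVneq i l; last by rewrite dist// mulr0 subr0.
      by rewrite subrr dot0v/=; ring.
    rewrite sumrB -mulr_sumr A0 mulr0 sub0r (bigD1 i)//= eqxx mulr1 big1 ?addr0// => l li.
    by rewrite eq_sym (negbTE li) mulr0.
  have E2 : \sum_l dotv (v i - v l) (v i - v l) * dotv (A l) u =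
      dotv B u - 2 * dotv (v i) u.
    rewrite /B dotv_suml -(dual (v i) u).
    transitivity (\sum_l (dotv (v i) (v i) * dotv (A l) u + dotv (dotv (v l) (v l) *: A l) u
        + (-2) * (dotv (v i) (v l) * dotv (A l) u))).
      apply: eq_bigr => l _; rewrite dotvZl !(dotvDl, dotvDr, dotvNl, dotvNr) (dotvC (v l) (v i)).
      by ring.
    by rewrite !big_split/= -!mulr_sumr A0; ring.
  by rewrite E1 in E2; lra.
have GE i j : L * dotv (A i) (A j) = 2 * (i == j)%:R - (2 * c j + dotv B (A j)).
  by rewrite AE eq_sym -(Av j i) (dotvC (v i)); ring.
(* The unknown part of column [j] does not depend on [i]; it is fixed by the vanishing sum of the
   [A i]. *)
have mE j : d.+1%:R * (2 * c j + dotv B (A j)) = 2.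
  have : \sum_i (2 * (i == j)%:R - (2 * c j + dotv B (A j))) = 0.
    transitivity (L * \sum_i dotv (A i) (A j)); last by rewrite A0 mulr0.
    by rewrite mulr_sumr; apply: eq_bigr => i _; rewrite GE.
  rewrite sumrB sumr_const card_ord -mulr_sumr -(mulr_natl (2 * c j + _)).
  rewrite (bigD1 j)//= eqxx big1 => [|i ij]; last by rewrite (negbTE ij).
  by rewrite addr0 mulr1 => /eqP; rewrite subr_eq0 => /eqP.
move=> i j; apply: (@mulfI _ L) => //; rewrite GE.
have n0 : d.+1%:R != 0 :> R by rewrite pnatr_eq0.
have -> : 2 * c j + dotv B (A j) = 2 / d.+1%:R.
  by apply: (@mulfI _ d.+1%:R) => //; rewrite mE mulrC divfK.
by move: n0; move: (d.+1%:R : R) => D n0; field; rewrite L0 n0.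
Qed.

End functionals.

End simplex_barycentric.

(** * Gram matrices of regular and ideal simplices *)

Section simplex_gram.
Context {R : realType} {d : nat} (kappa : R) (v : 'I_d.+1 -> 'rV[R]_d).
Variables (A : 'I_d.+1 -> 'rV[R]_d) (c : 'I_d.+1 -> R).
Hypothesis d2 : (2 <= d)%N.
Hypotheses (Av : forall i j, dotv (A i) (v j) + c i = (i == j)%:R)
  (sumc : \sum_i c i = 1) (sumA : \sum_i A i = 0) (sumcv : \sum_i c i *: v i = 0)
  (decomp : forall u, u = \sum_i dotv (A i) u *: v i).

Let gram_shape (lam : R) := exists2 del : 'I_d.+1 -> R, forall i, 0 < del i &
  forall i j, dotv (A i) (A j) + kappa * c i * c j = del i * del j * ((i == j)%:R + lam).

Let d0 : (0 < d)%N. Proof. exact: ltnW. Qed.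

Let i01 : ord0 != ord_max :> 'I_d.+1.
Proof. by rewrite -val_eqE/= eq_sym -lt0n. Qed.

Let v_neq i j : i != j -> v i - v j != 0.
Proof.
move=> ij; apply: contraTneq (oner_neq0 R) => /subr0_eq vij.
have := Av i i; have := Av i j; rewrite -vij (negbTE ij) eqxx/= => -> /eqP.
by rewrite eq_sym => /negPn.
Qed.

(** Scaling by [e i = sqrt (1 + kappa |v i|^2)], the equal distances give [1 + kappa <v i, v j>] the
    entries 1 on the diagonal and [C] off it. Inverting this matrix produces [lam], with denominator
    [(1 - C) + (d + 1) C = 1 + d C]. *)
Lemma regular_simplex_gram l : regular_simplex kappa l v ->
  let C := curvature_cos kappa l in
  1 + d%:R * C != 0 /\ gram_shape (- (C / (1 + d%:R * C))).
Proof.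
move=> [_ sub dist] C.
have vB i : klein_ball kappa (v i).
  apply: sub; exists (fun j => (j == i)%:R); split=> [j||].
  - by rewrite ler0n.
  - by rewrite (bigD1 i)//= eqxx big1 ?addr0// => j ji; rewrite (negbTE ji).
  - rewrite (bigD1 i)//= eqxx scale1r big1 ?addr0// => j ji.
    by rewrite (negbTE ji) scale0r.
have s0 i := klein_ball_gt0 (vB i).
(* In the flat case [C = 1], the functionals are controlled by the Euclidean distances, and
   [lam = - 1 / (d + 1)]. *)
have [k0|k0] := eqVneq kappa 0.
  have -> : C = 1 by rewrite /C /curvature_cos k0 ltxx eqxx.
  have n0 : 0 < 1 + d%:R * 1 :> R by rewrite mulr1 nat1r ltr0n.
  split; first by rewrite gt_eqF.
  have distE i j : i != j -> dotv (v i - v j) (v i - v j) = l ^+ 2.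
    by move=> /dist; rewrite /geodesic_dist k0 eqxx => <-; rewrite enorm_sqr.
  have L0 : 0 < l ^+ 2 by rewrite -(distE _ _ i01) dotv_gt0// v_neq.
  exists (fun=> Num.sqrt (2 / l ^+ 2)) => [_|i j]; first by rewrite sqrtr_gt0 divr_gt0.
  rewrite k0 !mul0r addr0 -expr2 sqr_sqrtr ?divr_ge0 ?ltW//.
  rewrite (gram_equidistant Av sumA decomp (lt0r_neq0 L0) distE).
  by rewrite mulr1 nat1r div1r.
have CE i j : i != j -> 1 + kappa * dotv (v i) (v j) =
    C * (Num.sqrt (1 + kappa * dotv (v i) (v i)) * Num.sqrt (1 + kappa * dotv (v j) (v j))).
  move=> ij; have [CE _] := curvature_cos_dist k0 (vB i) (vB j) (dist _ _ ij).
  rewrite /C CE sqrtrM ?ltW// divfK// mulf_neq0// gt_eqF// sqrtr_gt0//.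
have [_ [Cle1 Cge1]] := curvature_cos_dist k0 (vB ord0) (vB ord_max)
  (dist _ _ i01).
pose e i := Num.sqrt (1 + kappa * dotv (v i) (v i)).
have e0 i : 0 < e i by rewrite sqrtr_gt0.
have [||al0 D0 KE] := gram_inverse (alpha := 1 - C) (beta := C) (e := e)
    Av sumc sumA sumcv decomp d0 k0.
- by move=> i; rewrite gt_eqF.
- move=> i j; have [<-|ij] := eqVneq i j.
    by rewrite mulr1 subrK mulr1 -expr2 sqr_sqrtr// ltW.
  by rewrite mulr0 add0r [RHS]mulrC CE.
have DE : 1 - C + d.+1%:R * C = 1 + d%:R * C by rewrite -natr1; ring.
rewrite DE in D0 KE; split=> //.
(* Numerator and denominator have the same sign, since [C] lies above or below 1 according to the
   sign of [kappa]; the square root in [del] needs this. *)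
have ka0 : 0 < kappa / (1 - C).
  have [kneg|kpos] := ltP kappa 0.
    have : 1 - C < 0 by rewrite lt_neqAle al0 subr_le0 Cge1.
    by move=> ?; rewrite -mulrNN -invrN divr_gt0 ?oppr_gt0.
  have {}kpos : 0 < kappa by rewrite lt_neqAle eq_sym k0.
  by rewrite divr_gt0// lt_neqAle eq_sym al0 subr_ge0 Cle1.
exists (fun i => Num.sqrt (kappa / (1 - C)) / e i) => [i|i j].
  by rewrite divr_gt0// sqrtr_gt0.
rewrite KE -[_ - C / _]/(_ + - (C / _)); congr (_ * _).
by rewrite mulf_div -expr2 sqr_sqrtr// ltW.
Qed.

Lemma ideal_simplex_gram : kappa < 0 -> ideal_regular_simplex kappa v ->
  gram_shape (- d%:R^-1).
Proof.
move=> kneg [_ [s dist] _ norm].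
have k0 : kappa != 0 by rewrite lt_eqF.
have nE i : dotv (v i) (v i) = (- kappa)^-1.
  by rewrite -enorm_sqr norm exprVn sqr_sqrtr// oppr_ge0 ltW.
have s0 : 0 < s ^+ 2 by rewrite -(dist _ _ i01) enorm_sqr dotv_gt0// v_neq.
pose h := - kappa * s ^+ 2 / 2.
have h0 : 0 < h by rewrite /h divr_gt0// mulr_gt0// oppr_gt0.
have HE i j : 1 + kappa * dotv (v i) (v j) = 1 * 1 * (- h * (i == j)%:R + h).
  have [<-|ij] := eqVneq i j.
    rewrite [RHS](_ : _ = 0); last by rewrite /=; ring.
    by rewrite nE invrN mulrN divff// subrr.
  have := dist _ _ ij; move=> /(congr1 (fun r => r ^+ 2)).
  rewrite enorm_sqr !(dotvDl, dotvDr, dotvNl, dotvNr) (dotvC (v j)) !nE /h => <-.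
  by rewrite mulr0; field.
have [_ _ KE] := gram_inverse Av sumc sumA sumcv decomp d0 k0
  (fun _ => oner_neq0 R) HE.
have kh : 0 < kappa / - h by rewrite -mulrNN -invrN opprK divr_gt0// oppr_gt0.
exists (fun=> Num.sqrt (kappa / - h)) => [_|i j]; first by rewrite sqrtr_gt0.
rewrite KE mulr1 divr1 -expr2 sqr_sqrtr ?ltW//; congr (_ * (_ - _)).
have dn : d%:R != 0 :> R by rewrite pnatr_eq0 -lt0n.
have -> : - h + d.+1%:R * h = d%:R * h by rewrite -natr1; ring.
by rewrite invfM mulrCA divff ?gt_eqF// mulr1.
Qed.

End simplex_gram.

(** * Conversion of [lam] into the parameters of the statement *)

Section angle_parameters.
Context {R : realType}.
Implicit Types (C lam : R).

(** Since [1 + n lam = (1 + k C) / (1 + d C)], the positivity already obtained at the face also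
    shows that the denominator [1 + k C] is nonzero. *)
Lemma simplex_external_parameter (d k n : nat) C : (k + n = d)%N ->
  1 + d%:R * C != 0 -> 0 < 1 + n%:R * - (C / (1 + d%:R * C)) ->
  - (- (C / (1 + d%:R * C))) / (1 + n%:R * - (C / (1 + d%:R * C))) = C / (1 + k%:R * C).
Proof.
move=> <- D0 pos; rewrite natrD in D0 pos *.
have E : 1 + n%:R * - (C / (1 + (k%:R + n%:R) * C)) =
   (1 + k%:R * C) / (1 + (k%:R + n%:R) * C) by field.
rewrite E in pos *.
have k0 : 1 + k%:R * C != 0 by apply: contraTneq pos => ->; rewrite mul0r ltxx.
by field; rewrite D0 k0.
Qed.

Lemma cube_external_parameter (d k n : nat) C lam : (k + n = d)%N ->
  0 < 1 + d%:R * lam -> 0 < 1 + n%:R * lam -> C - 1 = - 2 * lam / (1 + d%:R * lam) ->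
  - lam / (1 + n%:R * lam) = (C - 1) / (2 + k%:R * (C - 1)).
Proof.
move=> <- D0 n0 ->; rewrite natrD in D0 *.
have E : 2 + k%:R * (- 2 * lam / (1 + (k%:R + n%:R) * lam)) =
  2 * (1 + n%:R * lam) / (1 + (k%:R + n%:R) * lam) by field; rewrite gt_eqF.
by rewrite E; field; rewrite !gt_eqF.
Qed.

Lemma cube_internal_parameter (d : nat) C lam :
  0 < 1 + d%:R * lam -> C - 1 = - 2 * lam / (1 + d%:R * lam) ->
  lam = - ((C - 1) / (2 + d%:R * (C - 1))).
Proof.
move=> D0 ->.
have -> : 2 + d%:R * (- 2 * lam / (1 + d%:R * lam)) = 2 / (1 + d%:R * lam).
  by field; rewrite gt_eqF.
by field; rewrite gt_eqF.
Qed.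

Lemma ideal_external_parameter (d k n : nat) : (k + n = d)%N -> (0 < d)%N ->
  0 < 1 + n%:R * - (d%:R : R)^-1 ->
  - (- (d%:R : R)^-1) / (1 + n%:R * - (d%:R : R)^-1) = k%:R^-1.
Proof.
move=> knd d0 pos.
have dn : d%:R != 0 :> R by rewrite pnatr_eq0 -lt0n.
have E : 1 + n%:R * - (d%:R : R)^-1 = k%:R / d%:R.
  have -> : k%:R = d%:R - n%:R :> R by rewrite -knd natrD addrK.
  by field.
rewrite E in pos *.
have kn : k%:R != 0 :> R by apply: contraTneq pos => ->; rewrite mul0r ltxx.
by field; rewrite dn kn.
Qed.

Local Open Scope complex_scope.

Lemma sqrt_real_inv (n : nat) (x : R) :
  sqrt_real (n%:R^-1) * x%:C = (x / Num.sqrt n%:R)%:C.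
Proof.
rewrite /sqrt_real invr_ge0 ler0n -(rmorphM (real_complex R)).
by rewrite sqrtrV ?ler0n// mulrC.
Qed.

Lemma sqrt_real_opp_inv (n : nat) (x : R) : (0 < n)%N ->
  sqrt_real (- n%:R^-1) * x%:C = 0 +i* (x / Num.sqrt n%:R).
Proof.
move=> n0; rewrite /sqrt_real oppr_ge0 leNgt invr_gt0 ltr0n n0/= opprK.
by rewrite sqrtrV ?ler0n//; simpc; rewrite mulrC.
Qed.

End angle_parameters.

Local Open Scope complex_scope.

Theorem theorem1p1 (R : realType) (d : nat) (hd : (2 <= d)%N)
    (kappa : R) (k : nat) (hk : (k < d)%N)
    (dT : measure_display) (T : measurableType dT) (Pr : probability T R)
    (xi : {RV Pr >-> R}) (hxi : standard_normal xi)
    (l : R) (hl : 0 < l) :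
  let C := curvature_cos kappa l in
  (forall v : 'I_d.+1 -> 'rV[R]_d, regular_simplex kappa l v ->
   forall F : set 'rV[R]_d, is_face F (convex_hull v) -> affine_dim F = k ->
   forall (m : nat) (a : 'I_m -> 'rV[R]_d) (b : 'I_m -> R),
     irredundant_Hrep (convex_hull v) a b ->
   forall x, relint F x -> klein_ball kappa x ->
     has_mean Pr
       (fun w => Phi (sqrt_real (C / (1 + k%:R * C)) * (xi w)%:C) ^+ (d - k))
       (external_angle kappa x a b F)%:C /\
     has_mean Pr
       (fun w => Phi (sqrt_real (- (C / (1 + d%:R * C))) * (xi w)%:C) ^+ (d - k))
       (internal_angle kappa x a b F)%:C)
  /\
  (forall tau : R, @regular_cube R d kappa l tau ->
   forall F : set 'rV[R]_d, is_face F (cube tau) -> affine_dim F = k ->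
   forall (m : nat) (a : 'I_m -> 'rV[R]_d) (b : 'I_m -> R),
     irredundant_Hrep (cube tau) a b ->
   forall x, relint F x -> klein_ball kappa x ->
     has_mean Pr
       (fun w => Phi (sqrt_real ((C - 1) / (2 + k%:R * (C - 1))) * (xi w)%:C)
                 ^+ (d - k))
       (external_angle kappa x a b F)%:C /\
     has_mean Pr
       (fun w => Phi (sqrt_real (- ((C - 1) / (2 + d%:R * (C - 1)))) * (xi w)%:C)
                 ^+ (d - k))
       (internal_angle kappa x a b F)%:C)
  /\
  (kappa < 0 -> (1 <= k)%N ->
   forall P : set 'rV[R]_d,
     (exists2 v : 'I_d.+1 -> 'rV[R]_d,
        ideal_regular_simplex kappa v & P = convex_hull v) \/ P = ideal_cube kappa ->
   forall F : set 'rV[R]_d, is_face F P -> affine_dim F = k ->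
   forall (m : nat) (a : 'I_m -> 'rV[R]_d) (b : 'I_m -> R),
     irredundant_Hrep P a b ->
   forall x, relint F x -> klein_ball kappa x ->
     has_mean Pr
       (fun w => Phi (xi w / Num.sqrt k%:R)%:C ^+ (d - k))
       (external_angle kappa x a b F)%:C /\
     has_mean Pr
       (fun w => Phi (0 +i* (xi w / Num.sqrt d%:R)) ^+ (d - k))
       (internal_angle kappa x a b F)%:C).

Proof.
move=> C; have d0 : (0 < d)%N := ltnW hd.
split; [|split].
- move=> v reg F FP Fk m a b [PE _ _] x xF xB.
  have [vfree _ _] := reg.
  have [A [c [Av sumc sumA sumcv decomp]]] := barycentric_exists vfree.
  have [D0 [del del0 gram]] := regular_simplex_gram hd Av sumc sumA sumcv decomp reg.
  have [knd n0 ext int] :=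
    simplex_angles Av sumc sumA sumcv decomp PE FP xF xB Fk hxi del0 gram.
  rewrite -(simplex_external_parameter knd D0 n0).
  by split; [exact: ext|exact: int].
- move=> tau reg F FP Fk m a b [PE _ _] x xF xB.
  have [tau0 _ _] := reg.
  have [D0 CE] := regular_cube_curvature hd reg.
  have [knd n0 ext int] := cube_angles tau0 PE FP xF xB Fk hxi.
  rewrite -(cube_external_parameter knd D0 n0 CE) -(cube_internal_parameter D0 CE).
  by split; [exact: ext|exact: int].
- move=> kneg k1 P PP F FP Fk m a b [PE _ _] x xF xB.
  (* Both ideal polytopes have the parameter [lam = - 1 / d], which is why their angle formulas
     coincide. *)
  suff [knd n0 ext int] : let lam := - d%:R^-1 in let n := (d - k)%N in
      [/\ (k + n = d)%N, 0 < 1 + n%:R * lam,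
      has_mean Pr (fun t => Phi (sqrt_real (- lam / (1 + n%:R * lam)) * (xi t)%:C) ^+ n)
        (external_angle kappa x a b F)%:C &
      has_mean Pr (fun t => Phi (sqrt_real lam * (xi t)%:C) ^+ n)
        (internal_angle kappa x a b F)%:C].
    rewrite (ideal_external_parameter knd d0 n0) in ext.
    split.
      by move: ext; under eq_fun do rewrite sqrt_real_inv.
    by move: int; under eq_fun do rewrite (sqrt_real_opp_inv _ d0).
  case: PP => [[v reg PvE]|PcE].
    have [vfree _ _ _] := reg.
    have [A [c [Av sumc sumA sumcv decomp]]] := barycentric_exists vfree.
    have [del del0 gram] := ideal_simplex_gram hd Av sumc sumA sumcv decomp kneg reg.
    rewrite PvE in PE FP.
    exact: (simplex_angles Av sumc sumA sumcv decomp PE FP xF xB Fk hxi del0 gram).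
  rewrite PcE /ideal_cube in PE FP.
  have kd : 0 < - kappa * d%:R by rewrite mulr_gt0 ?oppr_gt0// ltr0n.
  have tau0 : 0 < (Num.sqrt (- kappa * d%:R))^-1 by rewrite invr_gt0 sqrtr_gt0.
  (* For the ideal cube [tau ^+ 2 = 1 / (- kappa * d)], so [kappa * tau ^+ 2] is the required
     parameter. *)
  have -> : - d%:R^-1 = kappa * (Num.sqrt (- kappa * d%:R))^-1 ^+ 2.
    rewrite exprVn sqr_sqrtr ?ltW//; field.
    by rewrite pnatr_eq0 -lt0n d0 lt_eqF.
  exact: (cube_angles tau0 PE FP xF xB Fk hxi).
Qed.
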